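(* Let $a>0$ and $T>0$, and let $u_0,w_0\in BV(\mathbb{R})\cap L^1(\mathbb{R})$ satisfy $|u_0(x)-w_0(x)|\le a$ for almost every $x\in\mathbb{R}$. Then there exists a couple of functions $u,w\in L^1(\mathbb{R}\times[0,T))$ such that $(u,w)$ is a weak solution, in the sense defined in the context, of the Cauchy problem with Play hysteresis (of amplitude $a$) and initial data $u_0,w_0$.
   Context: Let $a>0$ and $\mathbb{R}_T:=\mathbb{R}\times[0,T)$. The Cauchy problem considered is formally $$u_t+w_t+u_x=0\ \text{ in }\mathbb{R}_T,\qquad w=\mathcal{F}(u,w_0),\qquad u(x,0)=u_0(x),\quad w(x,0)=w_0(x)\ \text{ in }\mathbb{R},$$ where $\mathcal{F}$ is the Play hysteresis operator of amplitude $a$, applied to $t\mapsto u(x,t)$ for a.e. fixed $x$ with initial output $w_0(x)$. The precise notion of solution is the following. Definition (weak solution). A couple of $L^1_{loc}$ functions $u,w:\mathbb{R}_T\to\mathbb{R}$ is a weak solution if: (i) for every $C^1$ function $\phi$ with compact support in $\mathbb{R}_T=\mathbb{R}\times[0,T)$, $$\int_0^{T}\int_{-\infty}^{+\infty}\big[(u+w)\phi_t+u\,\phi_x\big]\,dx\,dt+\int_{-\infty}^{+\infty}(u_0(x)+w_0(x))\,\phi(x,0)\,dx=0;$$ (ii) $|u(x,t)-w(x,t)|\le a$ for almost every $(x,t)\in\mathbb{R}_T$; (iii) the distributional derivative $\frac{\partial w}{\partial t}$ is a (signed) measure on $\mathbb{R}_T$ and, for almost every $t\in(0,T)$, $$\frac12\int_{\mathbb{R}}\big(u(x,t)^2-u_0(x)^2\big)\,dx+\frac12\int_{\mathbb{R}}\big(w(x,t)^2-w_0(x)^2\big)\,dx\le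 -a\,\Big|\frac{\partial w}{\partial t}\Big|(\mathbb{R}\times(0,t)),$$ where $\big|\frac{\partial w}{\partial t}\big|$ denotes the total variation measure of $\frac{\partial w}{\partial t}$. *)

(* Defs.v *)
From HB Require Import structures.
From mathcomp Require Import all_boot all_order all_algebra.
From mathcomp Require Import all_classical all_reals all_analysis.

Set Implicit Arguments.
Unset Strict Implicit.
Unset Printing Implicit Defensive.

Import Order.TTheory GRing.Theory Num.Theory.
Import numFieldNormedType.Exports.

Local Open Scope classical_set_scope.
Local Open Scope ring_scope.

(* Points of the plane are pairs (x, t), space variable first. *)
Notation plane R := (measurableTypeR R * measurableTypeR R)%type.

Definition leb1 {R : realType} : {measure set (measurableTypeR R) -> \bar R} :=
  lebesgue_measure.

Definition leb2 {R : realType} : {measure set (plane R) -> \bar R} :=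
  (lebesgue_measure \x lebesgue_measure)%E.

Definition strip {R : realType} (T : R) : set (R * R) := setT `*` `[0, T[.

Definition open_strip {R : realType} (T : R) : set (R * R) := setT `*` `]0, T[.

Definition dx {R : realType} (f : R * R -> R) : R * R -> R :=
  fun z => 'D_(1, 0) f z.

Definition dt {R : realType} (f : R * R -> R) : R * R -> R :=
  fun z => 'D_(0, 1) f z.

Fixpoint Ck {R : realType} (k : nat) (f : R * R -> R) : Prop :=
  if k is j.+1 then
    [/\ continuous f,
        forall z, derivable f z (1, 0) /\ derivable f z (0, 1),
        Ck j (dx f) & Ck j (dt f)]
  else continuous f.

(* [strip T] contains its bottom edge t = 0, where [phi] need not vanish.
   A C^1 function up to the edge is represented by a C^1 extension to the
   plane, whose values outside the strip are irrelevant. *)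
Definition C1_compact_support_in_strip {R : realType} (T : R)
    (phi : R * R -> R) : Prop :=
  Ck 1 phi /\
  exists K : set (R * R), [/\ compact K, K `<=` strip T &
    forall z, strip T z -> ~ K z -> phi z = 0].

Definition test_function {R : realType} (T : R) (phi : R * R -> R) : Prop :=
  (forall k, Ck k phi) /\
  exists K : set (R * R), [/\ compact K, K `<=` open_strip T &
    forall z, ~ K z -> phi z = 0].

(* The library's [locally_integrable] is restricted to open subsets of the
   line. *)
Definition L1loc_strip {R : realType} (T : R) (f : R * R -> R) : Prop :=
  measurable_fun (strip T : set (plane R)) (f : plane R -> measurableTypeR R) /\
  forall K : set (R * R), compact K -> K `<=` strip T ->
    leb2.-integrable (K : set (plane R)) (EFin \o f).

Definition total_variation_line {R : realType} (f : R -> R) : \bar R :=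
  ereal_sup [set total_variation p.1 p.2 f | p in [set p : R * R | p.1 <= p.2]].

(* Functions are taken modulo equality almost everywhere: f is in BV(R) if one
   of its representatives has finite total variation on the line. *)
Definition BV_line {R : realType} (f : R -> R) : Prop :=
  exists g : R -> R, {ae leb1, forall x, f x = g x} /\
    (total_variation_line g < +oo)%E.

Definition jordan_integral {R : realType} (nu : {charge set (plane R) -> \bar R})
    (P N : set (plane R)) (nuPN : hahn_decomposition nu P N)
    (f : R * R -> R) : R :=
  \int[jordan_pos nuPN]_z f z - \int[jordan_neg nuPN]_z f z.

Definition is_distributional_dt {R : realType} (T : R) (w : R * R -> R)
    (nu : {charge set (plane R) -> \bar R})
    (P N : set (plane R)) (nuPN : hahn_decomposition nu P N) : Prop :=
  forall phi, test_function T phi ->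
    \int[leb2]_(z in strip T) (w z * dt phi z) = - jordan_integral nuPN phi.

(* A charge is a finite signed measure. Finiteness loses nothing when the
   initial data are square integrable, since the energy inequality bounds the
   variation on R x (0, T). The Hahn decomposition of nu is auxiliary: the
   Jordan decomposition and the variation do not depend on it. The two integrals
   on the left of the inequality are extended real integrals; for square
   integrable initial data neither can be -oo, so the inequality makes both of
   them finite. *)
Definition energy_condition {R : realType} (a T : R) (u0 w0 : R -> R)
    (u w : R * R -> R) : Prop :=
  exists (nu : {charge set (plane R) -> \bar R}) (P N : set (plane R))
         (nuPN : hahn_decomposition nu P N),
    is_distributional_dt T w nuPN /\
    {ae leb1, forall t : R, t \in `]0, T[ ->
      (2^-1%:E * (\int[leb1]_x (u (x, t) ^+ 2 - u0 x ^+ 2)%:E)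
       + 2^-1%:E * (\int[leb1]_x (w (x, t) ^+ 2 - w0 x ^+ 2)%:E)
       <= - (a%:E * charge_variation nuPN (open_strip t)))%E}.

Definition weak_solution {R : realType} (a T : R) (u0 w0 : R -> R)
    (u w : R * R -> R) : Prop :=
  [/\ L1loc_strip T u, L1loc_strip T w,
      forall phi, C1_compact_support_in_strip T phi ->
        \int[leb2]_(z in strip T) ((u z + w z) * dt phi z + u z * dx phi z)
        + \int[leb1]_x ((u0 x + w0 x) * phi (x, 0)) = 0,
      {ae leb2, forall z : R * R, strip T z -> `|u z - w z| <= a} &
      energy_condition a T u0 w0 u w].

(* Main.v *)
(** Splitting scheme. With tau = T / (N + 1), transport u to the right for a time
    tau, then project the pair (u, w) onto the constraint |u - w| <= a along the
    direction in which u + w is constant, and repeat. The interpolants satisfy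
    the weak equation and the energy inequality exactly, and the constraint up to
    an error that tends to 0 with tau. The energy is controlled because a slip e
    of w dissipates at least a |e|. The total upward and downward variations p
    and q of w at a point x are bounded because, by finite propagation along
    characteristics, the time variation of u at x is at most the space variation
    of u0.

    Compactness is replaced by convexity: the constraints on (u, p, q), where
    w = w0 + p - q, are convex, so nearly L2-minimal approximate solutions form a
    Cauchy sequence and converge almost everywhere, up to a choice of rates.

    The distributional derivative of p, nondecreasing and bounded in t, is the
    image of the plane Lebesgue measure on {(x, y) : 0 < y <= M} under
    (x, y) |-> (x, theta(x, y)), where theta(x, y) is the time at which p(x, .)
    passes the level y; likewise for q, and the derivative of w is the difference
    of the two measures. *)
From HB Require Import structures.
Require Import Defs.
From mathcomp Require Import all_boot all_order all_algebra.
From mathcomp Require Import all_classical all_reals all_analysis.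
From mathcomp Require Import measurable_realfun.
From mathcomp Require Import ring lra.

Set Implicit Arguments.
Unset Strict Implicit.
Unset Printing Implicit Defensive.

Import Order.TTheory GRing.Theory Num.Theory.
Import numFieldNormedType.Exports.

Local Open Scope classical_set_scope.
Local Open Scope ring_scope.

(** * Integration on the plane *)

(** The play relation itself does not survive averaging, but the notion of solution keeps only the
    constraint and the energy inequality. The inequality becomes convex once the variation of [w] is
    replaced by [p + q], which is linear in the unknowns. Nothing is lost: the derivative of [w] is
    a difference of two positive measures whose masses up to time [t] are at most the integrals of
    [p] and [q], and this bounds its variation whether or not they are mutually singular.

    Only the constraint carries an error [eps], since transport between two projections violates it;
    all other conditions are exact. Letting [eps] decrease thus gives nested convex sets. That they
    are bounded in L2 is not automatic for [p] and [q]: the dissipation [a * (p + q)] bounds their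
    integrals, and the pointwise bound [M] turns this into a bound on squares.

    Values are followed along characteristics, so the data are first replaced by representatives
    satisfying the constraint and the variation bounds at every point. *)

Section MeasurableComparison.
Context {d : measure_display} {T : measurableType d} {R : realType}.
Variables (f g : T -> R).
Hypotheses (mf : measurable_fun setT f) (mg : measurable_fun setT g).

Lemma measurable_lt_set : measurable [set z | f z < g z].
Proof.
rewrite (_ : [set _ | _] = setT `&` (fun z => f z < g z) @^-1` [set true]).
  by apply: measurable_fun_ltr.
by rewrite setTI.
Qed.

Lemma measurable_le_set : measurable [set z | f z <= g z].
Proof.
rewrite (_ : [set _ | _] = setT `&` (fun z => f z <= g z) @^-1` [set true]).
  by apply: measurable_fun_ler.
by rewrite setTI.
Qed.

End MeasurableComparison.

Lemma le_integral_EFin d (T : measurableType d) (R : realType)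
    (nu : {measure set T -> \bar R}) (D : set T) (f g : T -> R) :
  measurable D -> measurable_fun D f -> measurable_fun D g ->
  (forall x, D x -> 0 <= f x) -> (forall x, D x -> f x <= g x) ->
  (\int[nu]_(x in D) (f x)%:E <= \int[nu]_(x in D) (g x)%:E)%E.
Proof.
move=> mD mf mg f0 fg; apply: ge0_le_integral => //.
- exact/measurable_EFinP.
- exact/measurable_EFinP.
Qed.

Section EFinIntegral.
Context d (T : measurableType d) (R : realType).
Variables (nu : {measure set T -> \bar R}) (D : set T).
Hypothesis mD : measurable D.

Lemma ge0_integralZl_real (c : R) (f : T -> R) : 0 <= c -> measurable_fun D f ->
  (forall x, D x -> 0 <= f x) ->
  (\int[nu]_(x in D) (c * f x)%:E = c%:E * \int[nu]_(x in D) (f x)%:E)%E.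
Proof.
move=> c0 mf f0; under eq_integral do rewrite EFinM.
by rewrite ge0_integralZl_EFin//; exact/measurable_EFinP.
Qed.

Lemma ge0_integralD_real (f g : T -> R) : measurable_fun D f -> measurable_fun D g ->
  (forall x, D x -> 0 <= f x) -> (forall x, D x -> 0 <= g x) ->
  (\int[nu]_(x in D) (f x + g x)%:E =
   \int[nu]_(x in D) (f x)%:E + \int[nu]_(x in D) (g x)%:E)%E.
Proof.
move=> mf mg f0 g0; under eq_integral do rewrite EFinD.
by rewrite ge0_integralD//; exact/measurable_EFinP.
Qed.

Lemma integral_midpoint_le (f g h : T -> R) (K : R) :
  measurable_fun D f -> measurable_fun D g -> measurable_fun D h ->
  (forall x, D x -> 0 <= f x) -> (forall x, D x -> 0 <= g x) ->
  (forall x, D x -> 0 <= h x <= 2^-1 * (f x + g x)) ->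
  (\int[nu]_(x in D) (f x)%:E <= K%:E)%E ->
  (\int[nu]_(x in D) (g x)%:E <= K%:E)%E ->
  (\int[nu]_(x in D) (h x)%:E <= K%:E)%E.
Proof.
move=> mf mg mh f0 g0 hfg fK gK.
have mfg := measurable_funD mf mg.
apply: (@le_trans _ _ (\int[nu]_(x in D) (2^-1 * (f x + g x))%:E)%E).
  apply: le_integral_EFin => //; first exact: measurable_funM.
  - by move=> x Dx; have /andP[] := hfg x Dx.
  - by move=> x Dx; have /andP[] := hfg x Dx.
rewrite (ge0_integralZl_real _ mfg)//; last first.
  by move=> x Dx; rewrite addr_ge0 ?f0 ?g0.
rewrite ge0_integralD_real//.
apply: (@le_trans _ _ ((2^-1)%:E * (K%:E + K%:E))%E).
  by rewrite lee_wpmul2l ?lee_fin ?invr_ge0// leeD.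
by rewrite -EFinD -EFinM lee_fin; lra.
Qed.

End EFinIntegral.

Section PlaneMeasure.
Context {R : realType}.
Local Notation mu := (@lebesgue_measure R).

Lemma measurable_shift (s : R) : measurable_fun setT (fun x : R => x - s).
Proof. by apply: measurable_funB => //; exact: measurable_cst. Qed.

Lemma lebesgue_measure_shift (s : R) (A : set R) : measurable A ->
  mu ((fun x : R => x - s) @^-1` A) = mu A.
Proof.
move=> mA.
pose m : {measure set (measurableTypeR R) -> \bar R} :=
  measure_function_pushforward__canonical__measure_function_Measure
    lebesgue_measure (measurable_shift s : @measurable_fun _ _ (measurableTypeR R) (measurableTypeR R) setT (fun x : R => x - s)).
suff /(_ A mA) : forall A, measurable A -> lebesgue_measure A = m A by [].
apply: lebesgue_measure_unique => X [[a b] /= _ <-].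
rewrite /m/= /pushforward.
have -> : (fun x : R => x - s) @^-1` `]a, b] = `]a + s, b + s]%classic.
  by apply/seteqP; split => x /=; rewrite !in_itv/= ltrBrDr lerBlDr.
by rewrite !lebesgue_measure_itv/= !lte_fin ltrD2r; case: ifPn => // _;
   rewrite -!EFinD; congr EFin; ring.
Qed.

Lemma ge0_integral_shift (s : R) (f : R -> \bar R) :
  measurable_fun setT f -> (forall x, 0 <= f x)%E ->
  (\int[mu]_x f (x - s)%R = \int[mu]_x f x)%E.
Proof.
move=> mf f0.
have := @ge0_integral_pushforward _ _ (measurableTypeR R) (measurableTypeR R)
  R (fun x : R => x - s) (measurable_shift s) mu setT f (@measurableT _ _) mf
  (fun x _ => f0 x).
rewrite preimage_setT => <-.
by apply: eq_measure_integral => [|? A mA _]; [exact: measurable_shift|exact: (@lebesgue_measure_shift s A mA)].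
Qed.

Lemma integral_shift (s : R) (f : R -> \bar R) : measurable_fun setT f ->
  (\int[mu]_x f (x - s)%R = \int[mu]_x f x)%E.
Proof.
move=> mf; rewrite integralE [RHS]integralE.
rewrite -(@ge0_integral_shift s _ (measurable_funepos mf) (funepos_ge0 f)).
rewrite -(@ge0_integral_shift s _ (measurable_funeneg mf) (funeneg_ge0 f)).
by congr (_ - _)%E; apply: eq_integral => x _; rewrite 1?funepos_comp 1?funeneg_comp.
Qed.

(** The plane carries the product sigma-algebra, so an open set is exhibited as a countable union of
    rectangles: the balls of the maximum norm with rational centre and radius that it contains. *)
Lemma open_measurable_plane (U : set (R * R)) : open U -> measurable U.
Proof.
move=> oU.
pose box (q : rat * rat * rat) : set (R * R) :=
  ball (ratr q.1.1 : R) (ratr q.2 : R) `*` ball (ratr q.1.2 : R) (ratr q.2 : R).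
pose F (q : rat * rat * rat) : set (R * R) :=
  if `[< box q `<=` U >] then box q else set0.
have -> : U = \bigcup_q F q.
  apply/seteqP; split => [z Uz|z [q _]]; last first.
    by rewrite /F; case: asboolP => // h /h.
  have : nbhs z U by exact: open_nbhs_nbhs.
  rewrite -nbhs_ballE => -[e /= e0 eU].
  have e2 : 0 < e / 2 by lra.
  have [r] := rat_in_itvoo e2.
  rewrite in_itv/= => /andP[r0 re].
  have apx (x : R) : exists q : rat, `|x - ratr q| < ratr r.
    have rr : x - ratr r < x + ratr r by lra.
    have [q] := rat_in_itvoo rr.
    by rewrite in_itv/= => q_; exists q; rewrite ltr_norml; lra.
  have [q1 h1] := apx z.1; have [q2 h2] := apx z.2.
  exists (q1, q2, r) => //; rewrite /F asboolT.
    by split; rewrite /box/= -ball_normE /= distrC.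
  move=> y [/=]; rewrite -!ball_normE /= => k1 k2.
  apply: eU; split; rewrite -ball_normE/=.
    by have := ler_distD (ratr q1) z.1 y.1; lra.
  by have := ler_distD (ratr q2) z.2 y.2; lra.
apply: countable_bigcupT_measurable => [|q]; first exact: countableP.
by rewrite /F; case: asboolP => // _; apply: measurableX; exact: measurable_ball.
Qed.

Lemma continuous_measurable_plane (f : R * R -> R) :
  continuous f -> measurable_fun setT f.
Proof.
move=> cf; apply: (measurability (RGenOInfty.G (R := R))).
  exact: RGenOInfty.measurableE.
move=> _ [_ [x ->] <-]; rewrite setTI.
by apply: open_measurable_plane; move/continuousP : cf; apply; exact: interval_open.
Qed.

Lemma measurable_rect (I : set R) : measurable I ->
  measurable ([set: R] `*` I).
Proof. by move=> mI; apply: measurableX. Qed.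

Section rect.
Variables (I : set R) (mI : measurable I).
Let D := [set: R] `*` I.

Lemma patch_rect (f : R * R -> \bar R) x t : (f \_ D) (x, t) =
  ((fun t => f (x, t)) \_ I) t.
Proof.
rewrite !patchE; case: ifPn; rewrite ?inE ?notin_setE => h.
  by rewrite mem_set//; case: h.
by rewrite memNset// => It; apply: h.
Qed.

Lemma measurable_patch_rect (f : R * R -> \bar R) : measurable_fun setT f ->
  measurable_fun setT (f \_ D).
Proof.
move=> mf; apply/(measurable_restrictT _ _).1; first exact: measurable_rect.
exact: measurable_funS mf.
Qed.

Lemma integrable_patch_rect (f : R * R -> \bar R) : leb2.-integrable D f ->
  (mu \x mu)%E.-integrable setT (f \_ D).
Proof.
by move=> fi; apply/(@integrable_mkcond _ _ _ leb2 D f) => //; exact: measurable_rect.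
Qed.

Lemma tonelli_rect12 (f : R * R -> \bar R) : measurable_fun setT f ->
  (forall z, 0 <= f z)%E ->
  (\int[leb2]_(z in D) f z = \int[mu]_x \int[mu]_(t in I) f (x, t))%E.
Proof.
move=> mf f0; rewrite integral_mkcond [LHS]fubini_tonelli1/=; last 2 first.
- exact: measurable_patch_rect.
- by move=> z; rewrite patchE; case: ifP.
apply: eq_integral => x _; rewrite /fubini_F [RHS]integral_mkcond.
by apply: eq_integral => t _; exact: patch_rect.
Qed.

Lemma tonelli_rect21 (f : R * R -> \bar R) : measurable_fun setT f ->
  (forall z, 0 <= f z)%E ->
  (\int[leb2]_(z in D) f z = \int[mu]_(t in I) \int[mu]_x f (x, t))%E.
Proof.
move=> mf f0; rewrite integral_mkcond [LHS]fubini_tonelli2/=; last 2 first.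
- exact: measurable_patch_rect.
- by move=> z; rewrite patchE; case: ifP.
rewrite [RHS]integral_mkcond; apply: eq_integral => t _.
rewrite /fubini_G !patchE; case: ifPn => tI.
  by apply: eq_integral => x _; rewrite patch_rect patchE tI.
by apply: integral0_eq => x _; rewrite patch_rect patchE (negbTE tI).
Qed.

Lemma fubini_rect12 (f : R * R -> \bar R) : measurable_fun setT f ->
  leb2.-integrable D f ->
  (\int[leb2]_(z in D) f z = \int[mu]_x \int[mu]_(t in I) f (x, t))%E.
Proof.
move=> mf /integrable_patch_rect fi.
rewrite integral_mkcond -[LHS](integral12_prod_meas1 fi).
apply: eq_integral => x _; rewrite /fubini_F [RHS]integral_mkcond.
by apply: eq_integral => t _; exact: patch_rect.
Qed.

Lemma integrable_rect12 (f : R * R -> \bar R) : measurable_fun setT f ->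
  leb2.-integrable D f ->
  mu.-integrable setT (fun x => \int[mu]_(t in I) f (x, t))%E.
Proof.
move=> mf /integrable_patch_rect fi.
have := integrable_fubini_F fi; apply: eq_integrable => // x _.
rewrite /fubini_F [RHS]integral_mkcond.
by apply: eq_integral => t _; exact: patch_rect.
Qed.

Lemma fubini_rect21 (f : R * R -> \bar R) : measurable_fun setT f ->
  leb2.-integrable D f ->
  (\int[leb2]_(z in D) f z = \int[mu]_(t in I) \int[mu]_x f (x, t))%E.
Proof.
move=> mf /integrable_patch_rect fi.
rewrite integral_mkcond -[LHS](integral21_prod_meas1 fi).
rewrite [RHS]integral_mkcond; apply: eq_integral => t _.
rewrite /fubini_G !patchE; case: ifPn => tI.
  by apply: eq_integral => x _; rewrite patch_rect patchE tI.
by apply: integral0_eq => x _; rewrite patch_rect patchE (negbTE tI).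
Qed.

End rect.
End PlaneMeasure.

(** * The projection onto the constraint and the splitting scheme *)

Section Projection.
Context {R : realType}.
Implicit Types a u v w g m : R.

(* A slip [e] changes [u - w] by [2 e], whence the factor [1 / 2]. *)
Definition excess a (d : R) : R := Num.max (d - a) 0 / 2.

Lemma excess_ge0 a d : 0 <= excess a d.
Proof. by rewrite /excess divr_ge0// le_max lexx orbT. Qed.

Variant excess_spec a d : R -> R -> Prop :=
| ExcessHigh of a < d : excess_spec a d ((d - a) / 2) 0
| ExcessNone of `|d| <= a : excess_spec a d 0 0
| ExcessLow of d < - a : excess_spec a d 0 ((- d - a) / 2).

Lemma excessP a d : 0 <= a -> excess_spec a d (excess a d) (excess a (- d)).
Proof.
move=> a0; rewrite /excess.
have [da|da] := ltP a d.
  rewrite max_l; last by lra.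
  by rewrite max_r ?mul0r; [constructor|lra].
have [da'|da'] := ltP d (- a).
  rewrite max_r; last by lra.
  by rewrite max_l ?mul0r; [constructor|lra].
by rewrite !max_r ?mul0r; [constructor; rewrite ler_norml; lra|lra|lra].
Qed.

(** The increment of [w] and the opposite of that of [u]: [d - 2 * slip a d] is the truncation of
    [d] to the interval from [- a] to [a]. *)
Definition slip a (d : R) : R := excess a d - excess a (- d).

Lemma excess0 a d : `|d| <= a -> excess a d = 0.
Proof.
by move=> /ler_normlP[h1 h2]; rewrite /excess max_r ?mul0r//; lra.
Qed.

Lemma slip0 a d : `|d| <= a -> slip a d = 0.
Proof. by move=> da; rewrite /slip !excess0// ?normrN// subrr. Qed.

Lemma norm_slip a d : 0 <= a -> `|slip a d| = excess a d + excess a (- d).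
Proof.
by move=> a0; rewrite /slip; case: (excessP d a0) => h;
  rewrite ?subr0 ?sub0r ?normrN ?addr0 ?add0r ?normr0// ger0_norm//; lra.
Qed.

Lemma slip_bound a d : 0 <= a -> `|d - 2 * slip a d| <= a.
Proof.
move=> a0; rewrite /slip; case: (excessP d a0) => h; rewrite ?ler_norml; last 1 first.
- lra.
- lra.
- by move: h; rewrite ler_norml; lra.
Qed.

(** Beyond the dissipation [a * |e|] of the slip [e], the energy loses exactly [e ^+ 2]; the two
    nontrivial cases exhibit this square. *)
Lemma slip_energy a u w (d := u - w) : 0 <= a ->
  (u - slip a d) ^+ 2 / 2 + (w + slip a d) ^+ 2 / 2
    + a * (excess a d + excess a (- d)) <= u ^+ 2 / 2 + w ^+ 2 / 2.
Proof.
move=> a0; rewrite /slip; case: (excessP d a0); rewrite /d => h; [|lra|];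
  rewrite -subr_ge0; set X := (X in 0 <= X).
- have -> : X = ((u - w - a) / 2) ^+ 2 by rewrite /X; field.
  exact: sqr_ge0.
- have -> : X = ((u - w + a) / 2) ^+ 2 by rewrite /X; field.
  exact: sqr_ge0.
Qed.

(** The l1 norm of the plane is the maximum norm of the sum and the difference of the coordinates,
    on each of which the projection acts separately. *)
Lemma norm_addl_le (p q M : R) :
  (`|p| + `|q| <= M) = (`|p + q| <= M) && (`|p - q| <= M).
Proof.
apply/idP/andP => [h|[h1 h2]].
  by split; [have := ler_normD p q|have := ler_normB p q]; lra.
move: h1 h2; rewrite !ler_norml.
by case: (ger0P p); case: (ger0P q); lra.
Qed.

(** On [u + w] the projection is the identity and on [u - w] a truncation, both 1-Lipschitz, so it
    is nonexpansive for the l1 norm. The translation and variation estimates of the scheme rest on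
    this. *)
Lemma slip_contraction a u w u' w' (e := slip a (u - w))
    (e' := slip a (u' - w')) : 0 <= a ->
  `|(u - e) - (u' - e')| + `|(w + e) - (w' + e')| <= `|u - u'| + `|w - w'|.
Proof.
move=> a0; rewrite norm_addl_le; apply/andP; split.
  apply: (le_trans _ (ler_normD (u - u') (w - w'))).
  by rewrite le_eqVlt; apply/orP; left; apply/eqP; congr (`|_|); ring.
apply: (le_trans _ (ler_normB (u - u') (w - w'))).
rewrite /e /e' /slip; case: (excessP (u - w) a0); case: (excessP (u' - w') a0);
  case: (ger0P (u - u' - (w - w'))) => ?; rewrite !ler_norml => *;
  lra.
Qed.

Lemma slip_norm a u w : 0 <= a ->
  `|u - slip a (u - w)| + `|w + slip a (u - w)| <= `|u| + `|w|.
Proof.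
move=> a0; have := @slip_contraction a u w 0 0 a0.
by rewrite subrr (@slip0 a 0) ?normr0// !subr0 !addr0 subr0.
Qed.

(** The slip moves [u] and [w] towards each other and, as [0 <= a], never past each other, so both
    stay between their old values. *)
Lemma slip_box a u w m : 0 <= a -> `|u| <= m -> `|w| <= m ->
  `|u - slip a (u - w)| <= m /\ `|w + slip a (u - w)| <= m.
Proof.
move=> a0; rewrite !ler_norml /slip => hu hw.
by case: (excessP (u - w) a0) => h; split; lra.
Qed.

(** Here [v] is the value of [u] before the step and [g] the incoming one. If [g - w = a + 2 * e]
    with [e > 0], the new value is [w + a + e], whereas [v <= w + a]; the other sign is symmetric. A
    slip thus forces a jump of [u] at least as large. *)
Lemma slip_le_jump a v w g : 0 <= a -> `|v - w| <= a ->
  `|slip a (g - w)| <= `|g - slip a (g - w) - v|.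
Proof.
move=> a0; rewrite ler_norml /slip; case: (excessP (g - w) a0) => h vw.
- rewrite !ger0_norm; lra.
- by rewrite subrr normr0.
- rewrite !ler0_norm; lra.
Qed.

End Projection.

Section Scheme.
Context {R : realType}.
Variables (a tau : R) (u0 w0 : R -> R).

(** The state consists of [u] and of the accumulated upward and downward slips. Only [u] is moved by
    [tau]; the output stays in place and is recomputed from [w0]. *)
Fixpoint scheme (n : nat) : (R -> R) * (R -> R) * (R -> R) :=
  if n is k.+1 then
    let s := scheme k in
    let d := fun x => s.1.1 (x - tau) - (w0 x + s.1.2 x - s.2 x) in
    (fun x => s.1.1 (x - tau) - slip a (d x),
     fun x => s.1.2 x + excess a (d x),
     fun x => s.2 x + excess a (- d x))
  else (u0, fun=> 0, fun=> 0).

Definition schemeU n := (scheme n).1.1.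
Definition schemeP n := (scheme n).1.2.
Definition schemeQ n := (scheme n).2.
Definition schemeW n x := w0 x + schemeP n x - schemeQ n x.

Local Notation U := schemeU.
Local Notation P := schemeP.
Local Notation Q := schemeQ.
Local Notation W := schemeW.
Local Notation d n x := (U n (x - tau) - W n x).

Lemma schemeUS n x : U n.+1 x = U n (x - tau) - slip a (d n x).
Proof. by []. Qed.

Lemma schemePS n x : P n.+1 x = P n x + excess a (d n x).
Proof. by []. Qed.

Lemma schemeQS n x : Q n.+1 x = Q n x + excess a (- d n x).
Proof. by []. Qed.

Lemma schemeWS n x : W n.+1 x = W n x + slip a (d n x).
Proof. by rewrite /W schemePS schemeQS /slip /W; ring. Qed.

Lemma scheme_conservation n x : U n.+1 x + W n.+1 x = U n (x - tau) + W n x.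
Proof. by rewrite schemeUS schemeWS; ring. Qed.

Lemma schemeP_ge0 n x : 0 <= P n x.
Proof. by elim: n => // n IH; rewrite schemePS addr_ge0// excess_ge0. Qed.

Lemma schemeQ_ge0 n x : 0 <= Q n x.
Proof. by elim: n => // n IH; rewrite schemeQS addr_ge0// excess_ge0. Qed.

Lemma schemeP_le n k x : (n <= k)%N -> P n x <= P k x.
Proof.
move=> /subnK <-; elim: (k - n)%N => // i IH.
by rewrite addSn schemePS (le_trans IH)// lerDl excess_ge0.
Qed.

Lemma schemeQ_le n k x : (n <= k)%N -> Q n x <= Q k x.
Proof.
move=> /subnK <-; elim: (k - n)%N => // i IH.
by rewrite addSn schemeQS (le_trans IH)// lerDl excess_ge0.
Qed.

Lemma measurable_excess (f : R -> R) : measurable_fun setT f ->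
  measurable_fun setT (fun x => excess a (f x)).
Proof.
move=> mf; apply: measurable_funM => //; apply: measurable_maxr => //.
by apply: measurable_funB.
Qed.

Lemma measurable_scheme n : measurable_fun setT u0 -> measurable_fun setT w0 ->
  [/\ measurable_fun setT (U n), measurable_fun setT (P n),
      measurable_fun setT (Q n) & measurable_fun setT (W n)].
Proof.
move=> mu0 mw0.
have mWPQ k : measurable_fun setT (P k) -> measurable_fun setT (Q k) ->
    measurable_fun setT (W k).
  move=> mP mQ.
  exact: (measurable_funB (measurable_funD mw0 mP) mQ).
elim: n => [|n [mU mP mQ mW]].
  have mP : measurable_fun setT (P 0) by exact: measurable_cst.
  have mQ : measurable_fun setT (Q 0) by exact: measurable_cst.
  by split => //; exact: mWPQ.
have ms : measurable_fun setT (fun x : R => U n (x - tau)).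
  by apply: measurableT_comp => //; apply: measurable_funB.
have md : measurable_fun setT (fun x : R => d n x) by exact: measurable_funB.
have me := measurable_excess md.
have me' := measurable_excess (measurable_funN md).
have mP' : measurable_fun setT (P n.+1) := measurable_funD mP me.
have mQ' : measurable_fun setT (Q n.+1) := measurable_funD mQ me'.
split => //; last exact: mWPQ.
exact: (measurable_funB ms (measurable_funB me me')).
Qed.

Hypothesis a0 : 0 <= a.
Hypothesis uw0 : forall x, `|u0 x - w0 x| <= a.

Lemma scheme_constraint n x : `|U n x - W n x| <= a.
Proof.
case: n => [|n]; first by rewrite /W /P /Q /= addr0 subr0.
rewrite schemeUS schemeWS.
have -> : U n (x - tau) - slip a (d n x) - (W n x + slip a (d n x)) =
          d n x - 2 * slip a (d n x) by ring.
exact: slip_bound.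
Qed.

Lemma scheme_box m : (forall x, `|u0 x| <= m) -> (forall x, `|w0 x| <= m) ->
  forall n x, `|U n x| <= m /\ `|W n x| <= m.
Proof.
move=> hu hw; elim => [|n IH] x; first by rewrite /W /P /Q/= addr0 subr0.
rewrite schemeUS schemeWS; apply: slip_box => //.
  by have [] := IH (x - tau).
by have [] := IH x.
Qed.

(** The step commutes with translations, so it can be compared with its own translate. The
    contraction controls only the sum of the two moduli, hence the translates of [W] are carried
    along. *)
Lemma scheme_translate n s x :
  `|U n.+1 (x - s) - U n.+1 x| + `|W n.+1 (x - s) - W n.+1 x| <=
  `|U n (x - tau - s) - U n (x - tau)| + `|W n (x - s) - W n x|.
Proof.
rewrite !schemeUS !schemeWS.
have -> : x - s - tau = x - tau - s by ring.
exact: slip_contraction.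
Qed.

Variables (V : R -> R) (M : R).
Hypothesis tau0 : 0 <= tau.
Hypothesis V_ge0 : forall x, 0 <= V x.
Hypothesis V_le : forall x, V x <= M.
Hypothesis uV : forall x y, y <= x -> `|u0 x - u0 y| <= V x - V y.

(* The time variation of [U] at [x] is transported along the characteristic
   through [x], while the last slip is absorbed by the next jump of [U]. *)
Lemma scheme_variation n x :
  \sum_(i < n.+1) `|U i.+1 x - U i x| + `|slip a (d n x)| <= V x - V (x - n.+1%:R * tau).
Proof.
(* The comparison pair [(U k y, W k y)] satisfies the constraint and is fixed by the projection, so
   the jump and the slip together cost at most the jump that transport alone would make. *)
have key k y : `|U k.+1 y - U k y| + `|slip a (d k y)| <= `|U k (y - tau) - U k y|.
  have := @slip_contraction R a (U k (y - tau)) (W k y) (U k y) (W k y) a0.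
  rewrite (slip0 (scheme_constraint k y)) subr0 addr0 subrr normr0 addr0.
  by rewrite schemeUS (addrC (W k y)) addrK.
elim: n x => [|n IH] x.
  rewrite big_ord_recr big_ord0/= add0r; apply: (le_trans (key _ _)).
  have xt : x - tau <= x by rewrite lerBlDr lerDl.
  by rewrite mul1r distrC; exact: uV xt.
rewrite big_ord_recl/= -addrA.
have -> : V x - V (x - n.+2%:R * tau) =
   (V x - V (x - tau)) + (V (x - tau) - V (x - tau - n.+1%:R * tau)).
  have -> : x - n.+2%:R * tau = x - tau - n.+1%:R * tau by rewrite -natr1; ring.
  by ring.
(* In the induction, the jump made by transport at step [k.+1] is at most the upstream jump at
   [y - tau] plus the slip of step [k], and that slip is already counted on the left of the
   induction hypothesis. *)
have step k y : \sum_(i < k) `|U i.+2 y - U i.+1 y| + `|slip a (d k y)| <=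
    \sum_(i < k) `|U i.+1 (y - tau) - U i (y - tau)| + `|slip a (d 0 y)|.
  elim: k => [|k IHk]; first by rewrite !big_ord0 !add0r.
  rewrite !big_ord_recr/=.
  have := key k.+1 y.
  have : `|U k.+1 (y - tau) - U k.+1 y| <=
      `|U k.+1 (y - tau) - U k (y - tau)| + `|slip a (d k y)|.
    rewrite (schemeUS k y); apply: (le_trans _ (ler_normD _ _)).
    rewrite le_eqVlt; apply/orP; left; apply/eqP; congr (`|_|); ring.
  by move: IHk; lra.
have := step n.+1 x; have := IH (x - tau); have := key 0%N x.
have : `|U 0 (x - tau) - U 0 x| <= V x - V (x - tau).
  have xt : x - tau <= x by rewrite lerBlDr lerDl.
  by rewrite distrC; exact: uV xt.
have := normr_ge0 (slip a (d n (x - tau))).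
rewrite /bump/= => ? ? ? ? H.
under [X in _ + (X + _)]eq_bigr do rewrite add1n.
by lra.
Qed.

(** Each slip is at most the jump of [U] in the same step, and the sum of these jumps is at most an
    increment of [V]. The bound is therefore uniform in [n], [x] and [tau]. *)
Lemma scheme_total n x : P n x + Q n x <= M.
Proof.
have M0 : 0 <= M by apply: le_trans (V_le 0).
case: n => [|n]; first by rewrite addr0.
have h : P n.+1 x + Q n.+1 x <= \sum_(i < n.+1) `|U i.+1 x - U i x|.
  elim: n => [|n IH].
    rewrite big_ord_recr big_ord0/= add0r schemePS schemeQS !add0r.
    rewrite -norm_slip// schemeUS; apply: slip_le_jump => //.
    exact: scheme_constraint.
  rewrite big_ord_recr/= schemePS schemeQS addrACA -norm_slip//.
  rewrite lerD//; rewrite schemeUS; apply: slip_le_jump => //.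
  exact: scheme_constraint.
have := scheme_variation n x; have := normr_ge0 (slip a (d n x)).
have := V_ge0 (x - n.+1%:R * tau); have := V_le x; lra.
Qed.

End Scheme.

(** * Functions of bounded variation *)

Section BV.
Context {R : realType}.
Local Notation mu := (@lebesgue_measure R).

(** [V x] is the variation of [g] on the half-line up to [x], a supremum over left endpoints;
    additivity of the variation bounds the increments of [g] by those of [V]. *)
Lemma BV_modulus (g : R -> R) : (total_variation_line g < +oo)%E ->
  exists (V : R -> R) (M : R), [/\ forall x, 0 <= V x <= M,
    {homo V : x y / x <= y} &
    forall x y, y <= x -> `|g x - g y| <= V x - V y].
Proof.
move=> gfin.
pose S x := ereal_sup [set total_variation a x g | a in [set a | a <= x]].
have tv_le a x : a <= x -> (total_variation a x g <= total_variation_line g)%E.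
  by move=> ax; apply: ereal_sup_ubound; exists (a, x).
have tv_S a x : a <= x -> (total_variation a x g <= S x)%E.
  by move=> ax; apply: ereal_sup_ubound; exists a.
have S0 x : (0 <= S x)%E.
  by apply: le_trans (tv_S x x (lexx x)); rewrite total_variation_ge0.
have S_le x : (S x <= total_variation_line g)%E.
  by apply: ge_ereal_sup => _ [a /= ax <-]; exact: tv_le.
have Sfin x : S x \is a fin_num.
  by rewrite ge0_fin_numE// (le_lt_trans (S_le x)).
have tvfin : total_variation_line g \is a fin_num.
  by rewrite ge0_fin_numE// (le_trans (S0 0) (S_le 0)).
have SD y x : y <= x -> (S y + total_variation y x g <= S x)%E.
  move=> yx; rewrite -leeBrDr; last first.
    rewrite ge0_fin_numE ?total_variation_ge0// (le_lt_trans (tv_le _ _ yx))//.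
  apply: ge_ereal_sup => _ [a /= ay <-].
  rewrite leeBrDr; last first.
    rewrite ge0_fin_numE ?total_variation_ge0// (le_lt_trans (tv_le _ _ yx))//.
  by rewrite -total_variationD//; apply: tv_S; exact: le_trans yx.
have key x y : y <= x -> `|g x - g y| <= fine (S x) - fine (S y).
  move=> yx; rewrite -lee_fin EFinB !fineK// leeBrDr// addeC.
  by apply: le_trans (SD _ _ yx); rewrite leeD2l// total_variation_ge.
exists (fine \o S), (fine (total_variation_line g)); split => //.
- move=> x /=; rewrite fine_ge0//=; exact: fine_le.
- by move=> x y xy /=; have := key _ _ xy; have := normr_ge0 (g y - g x); lra.
Qed.

Variables (V : R -> R) (M : R).
Hypothesis V_bnd : forall x, 0 <= V x <= M.
Hypothesis V_homo : {homo V : x y / x <= y}.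

Lemma lebesgue_diameter_le (A : set R) (s : R) : measurable A -> 0 <= s ->
  (forall x y, A x -> A y -> y - x <= s) -> (mu A <= s%:E)%E.
Proof.
move=> mA s0 hA; have [->|/set0P[x0 Ax0]] := eqVneq A set0.
  by rewrite measure0.
have lbA : has_lbound A by exists (x0 - s) => y Ay; have := hA _ _ Ay Ax0; lra.
have -> : s%:E = mu `[inf A, inf A + s].
  rewrite lebesgue_measure_itv/= lte_fin; case: ltP => h.
    by rewrite -EFinB; congr EFin; ring.
  by congr EFin; lra.
apply: le_measure => [||y Ay]; [by rewrite inE|by rewrite inE|].
rewrite /= in_itv/=; apply/andP; split; first exact: ge_inf.
rewrite -lerBlDr; apply: lb_le_inf; first by exists x0.
by move=> x Ax; have := hA _ _ Ax Ay; lra.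
Qed.

(** The integral is the area between the graphs of [V (x - s)] and [V x]. By monotonicity two points
    of a horizontal section are at most [s] apart, and the levels lie in []0, M]]. *)
Lemma BV_translate (s : R) : 0 <= s ->
  (\int[mu]_x (V x - V (x - s))%:E <= (s * M)%:E)%E.
Proof.
move=> s0.
have M0 : 0 <= M by have /andP[] := V_bnd 0; exact: le_trans.
have mV : measurable_fun setT V.
  by apply: nondecreasing_measurable.
have mVs : measurable_fun setT (fun x : R => V (x - s)).
  by apply: measurableT_comp => //; exact: measurable_shift.
pose A : set (R * R) := [set z | V (z.1 - s) < z.2] `&` [set z | z.2 <= V z.1].
have mA : measurable A.
  apply: measurableI.
    apply: measurable_lt_set; last exact: measurable_snd.
    exact: (measurableT_comp mVs measurable_fst).
  apply: measurable_le_set; first exact: measurable_snd.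
  exact: (measurableT_comp mV measurable_fst).
have mI : measurable_fun setT (fun z : R * R => (\1_A z : R)%:E).
  by apply/measurable_EFinP; exact: measurable_indic.
have := @tonelli_rect12 R `]0, M] (measurable_itv _) _ mI.
rewrite (@tonelli_rect21 R `]0, M] (measurable_itv _) _ mI); last 1 first.
  by move=> z; rewrite lee_fin.
move=> /(_ (fun z => ltac:(by rewrite lee_fin))) E.
rewrite (_ : (\int[mu]_x _)%E = (\int[mu]_x \int[mu]_(t in `]0%R, M]) (\1_A (x, t) : R)%:E)%E); last first.
  apply: eq_integral => x _; have /andP[Vx0 VxM] := V_bnd x.
  have /andP[Vs0 VsM] := V_bnd (x - s).
  transitivity (\int[mu]_(t in `]0%R, M]) (\1_(`]V (x - s), V x]) t : R)%:E)%E; last first.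
    apply: eq_integral => t _; congr EFin; rewrite !indicE; congr ((nat_of_bool _)%:R).
    apply/idP/idP; rewrite !inE/= ?in_itv/= /A/=; first by move=> /andP[].
    by move=> [-> ->].
  rewrite integral_indic// setIidl; last first.
    by apply: subset_itv; rewrite bnd_simp.
  rewrite /= lebesgue_measure_itv/= lte_fin.
  have : V (x - s) <= V x by apply: V_homo; rewrite lerBlDr lerDl.
  rewrite le_eqVlt => /predU1P[->|->]; first by rewrite ltxx subrr.
  by rewrite EFinB.
rewrite -E (_ : (s * M)%:E = (\int[mu]_(t in `]0%R, M]) (cst s%:E) t)%E); last first.
  rewrite integral_cst//= lebesgue_measure_itv/= lte_fin.
  rewrite EFinM; case: ltP => h; first by rewrite sube0.
  by have -> : M = 0 by apply/eqP; rewrite eq_le h M0.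
apply: ge0_le_integral => //.
- by move=> t _; apply: integral_ge0 => x _; rewrite lee_fin.
- apply: measurable_funTS.
  have /= := @measurable_fun_fubini_tonelli_G _ _ _ _ _ lebesgue_measure _ mI; apply.
  by move=> z; rewrite lee_fin.
- move=> t _.
  have mAt : measurable (ysection A t) by exact: measurable_ysection.
  rewrite (_ : (\int[mu]_x _)%E = mu (ysection A t)); last first.
    transitivity (\int[mu]_x (\1_(ysection A t) x : R)%:E)%E.
      2: by rewrite integral_indic//= setIT.
    apply: eq_integral => x _.
    congr EFin; rewrite !indicE; congr ((nat_of_bool _)%:R).
    by rewrite /ysection/= [RHS]asboolb.
  apply: lebesgue_diameter_le => // x y.
  rewrite /ysection/= !inE => -[/= h1 h2] [/= h3 h4].
  rewrite leNgt; apply/negP => sxy.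
  have : V x <= V (y - s) by apply: V_homo; lra.
  by lra.
Qed.

End BV.

(** * Test functions and transport *)

Section Derivatives.
Context {R : realType}.
Local Notation mu := (@lebesgue_measure R).
Implicit Types phi : R * R -> R.

Lemma is_derive_dt phi x t : derivable phi (x, t) (0, 1) ->
  is_derive t 1 (fun s => phi (x, s)) (dt phi (x, t)).
Proof.
move=> d.
have E : (fun h : R => h^-1 *: ((phi \o +%R^~ (x, t)) (h *: (0, 1)) - phi (x, t)))
  = (fun h : R => h^-1 *: (((fun s => phi (x, s)) \o +%R^~ t) (h *: 1) - phi (x, t))).
  apply/funext => h /=; congr (_ *: (phi _ - _)).
  by rewrite [LHS]surjective_pairing /= scaler0 add0r.
apply: DeriveDef; first by move: d; rewrite /derivable E.
by rewrite /dt /derive E.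
Qed.

Lemma is_derive_dx phi x t : derivable phi (x, t) (1, 0) ->
  is_derive x 1 (fun s => phi (s, t)) (dx phi (x, t)).
Proof.
move=> d.
have E : (fun h : R => h^-1 *: ((phi \o +%R^~ (x, t)) (h *: (1, 0)) - phi (x, t)))
  = (fun h : R => h^-1 *: (((fun s => phi (s, t)) \o +%R^~ x) (h *: 1) - phi (x, t))).
  apply/funext => h /=; congr (_ *: (phi _ - _)).
  by rewrite [LHS]surjective_pairing /= scaler0 add0r.
apply: DeriveDef; first by move: d; rewrite /derivable E.
by rewrite /dx /derive E.
Qed.

Lemma mean_value_bound (f df : R -> R) (L e : R) (x y : R) :
  (forall z : R, is_derive z 1 f (df z)) ->
  (forall z, `|z - x| <= `|y - x| -> `|df z - L| <= e) ->
  `|f y - f x - L * (y - x)| <= e * `|y - x|.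
Proof.
move=> fdf dfL.
have cf (I : set R) : {within I, continuous f}.
  apply: continuous_subspaceT => z; apply: differentiable_continuous.
  by apply/derivable1_diffP; have [] := fdf z.
have bnd z : `|df z - L| <= e ->
    `|df z * (y - x) - L * (y - x)| <= e * `|y - x|.
  by move=> h; rewrite -mulrBl normrM ler_wpM2r.
have [xy|/ltW yx] := leP x y.
  have [z] := MVT_segment xy (fun z _ => fdf z) (cf _).
  rewrite in_itv/= => /andP[xz zy] ->; apply: bnd; apply: dfL.
  by rewrite !ger0_norm ?subr_ge0// lerB.
have [z] := MVT_segment yx (fun z _ => fdf z) (cf _).
rewrite in_itv/= => /andP[yz zx] E.
have -> : f y - f x = df z * (y - x) by rewrite -opprB E; ring.
apply: bnd; apply: dfL; rewrite !ler0_norm ?subr_le0//.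
by rewrite lerN2 lerB.
Qed.

(** The increment splits into a time increment at fixed position and a space increment at the
    displaced time. The second is handled by the mean value theorem and the continuity of
    [dx phi]. *)
Lemma is_derive_characteristic phi (c x0 : R) (t : R) : Ck 1 phi ->
  is_derive t 1 (fun s => phi (x0 + c * s, s))
    (dt phi (x0 + c * t, t) + c * dx phi (x0 + c * t, t)).
Proof.
move=> [_ dphi cdx _].
pose X s := x0 + c * s.
have {}cdx : continuous (dx phi) by [].
have dtP := is_derive_dt (dphi (X t, t)).2.
set L := dx phi (X t, t).
suff : h^-1 *: (((fun s => phi (X s, s)) \o +%R^~ t) (h *: 1) - phi (X t, t)) @[h --> 0^'] -->
    (dt phi (X t, t) + c * L).
  move=> H; apply: DeriveDef; first by apply/cvg_ex; eexists; exact: H.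
  by apply/cvg_lim => //; exact: H.
rewrite (_ : (fun h => _) = (fun h =>
    h^-1 *: (phi (X t, h + t) - phi (X t, t)) +
    h^-1 *: (phi (X (h + t), h + t) - phi (X t, h + t)))); last first.
  apply/funext => h /=; rewrite -scalerDr; congr (_ *: _).
  by rewrite /GRing.scale/= mulr1 addrC [RHS]addrC addrA subrK addrC.
apply: cvgD.
  have [dtd <-] := dtP; rewrite /derive/=.
  have E : (fun h : R => h^-1 *: (((fun s => phi (X t, s)) \o +%R^~ t) (h *: 1) - phi (X t, t))) = (fun h => h^-1 *: (phi (X t, h + t) - phi (X t, t))).
    by apply/funext => h; rewrite /= /GRing.scale/= mulr1.
  by move: dtd; rewrite /derivable E.
apply/cvgrPdist_le => /= e e0.
(* Dividing by [|c| + 1] covers [c = 0], and [|h| < d / (|c| + 1)] keeps both [|h|] and [|c * h|]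
   below [d]. *)
have c1 : 0 < `|c| + 1 by rewrite ltr_wpDl.
have e1 : 0 < e / (`|c| + 1) by rewrite divr_gt0.
have := cdx (X t, t); move/cvgrPdist_le => /(_ _ e1).
rewrite -nbhs_ballE => -[d /= d0 dball].
near=> h.
have h0 : h != 0 by near: h; exact: nbhs_dnbhs_neq.
have hd : `|h| < d / (`|c| + 1).
  near: h; apply: dnbhs0_lt; exact: divr_gt0.
have hd1 : `|h| < d.
  apply: lt_le_trans hd _; rewrite ler_pdivrMr// mulrDr mulr1 lerDr.
  by rewrite mulr_ge0// ltW.
have hd2 : `|c * h| < d.
  rewrite normrM; have : `|h| * (`|c| + 1) < d by rewrite -ltr_pdivlMr.
  by have := normr_ge0 h; rewrite mulrDr mulr1 (mulrC `|h|); lra.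
have XX : X (h + t) - X t = c * h by rewrite /X; ring.
have := @mean_value_bound (fun x => phi (x, h + t)) (fun x => dx phi (x, h + t))
  L (e / (`|c| + 1)) (X t) (X (h + t)) (fun z => is_derive_dx (dphi (z, h + t)).1).
rewrite XX => /(_ _)/wrap[z zz|H].
  rewrite distrC; apply: dball; split; rewrite -ball_normE/=.
    by rewrite distrC; apply: le_lt_trans zz _.
  by rewrite opprD addrC subrK normrN.
have -> : c * L - h^-1 *: (phi (X (h + t), h + t) - phi (X t, h + t)) =
   - (h^-1 * (phi (X (h + t), h + t) - phi (X t, h + t) - L * (c * h))).
  by rewrite /GRing.scale/=; field.
rewrite normrN normrM normfV mulrC ler_pdivrMr ?normr_gt0//.
apply: (le_trans H); rewrite normrM mulrA ler_wpM2r//.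
rewrite mulrAC ler_pdivrMr// ler_wpM2l ?(ltW e0)//; lra.
Unshelve. all: by end_near. Qed.

Lemma continuous_characteristic phi (c x0 : R) : continuous phi ->
  continuous (fun s : R => phi (x0 + c * s, s)).
Proof.
move=> cphi s; apply: continuous_comp; last exact: cphi.
have h : x0 + c * r @[r --> s] --> x0 + c * s.
  by apply: cvgD; [exact: cvg_cst|apply: cvgM; [exact: cvg_cst|exact: cvg_id]].
exact: (cvg_pair h cvg_id).
Qed.

Lemma FTC_characteristic phi (c x0 t0 t1 : R) : Ck 1 phi -> t0 < t1 ->
  (\int[mu]_(s in `[t0, t1[)
    (dt phi (x0 + c * s, s) + c * dx phi (x0 + c * s, s))%:E =
  (phi (x0 + c * t1, t1) - phi (x0 + c * t0, t0))%:E)%E.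
Proof.
move=> C1 t01; have [cphi _ cdx cdt] := C1.
pose f s := dt phi (x0 + c * s, s) + c * dx phi (x0 + c * s, s).
have cf : continuous f.
  move=> s; apply: cvgD; first exact: (@continuous_characteristic (dt phi) c x0 cdt s).
  apply: cvgM; first exact: cvg_cst.
  exact: (@continuous_characteristic (dx phi) c x0 cdx s).
have dF s := is_derive_characteristic c x0 s C1.
have cF : continuous (fun s : R => phi (x0 + c * s, s)) by exact: continuous_characteristic.
rewrite EFinB -(@continuous_FTC2 R f (fun s => phi (x0 + c * s, s)) t0 t1 t01).
- apply: (@integral_itv_bndo_bndc _ (BLeft t0) t1 (EFin \o f)); apply/measurable_funTS/measurable_EFinP.
  exact: continuous_measurable_fun.
- exact: continuous_subspaceT.
- split.
  + by move=> s _; have [] := dF s.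
  + by apply: cvg_at_right_filter; exact: (cF t0).
  + by apply: cvg_at_left_filter; exact: (cF t1).
- by move=> s _; rewrite derive1E; have [] := dF s.
Qed.

End Derivatives.

Section TestFunctions.
Context {R : realType}.
Local Notation mu := (@lebesgue_measure R).
Implicit Types phi : R * R -> R.

(** One-sided on purpose: a test function is known to vanish only inside the strip, and at [t = 0]
    only later times lie in it. *)
Lemma is_derive_locally0 (f : R -> R) (x d r : R) : is_derive x 1 f d -> 0 < r ->
  (forall s, x <= s < x + r -> f s = 0) -> d = 0.
Proof.
move=> [fd dE] r0 f0; apply/eqP; apply: contrapT => /negP d0.
have : h^-1 *: ((f \o shift x) (h *: 1) - f x) @[h --> 0^'] --> d by rewrite -dE.
move/cvgrPdist_lt => /(_ `|d|); rewrite normr_gt0 => /(_ d0).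
rewrite /dnbhs /within /= -nbhs_ballE => -[e /= e0 H].
pose h := Num.min (e / 2) (r / 2).
have h0 : 0 < h by rewrite lt_min; apply/andP; split; lra.
have he : h < e by rewrite gt_min; apply/orP; left; lra.
have hr : h < r by rewrite gt_min; apply/orP; right; lra.
have := H h; rewrite -ball_normE /= sub0r normrN gtr0_norm// he => /(_ isT).
have -> : h%:A = h :> R by rewrite /GRing.scale/= mulr1.
rewrite gt_eqF// => /(_ isT); rewrite !f0 ?subrr ?scaler0 ?subr0 ?ltxx//; lra.
Qed.

Lemma compact_box_bounded (X T : R) (f : R * R -> R) : continuous f ->
  exists B, 0 <= B /\ forall x t, `|x| <= X -> 0 <= t <= T -> `|f (x, t)| <= B.
Proof.
move=> cf.
have cK : compact (`[- X, X] `*` `[0, T] : set (R * R)).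
  by apply: compact_setX; exact: segment_compact.
have /compact_bounded [M [_ hM]] : compact (f @` (`[- X, X] `*` `[0, T] : set (R * R))).
  by apply: continuous_compact => //; exact: continuous_subspaceT.
exists (Num.max M 0 + 1); split; first by rewrite addr_ge0// le_max lexx orbT.
move=> x t xX tT; apply: (hM (Num.max M 0 + 1)).
  by rewrite (@le_lt_trans _ _ (Num.max M 0))// ?le_max ?lexx// ltrDl.
by exists (x, t) => //; split; rewrite /= in_itv/= -?ler_norml.
Qed.

(** The values of the extension off the strip are arbitrary, so the conditions concern only times of
    the strip. Vanishing far away includes the closed end [T], where boundary terms are evaluated;
    the derivatives enter only before it. *)
Definition box_supported (T X B : R) (phi : R * R -> R) := [/\ Ck 1 phi, 0 <= B,
  (forall x t : R, 0 <= t <= T -> X < `|x| -> phi (x, t) = 0),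
  (forall x t : R, 0 <= t < T -> X < `|x| -> dt phi (x, t) = 0 /\ dx phi (x, t) = 0) &
  (forall x t : R, 0 <= t < T -> `|dt phi (x, t)| <= B /\ `|dx phi (x, t)| <= B)].

Lemma C1_box_supported (T : R) phi : 0 < T -> C1_compact_support_in_strip T phi ->
  exists X B, [/\ 0 <= X, box_supported T X B phi & forall x, phi (x, T) = 0].
Proof.
move=> T0 [C1 [K [cK KT phiK]]]; have [cphi dphi cdx cdt] := C1.
have Kcl : closed K by apply: compact_closed cK; exact: norm_hausdorff.
have [M [_ hM]] := compact_bounded cK.
pose X := Num.max M 0 + 1.
have X0 : 0 <= X by rewrite addr_ge0// le_max lexx orbT.
have KX x t : X < `|x| -> ~ K (x, t).
  move=> Xx Kxt; have := hM X; rewrite (@le_lt_trans _ _ (Num.max M 0))// ?le_max ?lexx// ?ltrDl//.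
  move=> /(_ isT _ Kxt)/=; rewrite prod_normE/= ge_max => /andP[+ _].
  by rewrite leNgt Xx.
have phi0 x t : 0 <= t < T -> X < `|x| -> phi (x, t) = 0.
  by move=> tT Xx; apply: phiK; [split => //=; rewrite in_itv/=|exact: KX].
have phiT x : phi (x, T) = 0.
  (* The point lies off the closed set [K], so [phi] vanishes at nearby earlier times; a nonzero
     value here would contradict continuity at a time [T - r]. *)
  have nK : (~` K) (x, T) by move=> /KT[_]/=; rewrite in_itv/= ltxx andbF.
  apply/eqP; apply: contrapT => /negP h.
  have n1 : \forall z \near (x, T), (~` K) z.
    by apply: open_nbhs_nbhs; split => //; exact: closed_openC.
  have n2 : \forall z \near (x, T), phi z != 0.
    have /cvgrPdist_lt/(_ `|phi (x, T)|) := cphi (x, T).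
    rewrite normr_gt0 => /(_ h); apply: filterS => z; rewrite ltNge => /negP hz.
    by apply/negP => /eqP z0; apply: hz; rewrite z0 subr0.
  have : nbhs (x, T) ((~` K) `&` [set z | phi z != 0]) by exact: filterI n1 n2.
  rewrite -nbhs_ballE => -[e /= e0 H].
  pose r := Num.min (e / 2) T.
  have r0 : 0 < r by rewrite lt_min T0 andbT divr_gt0.
  have re : r < e by rewrite gt_min; apply/orP; left; lra.
  have rT : r <= T by rewrite ge_min lexx orbT.
  have [|nKz /negP[]] := H (x, T - r).
    split; rewrite -ball_normE/= ?subrr ?normr0//.
    by rewrite opprB addrC subrK gtr0_norm.
  apply/eqP; apply: phiK => //; split => //=; rewrite in_itv/=; lra.
have phi0T x t : 0 <= t <= T -> X < `|x| -> phi (x, t) = 0.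
  by move=> /andP[t0]; rewrite le_eqVlt => /predU1P[->//|tT]; apply: phi0; rewrite t0.
have far x : X < `|x| -> exists2 r, 0 < r & forall s, x <= s < x + r -> X < `|s|.
  rewrite ltr_normr => /orP[Xx|Xx]; [exists 1 => // s|exists (- x - X) => [|s]].
  - by move=> /andP[xs _]; rewrite ltr_normr; apply/orP; left; lra.
  - lra.
  - by move=> /andP[_ xs]; rewrite ltr_normr; apply/orP; right; lra.
have [B1 [B10 hB1]] := compact_box_bounded X T cdt.
have [B2 [B20 hB2]] := compact_box_bounded X T cdx.
have d0 x t : 0 <= t < T -> X < `|x| -> dt phi (x, t) = 0 /\ dx phi (x, t) = 0.
  move=> tT Xx; have [r r0 hr] := far _ Xx; split.
    have Tt : 0 < T - t by lra.
    apply: (is_derive_locally0 (is_derive_dt (dphi (x, t)).2) Tt) => s hs.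
    by apply: phi0 => //; lra.
  by apply: (is_derive_locally0 (is_derive_dx (dphi (x, t)).1) r0) => s /hr; exact: phi0.
exists X, (B1 + B2); split => //; split => //; first exact: addr_ge0.
move=> x t tT; have [xX|Xx] := leP `|x| X; last first.
  by have [-> ->] := d0 x t tT Xx; rewrite normr0 addr_ge0.
have tT' : 0 <= t <= T by lra.
by have := hB1 x t xX tT'; have := hB2 x t xX tT'; split; lra.
Qed.

End TestFunctions.

Section Transport.
Context {R : realType}.
Local Notation mu := (@lebesgue_measure R).

Lemma bounded_support_integrable (I : set R) (g : R * R -> R) (X C : R) :
  measurable I -> (mu I < +oo)%E -> measurable_fun setT g ->
  (forall x t, I t -> `|g (x, t)| <= C) ->
  (forall x t, I t -> X < `|x| -> g (x, t) = 0) ->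
  leb2.-integrable ([set: R] `*` I) (EFin \o g).
Proof.
move=> mI fI mg gC gX.
have mD := measurable_rect mI.
pose A := (`[- X, X] `*` I : set (R * R)).
have mA : measurable A by apply: measurableX.
have gA : leb2.-integrable A (EFin \o g).
  apply: measurable_bounded_integrable => //.
  - have -> : leb2 A = (mu `[(- X)%R, X] * mu I)%E by exact: product_measure1E.
    rewrite lebesgue_measure_itv/= lte_fin.
    case: ifPn => XX; rewrite ?mul0e// -EFinB lte_mul_pinfty// lee_fin.
    by rewrite subr_ge0 ltW.
  - exact: measurable_funS mg.
  - exists C; split; first by rewrite num_real.
    by move=> c Cc [x t] [_ /= It]; apply: le_trans (ltW Cc); exact: gC.
have gT := (@integrable_mkcond _ _ _ leb2 A (EFin \o g) mA).1 gA.
have := @integrableS _ _ _ leb2 _ _ _ measurableT mD (@subsetT _ _) gT.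
apply: eq_integrable => //.
move=> [x t]; rewrite inE => -[_ /= It]; rewrite patchE; case: ifPn => //.
rewrite notin_setE => nA; rewrite gX// ltNge; apply/negP => xX; apply: nA.
by split => //=; rewrite in_itv/= -ler_norml.
Qed.

Lemma integrable_mul_dt (T X B C : R) (phi f : R * R -> R) : 0 < T ->
  box_supported T X B phi -> measurable_fun setT f -> (forall z, `|f z| <= C) ->
  leb2.-integrable (strip T) (fun z => (f z * dt phi z)%:E).
Proof.
move=> T0 [C1 B0 _ dX dB] mf fC.
apply: (@bounded_support_integrable _ _ X (C * B)) => //.
- by rewrite lebesgue_measure_itv/= lte_fin T0 -EFinB ltry.
- by apply: measurable_funM => //; apply: continuous_measurable_plane; case: C1.
- move=> x t; rewrite /= in_itv/= => tT.
  by rewrite normrM; apply: ler_pM => //; have [] := dB x t tT.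
- by move=> x t; rewrite /= in_itv/= => tT xX; have [-> _] := dX x t tT xX; rewrite mulr0.
Qed.

(** For fixed [t] a shift in [x] straightens the characteristics of speed [c]; after exchanging the
    integrals, the fundamental theorem of calculus applies along each of them. The speed is 1 for
    [u] and 0 for [w]. In the boundary terms [g] the datum stays in place and the test function is
    shifted. *)
Lemma slab_transport (T X B c t0 t1 m : R) (phi : R * R -> R) (f : R -> R) :
  0 <= c -> 0 <= t0 -> t0 < t1 -> t1 <= T ->
  box_supported T X B phi -> measurable_fun setT f -> (forall x, `|f x| <= m) ->
  let psi z := dt phi z + c * dx phi z in
  let D : set (R * R) := [set: R] `*` (`[t0, t1[%classic) in
  let g t x := f x * phi (x + c * (t - t0), t) in
  [/\ leb2.-integrable D (EFin \o (fun z => f (z.1 - c * (z.2 - t0)) * psi z)),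
      mu.-integrable setT (EFin \o g t0), mu.-integrable setT (EFin \o g t1) &
  (\int[leb2]_(z in D) (f (z.1 - c * (z.2 - t0)) * psi z)%:E =
   \int[mu]_x (g t1 x)%:E - \int[mu]_x (g t0 x)%:E)%E ].
Proof.
move=> c0 t00 t01 t1T [C1 B0 phi0 dphi0 dphiB] mf fm psi D g.
have m0 : 0 <= m by apply: le_trans (fm 0).
have [cphi _ cdx cdt] := C1.
pose I : set R := `[t0, t1[%classic.
have mI : measurable I by exact: measurable_itv.
have fI : (mu I < +oo)%E by rewrite lebesgue_measure_itv/=; case: ifP; rewrite ?ltry.
have It t : I t -> [/\ 0 <= t < T, 0 <= t - t0 & t - t0 <= t1 - t0].
  by rewrite /I/= in_itv/= => h; split; lra.
have cpsi : continuous psi.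
  move=> z; apply: cvgD; first exact: cdt.
  by apply: cvgM; [exact: cvg_cst|exact: cdx].
have psiB x t : I t -> `|psi (x, t)| <= B + c * B.
  move=> /It[tT _ _]; have [h1 h2] := dphiB x t tT.
  by rewrite (le_trans (ler_normD _ _))// lerD// normrM (ger0_norm c0) ler_wpM2l.
have psi0 x t : I t -> X < `|x| -> psi (x, t) = 0.
  by move=> /It[tT _ _] Xx; rewrite /psi; have [-> ->] := dphi0 x t tT Xx; rewrite mulr0 addr0.
pose F1 (z : R * R) := f (z.1 - c * (z.2 - t0)) * psi z.
pose F2 (z : R * R) := f z.1 * psi (z.1 + c * (z.2 - t0), z.2).
have mz2 : measurable_fun setT (fun z : R * R => c * (z.2 - t0)).
  by apply: measurable_funM => //; apply: measurable_funB => //; exact: measurable_snd.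
have mF1 : measurable_fun setT F1.
  apply: measurable_funM; last exact: continuous_measurable_plane.
  apply: measurableT_comp => //; apply: measurable_funB => //; exact: measurable_fst.
have mF2 : measurable_fun setT F2.
  apply: measurable_funM; first exact: (measurableT_comp mf measurable_fst).
  apply: (measurableT_comp (continuous_measurable_plane cpsi)).
  exact: (measurable_fun_pair (measurable_funD measurable_fst mz2) measurable_snd).
(* In the moving coordinate the support widens by the distance travelled. *)
have far (x t : R) : I t -> X + c * (t1 - t0) < `|x| -> X < `|x + c * (t - t0)|.
  move=> /It[_ h1 h2] h.
  have := ler_normB (x + c * (t - t0)) (c * (t - t0)).
  rewrite addrK (ger0_norm (mulr_ge0 c0 h1)).
  by have := ler_wpM2l c0 h2; lra.
have iF1 : leb2.-integrable D (EFin \o F1).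
  apply: (@bounded_support_integrable I F1 X (m * (B + c * B))) => //.
  - by move=> x t tI; rewrite normrM ler_pM// psiB.
  - by move=> x t tI Xx; rewrite /F1 psi0// mulr0.
have iF2 : leb2.-integrable D (EFin \o F2).
  apply: (@bounded_support_integrable I F2 (X + c * (t1 - t0)) (m * (B + c * B))) => //.
  - by move=> x t tI; rewrite normrM ler_pM// psiB.
  - by move=> x t tI Xx; rewrite /F2 psi0 ?mulr0//; exact: far.
have ig (t : R) : t0 <= t <= t1 -> mu.-integrable setT (EFin \o g t).
  move=> tt.
  have [B' [B'0 hB']] := compact_box_bounded X T cphi.
  have tT : 0 <= t <= T by lra.
  have mg : measurable_fun setT (g t).
    apply: measurable_funM => //; apply: (measurableT_comp (continuous_measurable_plane cphi)).
    have ms : measurable_fun setT (fun x : R => x + c * (t - t0)) by exact: measurable_funD.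
    exact: (measurable_fun_pair ms (measurable_cst t)).
  have farg (x : R) : X + c * (t1 - t0) < `|x| -> g t x = 0.
    move=> h; rewrite /g phi0 ?mulr0//.
    have := ler_normB (x + c * (t - t0)) (c * (t - t0)).
    have h1 : 0 <= t - t0 by lra.
    have h2 : t - t0 <= t1 - t0 by lra.
    rewrite addrK (ger0_norm (mulr_ge0 c0 h1)).
    by have := ler_wpM2l c0 h2; lra.
  pose A : set R := `[- (X + c * (t1 - t0)), X + c * (t1 - t0)]%classic.
  have mA : measurable A by exact: measurable_itv.
  have gA : mu.-integrable A (EFin \o g t).
    apply: measurable_bounded_integrable => //.
    + by rewrite /= lebesgue_measure_itv/=; case: ifP; rewrite ?ltry.
    + exact: measurable_funS mg.
    + exists (m * B'); split; first by rewrite num_real.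
      move=> b /ltW Bb x _; apply: le_trans Bb; rewrite normrM ler_pM//.
      have [h|h] := leP `|x + c * (t - t0)| X; first exact: hB'.
      by rewrite phi0// normr0.
  have := (@integrable_mkcond _ _ _ mu A (EFin \o g t) mA).1 gA.
  apply: eq_integrable => // x _; rewrite patchE; case: ifPn => //.
  rewrite notin_setE => nA; rewrite /= farg// ltNge; apply/negP => xX; apply: nA.
  by rewrite /A/= in_itv/= -ler_norml.
have ig0 : mu.-integrable setT (EFin \o g t0) by apply: ig; lra.
have ig1 : mu.-integrable setT (EFin \o g t1) by apply: ig; lra.
split => //.
rewrite -integralB// (_ : (\int[leb2]_(z in D) _)%E = (\int[leb2]_(z in D) (EFin \o F1) z)%E)//.
have mEF1 : measurable_fun setT (EFin \o F1) by exact/measurable_EFinP.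
have mEF2 : measurable_fun setT (EFin \o F2) by exact/measurable_EFinP.
rewrite (fubini_rect21 mI mEF1 iF1).
transitivity (\int[mu]_(t in I) \int[mu]_x (EFin \o F2) (x, t))%E.
  apply: eq_integral => t _.
  have mF2t : measurable_fun setT (fun x => (EFin \o F2) (x, t)).
    apply: measurableT_comp mEF2 _; exact: pair2_measurable.
  rewrite -(integral_shift (c * (t - t0)) mF2t).
  by apply: eq_integral => x _; rewrite /F1 /F2/= subrK.
rewrite -(fubini_rect21 mI mEF2 iF2) (fubini_rect12 mI mEF2 iF2).
apply: eq_integral => x _.
rewrite -EFinB /g -mulrBr EFinM.
have -> : (phi (x + c * (t1 - t0), t1) - phi (x + c * (t0 - t0), t0))%:E =
   (\int[mu]_(t in I) (psi (x + c * (t - t0), t))%:E)%E.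
  have := FTC_characteristic c (x - c * t0) C1 t01.
  have -> : x - c * t0 + c * t1 = x + c * (t1 - t0) by ring.
  have -> : x - c * t0 + c * t0 = x + c * (t0 - t0) by ring.
  move=> <-; apply: eq_integral => t _.
  by have -> : x - c * t0 + c * t = x + c * (t - t0) by ring.
rewrite -integralZl//.
have : mu.-integrable `[t0, t1] (EFin \o (fun t => psi (x + c * (t - t0), t))).
  apply: continuous_compact_integrable; first exact: segment_compact.
  apply: continuous_subspaceT => t; apply: continuous_comp; last exact: cpsi.
  have h : x + c * (r - t0) @[r --> t] --> x + c * (t - t0).
    apply: cvgD; [exact: cvg_cst|apply: cvgM; [exact: cvg_cst|]].
    by apply: cvgB; [exact: cvg_id|exact: cvg_cst].
  exact: (cvg_pair h cvg_id).
by apply: integrableS => //; apply: subset_itvl; rewrite bnd_simp.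
Qed.

End Transport.

(** * Approximate solutions *)

Section Quasi.
Context {R : realType}.
Local Notation mu := (@lebesgue_measure R).
Variables (a T m M E0 B : R) (u0 w0 : R -> R).

Definition output (p q : R * R -> R) (z : R * R) : R := w0 z.1 + p z - q z.

(* Every condition is convex in the triple [u], [p], [q], where [p] and [q] are
   the upward and downward variations of the output [w = w0 + p - q]. *)
Record quasi_solution (eps : R) (u p q : R * R -> R) : Prop := QuasiSolution {
  quasi_mu : measurable_fun setT u;
  quasi_mp : measurable_fun setT p;
  quasi_mq : measurable_fun setT q;
  quasi_u : forall z, `|u z| <= m;
  quasi_p : forall z, 0 <= p z <= M;
  quasi_q : forall z, 0 <= q z <= M;
  quasi_p_homo : forall x s t, s <= t -> p (x, s) <= p (x, t);
  quasi_q_homo : forall x s t, s <= t -> q (x, s) <= q (x, t);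
  quasi_energy : forall t : R, 0 <= t < T ->
    (\int[mu]_x (u (x, t) ^+ 2 / 2 + (output p q (x, t) ^+ 2 / 2
       + a * (p (x, t) + q (x, t))))%:E <= E0%:E)%E;
  quasi_L1 : forall t : R, 0 <= t < T ->
    (\int[mu]_x (`|u (x, t)| + `|output p q (x, t)|)%:E <= B%:E)%E;
  quasi_weak : forall phi, C1_compact_support_in_strip T phi ->
    (\int[leb2]_(z in strip T)
        ((u z + output p q z) * dt phi z + u z * dx phi z)%:E
     + \int[mu]_x ((u0 x + w0 x) * phi (x, 0))%:E = 0)%E;
  quasi_gap : (\int[leb2]_(z in strip T)
     (Num.max (`|u z - output p q z| - a) 0)%:E <= eps%:E)%E }.

End Quasi.

Section ShiftSum.
Context {R : realType}.
Local Notation mu := (@lebesgue_measure R).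

(** Transport shifts the contribution of [U] and leaves the rest in place. The energy, L1 and
    translation functionals of the scheme do not feel it, so it remains to estimate the projection
    pointwise. *)
Lemma integral_shift_sum (s : R) (f g : R -> R) :
  measurable_fun setT f -> measurable_fun setT g ->
  (forall x, 0 <= f x) -> (forall x, 0 <= g x) ->
  (\int[mu]_x (f (x - s) + g x)%:E = \int[mu]_x (f x + g x)%:E)%E.
Proof.
move=> mf mg f0 g0.
have mEf : measurable_fun setT (EFin \o f) by exact/measurable_EFinP.
have mEg : measurable_fun setT (EFin \o g) by exact/measurable_EFinP.
have mEfs : measurable_fun setT (fun x : R => (EFin \o f) (x - s)).
  exact: (measurableT_comp mEf (measurable_shift s)).
have f0' x : (0 <= (EFin \o f) x)%E by rewrite lee_fin.
transitivity (\int[mu]_x ((EFin \o f) (x - s)%R + (EFin \o g) x))%E.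
  by apply: eq_integral => x _; rewrite /= EFinD.
rewrite ge0_integralD//; last by move=> x _; rewrite lee_fin.
rewrite (ge0_integral_shift s mEf f0') -ge0_integralD//.
by move=> x _; rewrite lee_fin.
Qed.

Lemma subeACA (x y z t : \bar R) : y \is a fin_num -> t \is a fin_num ->
  (x - y + (z - t) = x + z - (y + t))%E.
Proof. by move=> fy ft; rewrite addeACA fin_num_oppeD. Qed.

Lemma integrable_shift (s : R) (f : R -> R) :
  mu.-integrable setT (EFin \o f) -> mu.-integrable setT (EFin \o (fun x : R => f (x - s))).
Proof.
move=> /integrableP[mf fi]; apply/integrableP; split.
  exact: (measurableT_comp mf (measurable_shift s)).
apply: le_lt_trans fi; rewrite le_eqVlt; apply/orP; left; apply/eqP.
have mf' : measurable_fun setT (fun x => `|(EFin \o f) x|%E) by exact: measurableT_comp.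
by rewrite -(ge0_integral_shift s mf').
Qed.

End ShiftSum.

Section MeasurableGlue.
Context {d : measure_display} {X : measurableType d} {R : realType}.

Lemma measurable_glue (k : X -> nat) (f : nat -> X -> R) :
  (forall n, measurable [set z | k z = n]) -> (forall n, measurable_fun setT (f n)) ->
  measurable_fun setT (fun z => f (k z) z).
Proof.
move=> mk mf _ Y mY; rewrite setTI.
rewrite (_ : _ @^-1` Y = \bigcup_n ([set z | k z = n] `&` f n @^-1` Y)).
  apply: bigcupT_measurable => n; apply: measurableI => //.
  by rewrite -[X in measurable X]setTI; exact: mf.
apply/seteqP; split => [z Yz|z [n _ [/= <-]]//].
by exists (k z).
Qed.

Lemma measurable_truncn (f : X -> R) n : measurable_fun setT f ->
  measurable [set z | Num.truncn (f z) = n].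
Proof.
move=> mf.
have mt : measurable_fun setT (fun x : R => (Num.truncn x)%:R : R).
  by apply: nondecreasing_measurable => // x y xy; rewrite ler_nat le_truncn.
have := measurableT_comp mt mf; move=> /(_ measurableT [set n%:R] (measurable_set1 _)).
rewrite setTI; congr measurable; apply/seteqP; split => z /=.
  by move/eqP; rewrite eqr_nat => /eqP.
by move=> ->.
Qed.

End MeasurableGlue.

(** * Interpolation of the scheme in time *)

Section Approximation.
Context {R : realType}.
Local Notation mu := (@lebesgue_measure R).
Variables (a T m M E0 B C : R) (u0 w0 V : R -> R).
Hypotheses (a0 : 0 < a) (T0 : 0 < T).
Hypotheses (mu0 : measurable_fun setT u0) (mw0 : measurable_fun setT w0).
Hypotheses (u0m : forall x, `|u0 x| <= m) (w0m : forall x, `|w0 x| <= m).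
Hypothesis uw0 : forall x, `|u0 x - w0 x| <= a.
Hypothesis V_bnd : forall x, 0 <= V x <= M.
Hypothesis uV : forall x y, y <= x -> `|u0 x - u0 y| <= V x - V y.
Hypothesis E0E : (\int[mu]_x (u0 x ^+ 2 / 2 + w0 x ^+ 2 / 2)%:E <= E0%:E)%E.
Hypothesis BE : (\int[mu]_x (`|u0 x| + `|w0 x|)%:E <= B%:E)%E.
Hypothesis uwC : forall s : R, 0 <= s ->
  (\int[mu]_x (`|u0 (x - s) - u0 x| + `|w0 (x - s) - w0 x|)%:E <= (s * C)%:E)%E.
Variable N : nat.
Let tau := T / N.+1%:R.
Let tau0 : 0 < tau. Proof. by rewrite /tau divr_gt0. Qed.
Local Notation U := (schemeU a tau u0 w0).
Local Notation P := (schemeP a tau u0 w0).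
Local Notation Q := (schemeQ a tau u0 w0).
Local Notation W := (schemeW a tau u0 w0).
Let step (t : R) := Num.truncn (t / tau).
(** Between grid times [u] is transported freely while [p] and [q] are frozen; the constraint is
    exact at grid times and may fail in between. *)
Let u z := U (step z.2) (z.1 - (z.2 - (step z.2)%:R * tau)).
Let p z := P (step z.2) z.1.
Let q z := Q (step z.2) z.1.

Let mU n : measurable_fun setT (U n). Proof. by have [] := measurable_scheme a tau n mu0 mw0. Qed.
Let mP n : measurable_fun setT (P n). Proof. by have [] := measurable_scheme a tau n mu0 mw0. Qed.
Let mQ n : measurable_fun setT (Q n). Proof. by have [] := measurable_scheme a tau n mu0 mw0. Qed.
Let mW n : measurable_fun setT (W n). Proof. by have [] := measurable_scheme a tau n mu0 mw0. Qed.

Let a0' : 0 <= a. Proof. exact: ltW. Qed.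
Let PM n x : P n x <= M.
Proof.
have V0 y : 0 <= V y by have /andP[] := V_bnd y.
have VM y : V y <= M by have /andP[] := V_bnd y.
have := scheme_total a0' uw0 (ltW tau0) V0 VM uV n x.
by have := schemeQ_ge0 a tau u0 w0 n x; lra.
Qed.
Let QM n x : Q n x <= M.
Proof.
have V0 y : 0 <= V y by have /andP[] := V_bnd y.
have VM y : V y <= M by have /andP[] := V_bnd y.
have := scheme_total a0' uw0 (ltW tau0) V0 VM uV n x.
by have := schemeP_ge0 a tau u0 w0 n x; lra.
Qed.

Let stepP n t : n%:R * tau <= t < n.+1%:R * tau -> step t = n.
Proof.
move=> /andP[h1 h2]; apply: truncn_def; rewrite ler_pdivlMr// h1/=.
by rewrite ltr_pdivrMr.
Qed.

Let step_itv (t : R) : 0 <= t -> 0 <= t - (step t)%:R * tau <= tau.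
Proof.
move=> t0; have : 0 <= t / tau by rewrite divr_ge0// ltW.
move=> /truncn_itv; rewrite ler_pdivlMr// ltr_pdivrMr// -/(step t) => /andP[h1 h2].
by move: h2; rewrite -natr1 mulrDl mul1r; lra.
Qed.

Let mstep (n : nat) : measurable [set z : R * R | step z.2 = n].
Proof.
apply: measurable_truncn; apply: measurable_funM => //; exact: measurable_snd.
Qed.

Let mu_ : measurable_fun setT u.
Proof.
apply: (measurable_glue (k := fun z : R * R => step z.2) (f := fun n z => U n (z.1 - (z.2 - n%:R * tau))) mstep) => n.
have ms : measurable_fun setT (fun z : R * R => z.1 - (z.2 - n%:R * tau)).
  apply: measurable_funB; first exact: measurable_fst.
  by apply: measurable_funB => //; exact: measurable_snd.
exact: (measurableT_comp (mU n) ms).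
Qed.

Let mp_ : measurable_fun setT p.
Proof.
apply: (measurable_glue (k := fun z : R * R => step z.2) (f := fun n z => P n z.1) mstep) => n.
exact: (measurableT_comp (mP n) measurable_fst).
Qed.

Let mq_ : measurable_fun setT q.
Proof.
apply: (measurable_glue (k := fun z : R * R => step z.2) (f := fun n z => Q n z.1) mstep) => n.
exact: (measurableT_comp (mQ n) measurable_fst).
Qed.

Let outputE z : output w0 p q z = W (step z.2) z.1.
Proof. by []. Qed.

(** Transport preserves the integral of [U n ^+ 2], and in the projection the growth of [P] and [Q]
    is paid for by [slip_energy]. *)
Let energy n : (\int[mu]_x (U n x ^+ 2 / 2 + (W n x ^+ 2 / 2 + a * (P n x + Q n x)))%:E <= E0%:E)%E.
Proof.
elim: n => [|n IH].
  apply: le_trans E0E; rewrite le_eqVlt; apply/orP; left; apply/eqP.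
  apply: eq_integral => x _; congr EFin.
  by rewrite /schemeW /schemeP /schemeQ/= addr0 subr0 addr0 mulr0 addr0.
apply: le_trans IH.
have mh n' : measurable_fun setT (fun x => W n' x ^+ 2 / 2 + a * (P n' x + Q n' x)).
  apply: measurable_funD; first by apply: measurable_funM => //; exact: measurable_funX.
  by apply: measurable_funM => //; exact: measurable_funD.
have ms n' : measurable_fun setT (fun x => U n' x ^+ 2 / 2).
  by apply: measurable_funM => //; exact: measurable_funX.
have h0 n' x : 0 <= W n' x ^+ 2 / 2 + a * (P n' x + Q n' x).
  rewrite addr_ge0 ?divr_ge0 ?sqr_ge0// mulr_ge0// addr_ge0//.
    exact: schemeP_ge0.
  exact: schemeQ_ge0.
have s0 n' x : 0 <= U n' x ^+ 2 / 2 by rewrite divr_ge0 ?sqr_ge0.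
rewrite -(integral_shift_sum tau (ms n) (mh n))//.
apply: le_integral_EFin => //.
- exact: (measurable_funD (ms _) (mh _)).
- exact: (measurable_funD (measurableT_comp (ms n) (measurable_shift tau)) (mh n)).
- by move=> x _; rewrite addr_ge0.
- move=> x _; rewrite schemeUS schemeWS schemePS schemeQS.
  by have := @slip_energy R a (U n (x - tau)) (W n x) a0'; lra.
Qed.

Let L1 n : (\int[mu]_x (`|U n x| + `|W n x|)%:E <= B%:E)%E.
Proof.
elim: n => [|n IH].
  apply: le_trans BE; rewrite le_eqVlt; apply/orP; left; apply/eqP.
  apply: eq_integral => x _; congr EFin.
  by rewrite /schemeW /schemeP /schemeQ/= addr0 subr0.
apply: le_trans IH.
have mnU n' : measurable_fun setT (fun x => `|U n' x|) by exact: measurableT_comp.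
have mnW n' : measurable_fun setT (fun x => `|W n' x|) by exact: measurableT_comp.
rewrite -(integral_shift_sum tau (mnU n) (mnW n))//.
apply: le_integral_EFin => //.
- exact: (measurable_funD (mnU _) (mnW _)).
- exact: (measurable_funD (measurableT_comp (mnU n) (measurable_shift tau)) (mnW n)).
- by move=> x _; rewrite schemeUS schemeWS; exact: slip_norm.
Qed.

Let translate n (s : R) : 0 <= s ->
  (\int[mu]_x (`|U n (x - s) - U n x| + `|W n (x - s) - W n x|)%:E <= (s * C)%:E)%E.
Proof.
move=> s0; elim: n => [|n IH].
  apply: le_trans (uwC s0); rewrite le_eqVlt; apply/orP; left; apply/eqP.
  apply: eq_integral => x _; congr EFin.
  by rewrite /schemeW /schemeP /schemeQ/= !addr0 !subr0.
apply: le_trans IH.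
have mnU n' : measurable_fun setT (fun x : R => `|U n' (x - s) - U n' x|).
  apply: measurableT_comp => //; apply: measurable_funB => //.
  exact: (measurableT_comp (mU n') (measurable_shift s)).
have mnW n' : measurable_fun setT (fun x : R => `|W n' (x - s) - W n' x|).
  apply: measurableT_comp => //; apply: measurable_funB => //.
  exact: (measurableT_comp (mW n') (measurable_shift s)).
rewrite -(integral_shift_sum tau (mnU n) (mnW n))//.
apply: le_integral_EFin => //.
- exact: (measurable_funD (mnU _) (mnW _)).
- exact: (measurable_funD (measurableT_comp (mnU n) (measurable_shift tau)) (mnW n)).
- by move=> x _; exact: scheme_translate.
Qed.

Let shifted t x : u (x, t) = U (step t) (x - (t - (step t)%:R * tau)).
Proof. by []. Qed.

Let u_energy (t : R) : 0 <= t < T ->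
    (\int[mu]_x (u (x, t) ^+ 2 / 2 + (output w0 p q (x, t) ^+ 2 / 2
       + a * (p (x, t) + q (x, t))))%:E <= E0%:E)%E.
Proof.
move=> _; apply: le_trans (energy (step t)).
rewrite -(@integral_shift_sum R (t - (step t)%:R * tau) (fun x => U (step t) x ^+ 2 / 2)
  (fun x => W (step t) x ^+ 2 / 2 + a * (P (step t) x + Q (step t) x)))//.
- by apply: measurable_funM => //; exact: measurable_funX.
- apply: measurable_funD; first by apply: measurable_funM => //; exact: measurable_funX.
  by apply: measurable_funM => //; exact: measurable_funD.
- by move=> x; rewrite divr_ge0 ?sqr_ge0.
- move=> x; rewrite addr_ge0 ?divr_ge0 ?sqr_ge0// mulr_ge0// addr_ge0//.
    exact: schemeP_ge0.
  exact: schemeQ_ge0.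
Qed.

Let u_L1 (t : R) : 0 <= t < T ->
    (\int[mu]_x (`|u (x, t)| + `|output w0 p q (x, t)|)%:E <= B%:E)%E.
Proof.
move=> _; apply: le_trans (L1 (step t)).
by rewrite -(@integral_shift_sum R (t - (step t)%:R * tau) (fun x => `|U (step t) x|)
  (fun x => `|W (step t) x|))//; exact: measurableT_comp.
Qed.

Let C0 : 0 <= C.
Proof.
have := uwC ler01; rewrite mul1r -lee_fin; apply: le_trans.
by apply: integral_ge0 => x _; rewrite lee_fin addr_ge0.
Qed.

(** At a delay [s] after the last grid time, [u] differs by [U n (x - s) - U n x] from a value
    satisfying the constraint. This difference has integral at most [s * C], and [s <= tau]. *)
Let u_gap : (\int[leb2]_(z in strip T)
     (Num.max (`|u z - output w0 p q z| - a) 0)%:E <= (T * (tau * C))%:E)%E.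
Proof.
have mo : measurable_fun setT (output w0 p q).
  apply: measurable_funB => //; apply: measurable_funD => //.
  exact: (measurableT_comp mw0 measurable_fst).
have mg : measurable_fun setT (fun z => Num.max (`|u z - output w0 p q z| - a) 0).
  apply: measurable_maxr => //; apply: measurable_funB => //.
  by apply: measurableT_comp => //; exact: measurable_funB.
have mEg : measurable_fun setT (fun z => (Num.max (`|u z - output w0 p q z| - a) 0)%:E).
  exact/measurable_EFinP.
have g0 z : (0 <= (Num.max (`|u z - output w0 p q z| - a) 0)%:E)%E.
  by rewrite lee_fin le_max lexx orbT.
have mI : measurable (`[0, T[ : set R) by exact: measurable_itv.
rewrite [X in (X <= _)%E](tonelli_rect21 mI mEg g0).
have -> : (T * (tau * C))%:E = (\int[mu]_(t in `[0%R, T[) (cst (tau * C)%:E) t)%E.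
  rewrite integral_cst//= lebesgue_measure_itv/= lte_fin T0 -EFinB subr0 -EFinM.
  by congr EFin; ring.
apply: ge0_le_integral => //.
- by move=> t _; apply: integral_ge0 => x _.
- apply: measurable_funTS.
  have /= := @measurable_fun_fubini_tonelli_G _ _ _ _ _ lebesgue_measure _ mEg; exact.
move=> t; rewrite /= in_itv/= => /andP[t0 tT].
have /andP[s0 sT] := step_itv t0.
set s := t - _ in s0 sT.
apply: (@le_trans _ _ (s * C)%:E); last by rewrite lee_fin ler_wpM2r.
apply: le_trans (translate (step t) s0).
have mUs : measurable_fun setT (fun x : R => U (step t) (x - s)).
  exact: (measurableT_comp (mU (step t)) (measurable_shift s)).
have mWs : measurable_fun setT (fun x : R => W (step t) (x - s)).
  exact: (measurableT_comp (mW (step t)) (measurable_shift s)).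
have mdU : measurable_fun setT (fun x : R => `|U (step t) (x - s) - U (step t) x|).
  by apply: measurableT_comp => //; exact: measurable_funB.
have mdW : measurable_fun setT (fun x : R => `|W (step t) (x - s) - W (step t) x|).
  by apply: measurableT_comp => //; exact: measurable_funB.
apply: le_integral_EFin => //.
- by apply: (measurableT_comp mg); exact: pair2_measurable.
- exact: (measurable_funD mdU mdW).
- by move=> x _; rewrite le_max lexx orbT.
move=> x _; rewrite ge_max addr_ge0// andbT outputE shifted/= -/s.
have := scheme_constraint tau a0' uw0 (step t) x.
have := ler_normD (U (step t) (x - s) - U (step t) x) (U (step t) x - W (step t) x).
rewrite addrA subrK; have := normr_ge0 (W (step t) (x - s) - W (step t) x); lra.
Qed.

Let UWm n x : `|U n x| <= m /\ `|W n x| <= m.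
Proof. exact: scheme_box. Qed.

(** The integral over a slab is the increment of [L], the integral of [(U + W) * phi] at grid times.
    Projections preserve [U + W], so the sum telescopes exactly; the last term vanishes with [phi]
    at time [T] and the first one is the initial term. *)
Let u_weak phi : C1_compact_support_in_strip T phi ->
    (\int[leb2]_(z in strip T)
        ((u z + output w0 p q z) * dt phi z + u z * dx phi z)%:E
     + \int[mu]_x ((u0 x + w0 x) * phi (x, 0))%:E = 0)%E.
Proof.
move=> C1phi; have [X [Bd [X0 bs phiT]]] := C1_box_supported T0 C1phi.
have [[cphi _ cdx cdt] _ _ _ _] := bs.
pose G z := (u z + output w0 p q z) * dt phi z + u z * dx phi z.
have mo : measurable_fun setT (output w0 p q).
  apply: measurable_funB => //; apply: measurable_funD => //.
  exact: (measurableT_comp mw0 measurable_fst).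
have mG : measurable_fun setT G.
  apply: measurable_funD; apply: measurable_funM => //.
  - exact: measurable_funD.
  - exact: continuous_measurable_plane.
  - exact: continuous_measurable_plane.
pose D n : set (R * R) := [set: R] `*` (`[n%:R * tau, n.+1%:R * tau[%classic).
pose L k : \bar R := (\int[mu]_x ((U k x + W k x) * phi (x, k%:R * tau))%:E)%E.
have NT : N.+1%:R * tau = T by rewrite /tau mulrC divfK// pnatr_eq0.
have slab n : (n <= N)%N -> [/\ L n \is a fin_num, L n.+1 \is a fin_num &
    (\int[leb2]_(z in D n) (G z)%:E = L n.+1 - L n)%E ].
  move=> nN; have t0 : 0 <= n%:R * tau by rewrite mulr_ge0// ltW.
  have t01 : n%:R * tau < n.+1%:R * tau by rewrite ltr_pM2r// ltr_nat.
  have t1T : n.+1%:R * tau <= T by rewrite -NT ler_pM2r// ler_nat.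
  have Um x : `|U n x| <= m by have [] := UWm n x.
  have Wm x : `|W n x| <= m by have [] := UWm n x.
  have [iU iU0 iU1 eU] := slab_transport ler01 t0 t01 t1T bs (mU n) Um.
  have [iW iW0 iW1 eW] := slab_transport (lexx 0) t0 t01 t1T bs (mW n) Wm.
  have E1 : n.+1%:R * tau - n%:R * tau = tau by rewrite -mulrBl -natr1; ring.
  rewrite !subrr !E1 in iU0 iU1 iW0 iW1 eU eW.
  have LnE : L n = (\int[mu]_x (U n x * phi (x + 1 * 0, n%:R * tau))%:E +
                    \int[mu]_x (W n x * phi (x + 0 * 0, n%:R * tau))%:E)%E.
    rewrite -integralD//; apply: eq_integral => x _ /=.
    by rewrite !mulr0 !addr0 mulrDl EFinD.
  (* A shift by [tau] turns the terminal value of the transported part into [U n (x - tau)], and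
     [scheme_conservation] replaces its sum with [W n x] by the state after the projection. *)
  have LSE : L n.+1 = (\int[mu]_x (U n x * phi (x + 1 * tau, n.+1%:R * tau))%:E +
                    \int[mu]_x (W n x * phi (x + 0 * tau, n.+1%:R * tau))%:E)%E.
    have mg := measurable_int _ iU1.
    rewrite -(integral_shift tau mg) -integralD//; last exact: integrable_shift iU1.
    apply: eq_integral => x _ /=.
    by rewrite !mul1r !mul0r !addr0 subrK -EFinD -mulrDl scheme_conservation.
  have fU0 := integrable_fin_num measurableT iU0.
  have fU1 := integrable_fin_num measurableT iU1.
  have fW0 := integrable_fin_num measurableT iW0.
  have fW1 := integrable_fin_num measurableT iW1.
  split.
  - by rewrite LnE fin_numD fU0 fW0.
  - by rewrite LSE fin_numD fU1 fW1.
  rewrite LnE LSE.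
  transitivity (\int[leb2]_(z in D n) ((U n (z.1 - 1 * (z.2 - n%:R * tau)) * (dt phi z + 1 * dx phi z))%:E + (W n (z.1 - 0 * (z.2 - n%:R * tau)) * (dt phi z + 0 * dx phi z))%:E))%E.
    apply: eq_integral => -[x t]; rewrite inE => -[_ /=]; rewrite in_itv/= => tn.
    rewrite -EFinD /G outputE shifted/= (stepP tn) !mul1r !mul0r subr0 addr0.
    by congr EFin; ring.
  have mD : measurable (D n) by exact: measurable_rect.
  rewrite integralD// eU eW.
  exact: subeACA.
have Lfin k : (k <= N.+1)%N -> L k \is a fin_num.
  by case: k => [_|k kN]; [have [] := slab 0%N (leq0n _)|have [] := slab k kN].
have tele k : (k <= N.+1)%N ->
    (\int[leb2]_(z in [set: R] `*` (`[0%R, (k%:R * tau)%R[%classic)) (G z)%:E = L k - L 0%N)%E.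
  elim: k => [_|k IH kN].
    rewrite mul0r set_itvco0 setX0 integral_set0 subee//; exact: Lfin.
  have k0 : 0 <= k%:R * tau by rewrite mulr_ge0// ltW.
  have kk : k%:R * tau <= k.+1%:R * tau by rewrite ler_pM2r// ler_nat.
  have -> : [set: R] `*` `[0, k.+1%:R * tau[%classic =
      ([set: R] `*` `[0, k%:R * tau[%classic) `|` D k.
    apply/seteqP; split => -[x t] /=; rewrite /D/= !in_itv/=.
      move=> [_ /andP[t0 tk]]; have [h|h] := ltP t (k%:R * tau).
        by left; split => //; rewrite t0.
      by right; split => //; rewrite tk.
    move=> [[_ /andP[t0 tk]]|[_ /andP[t0 tk]]]; split => //.
      by rewrite t0 (lt_le_trans tk kk).
    by rewrite tk (le_trans k0 t0).
  rewrite integral_setU; last first.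
  - apply/disj_set2P; rewrite -subset0 => -[x t] /= [[_ /=]].
    rewrite in_itv/= => /andP[_ h1] [_ /=]; rewrite in_itv/= => /andP[h2 _].
    by move: h1; rewrite ltNge h2.
  - by apply/measurable_EFinP; exact: measurable_funS mG.
  - exact: measurable_rect.
  - exact: measurable_rect.
  have [_ _ ->] := slab k kN; rewrite IH ?(ltnW kN)//.
  by rewrite addeC addeA subeK// Lfin// ltnW.
have := tele N.+1 (leqnn _); rewrite NT => E.
have LT : L N.+1 = 0%E.
  by apply: integral0_eq => x _; rewrite NT phiT mulr0.
rewrite [X in (X + _)%E]E LT sub0e.
have -> : (\int[mu]_x ((u0 x + w0 x) * phi (x, 0))%:E)%E = L 0%N.
  apply: eq_integral => x _; rewrite mul0r; congr (_ * _)%:E.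
  by rewrite /schemeW /schemeP /schemeQ /= addr0 subr0.
by rewrite addeC subee// Lfin.
Qed.

Lemma quasi_solution_step : quasi_solution a T m M E0 B u0 w0 (T * (tau * C)) u p q.
Proof.
have dt0 (s t : R) : s <= t -> s / tau <= t / tau by move=> st; rewrite ler_pM2r// invr_gt0.
split => //.
- by move=> z; have [] := UWm (step z.2) (z.1 - (z.2 - (step z.2)%:R * tau)).
- by move=> z; rewrite schemeP_ge0 PM.
- by move=> z; rewrite schemeQ_ge0 QM.
- by move=> x s t st; apply: schemeP_le; apply: le_truncn; exact: dt0.
- by move=> x s t st; apply: schemeQ_le; apply: le_truncn; exact: dt0.
Qed.

End Approximation.

(** * Passage to the limit by convexity *)

Section Minimizers.
Context {R : realType} {X : Type}.
Variables (C : R -> X -> Prop) (mid : X -> X -> X) (J : X -> R) (d : X -> X -> R) (K : R).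
Hypothesis C_ex : forall e, 0 < e -> exists x, C e x.
Hypothesis C_le : forall e e' x, e <= e' -> C e x -> C e' x.
Hypothesis C_mid : forall e x y, C e x -> C e y -> C e (mid x y).
Hypothesis J_bnd : forall e x, C e x -> 0 <= J x <= K.
Hypothesis J_mid : forall e x y, C e x -> C e y ->
  d x y = 2 * J x + 2 * J y - 4 * J (mid x y).

(* In a uniformly convex space, nearly minimal elements of a decreasing sequence
   of convex sets form a Cauchy sequence; no weak compactness is needed. *)
Lemma almost_minimizers (delta : nat -> R) :
  (forall k, 0 < delta k) -> (forall k, delta k.+1 <= delta k) ->
  exists z : nat -> X, forall k, C k.+1%:R^-1 (z k) /\ d (z k) (z k.+1) <= delta k.
Proof.
move=> d0 dS.
pose I e := inf [set J x | x in C e].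
have hasI e : 0 < e -> has_inf [set J x | x in C e].
  move=> e0; split; first by have [x Cx] := C_ex e0; exists (J x), x.
  by exists 0 => _ [x Cx <-]; have /andP[] := J_bnd Cx.
have I_le e x : C e x -> 0 < e -> I e <= J x.
  by move=> Cx e0; apply: ge_inf; [have [] := hasI e e0|exists x].
pose S := [set I e | e in [set e | 0 < e]].
have hasS : has_sup S.
  split; first by exists (I 1), 1; rewrite //= ltr01.
  exists K => _ [e /= e0 <-]; have [x Cx] := C_ex e0.
  by apply: (le_trans (I_le _ _ Cx e0)); have /andP[] := J_bnd Cx.
pose j := sup S.
have Ij e : 0 < e -> I e <= j.
  by move=> e0; apply: ub_le_sup; [have [] := hasS|exists e].
have I_mono e e' : 0 < e -> e <= e' -> I e' <= I e.
  move=> e0 ee; apply: lb_le_inf; first by have [] := hasI e e0.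
  move=> _ [x Cx <-]; apply: I_le; first exact: C_le Cx.
  exact: lt_le_trans ee.
(* [j] is the limit of the infima as the tolerance shrinks. With [J] below [j + delta k / 8] at both
   points and at least [j - delta k / 8] at the midpoint, [J_mid] bounds the distance by
   [8 * (delta k / 8)]. *)
have eta_ex k : exists e, 0 < e /\ j - delta k / 8 < I e.
  have dk : 0 < delta k / 8 by rewrite divr_gt0.
  by have [_ [e /= e0 <-] h] := sup_adherent dk hasS; exists e.
have [eta etaP] := choice eta_ex.
(* The tolerances are made nonincreasing so that [z k], [z k.+1] and their midpoint all lie in
   [C (ep k)]. *)
pose ep := fix ep k : R := Num.min (Num.min (eta k) k.+1%:R^-1)
   (if k is i.+1 then ep i else 1).
have ep0 k : 0 < ep k.
  by elim: k => [|k IH] /=; rewrite !lt_min (etaP _).1 invr_gt0 ltr0n/=.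
have ep_eta k : ep k <= eta k by case: k => [|k] /=; rewrite !ge_min lexx.
have ep_inv k : ep k <= k.+1%:R^-1 by case: k => [|k] /=; rewrite !ge_min lexx !orbT.
have ep_S k : ep k.+1 <= ep k by rewrite /= ge_min lexx orbT.
have z_ex k : exists x, C (ep k) x /\ J x < j + delta k / 8.
  have dk : 0 < delta k / 8 by rewrite divr_gt0.
  have [_ [x Cx <-] h] := inf_adherent dk (hasI _ (ep0 k)).
  exists x; split => //; apply: (lt_le_trans h).
  by rewrite lerD2r Ij.
have [z zP] := choice z_ex.
exists z => k; split; first by apply: C_le (ep_inv k) _; exact: (zP k).1.
have Ck := (zP k).1; have Ck1 : C (ep k) (z k.+1) := C_le (ep_S k) (zP k.+1).1.
rewrite (J_mid Ck Ck1).
have := I_le _ _ (C_mid Ck Ck1) (ep0 k).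
have := I_mono _ _ (ep0 k) (ep_eta k); have := (etaP k).2.
by have := (zP k).2; have := (zP k.+1).2; have := dS k; lra.
Qed.

End Minimizers.

(** * Almost everywhere convergence and the passage of bounds to the limit *)

Section FastConvergence.
Context {R : realType}.

Lemma geometric_cvg (v : nat -> R) (A : R) :
  (forall k, `|v k.+1 - v k| <= A / 2 ^+ k) -> cvgn v.
Proof.
move=> h.
have cg : cvgn (series (geometric A 2^-1)).
  by apply: is_cvg_geometric_series; rewrite ger0_norm ?invr_ge0// invf_lt1// ltr1n.
have : cvgn (series (telescope v)).
  apply: normed_cvg; apply: series_le_cvg cg => // n.
  - exact: normr_ge0.
  - by rewrite /geometric/= exprVn; apply: le_trans (h n).
  - by rewrite /geometric/= exprVn; exact: h.
move=> cs; have -> : v = (fun n => v 0%N + series (telescope v) n).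
  by apply/funext => n; rewrite [LHS]eq_sum_telescope.
by apply: is_cvgD => //; exact: is_cvg_cst.
Qed.

Context {d : measure_display} {X : measurableType d}.
Variables (mu : {measure set X -> \bar R}) (D : set X).

(** With the weights [4 ^+ k] the squared increments still have a summable sequence of integrals,
    [4^-1 ^+ k]. Hence their weighted sum is finite almost everywhere, and there the increments are
    bounded by a multiple of [2 ^- k]. *)
Lemma fast_L2_cvg (f : nat -> X -> R) : measurable D ->
  (forall k, measurable_fun setT (f k)) ->
  (forall k, (\int[mu]_(z in D) ((f k.+1 z - f k z) ^+ 2)%:E <= (16^-1 ^+ k)%:E)%E) ->
  {ae mu, forall z, D z -> cvgn (f ^~ z)}.
Proof.
move=> mD mf hf.
pose g k z := (4 ^+ k * (f k.+1 z - f k z) ^+ 2)%:E : \bar R.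
have g0 k z : (0 <= g k z)%E by rewrite lee_fin; apply: mulr_ge0; [exact: exprn_ge0|exact: sqr_ge0].
have mh k : measurable_fun D (fun z => (f k.+1 z - f k z) ^+ 2).
  apply: measurable_funX; apply: measurable_funB; exact: measurable_funTS.
have mg k : measurable_fun D (g k).
  by apply/measurable_EFinP; exact: measurable_funM.
pose F z := (\sum_(k <oo) g k z)%E.
have F0 z : (0 <= F z)%E by apply: nneseries_ge0.
have mF : measurable_fun D F by apply: ge0_emeasurable_sum.
have IF : (\int[mu]_(z in D) F z < +oo)%E.
  rewrite integral_nneseries//.
  apply: (@le_lt_trans _ _ (\sum_(k <oo) ((4^-1) ^+ k)%:E)%E).
    apply: lee_nneseries => k _; first by move=> _; exact: integral_ge0.
    rewrite ge0_integralZl_real ?exprn_ge0//; last by move=> x _; exact: sqr_ge0.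
    apply: (@le_trans _ _ ((4 ^+ k)%:E * (16^-1 ^+ k)%:E)%E).
      by rewrite lee_wpmul2l// lee_fin exprn_ge0.
    rewrite -EFinM lee_fin -exprMn.
    have -> // : (4 * 16^-1 : R) = 4^-1 by field.
  apply: (@le_lt_trans _ _ 2%:E); last by rewrite ltry.
  apply: lime_le; first by apply: is_cvg_nneseries => k _ _; rewrite lee_fin exprn_ge0.
  apply: nearW => n; rewrite sumEFin lee_fin.
  have := geometric_seriesE 1 (z := 4^-1 : R); rewrite /series/= => /(_ _)/wrap[|].
    by rewrite lt_eqF// invf_lt1// ltr1n.
  move=> /(congr1 (@^~ n))/=; under eq_bigr do rewrite mul1r; move=> ->.
  have : 0 <= (4^-1 : R) ^+ n by rewrite exprn_ge0.
  by rewrite mul1r ler_pdivrMr; lra.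
have iF : mu.-integrable D F.
  apply/integrableP; split => //.
  by rewrite (eq_integral F)// => z _; rewrite gee0_abs.
have := integrable_ae mD iF; apply: filterS => z Fz Dz.
pose S := fine (F z).
have gS k : 4 ^+ k * (f k.+1 z - f k z) ^+ 2 <= S.
  rewrite -lee_fin fineK; last exact: Fz.
  apply: (@le_trans _ _ (\sum_(0 <= i < k.+1) g i z)%E); last first.
    exact: nneseries_lim_ge.
  by rewrite big_nat_recr//= leeDr// sume_ge0.
(* Since [y <= 1 + y ^+ 2], the square is undone without a root, with a larger constant. *)
have key (y s : R) : y ^+ 2 <= s -> y <= 1 + s.
  move=> ys; have := sqr_ge0 (y - 1); have := sqr_ge0 y.
  by rewrite (_ : (y - 1) ^+ 2 = y ^+ 2 - 2 * y + 1); [lra|ring].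
apply: (@geometric_cvg _ (1 + S)) => k.
rewrite ler_pdivlMr ?exprn_gt0//.
have := gS k; set D' := `|_|.
have -> : 4 ^+ k * (f k.+1 z - f k z) ^+ 2 = (D' * 2 ^+ k) ^+ 2.
  rewrite exprMn /D' real_normK ?num_real// mulrC -exprM mulnC exprM.
  by congr (_ * _ ^+ k); rewrite -natrX.
exact: key.
Qed.

End FastConvergence.

Section AlmostEverywhere.
Context {d : measure_display} {X : measurableType d} {R : realType}.
Variables (nu : {measure set X -> \bar R}) (D : set X).

Lemma fatou_ae (f_ : nat -> X -> R) (f : X -> R) (K : R) : measurable D ->
  (forall k, measurable_fun D (f_ k)) -> measurable_fun D f ->
  (forall k z, 0 <= f_ k z) -> (forall z, 0 <= f z) ->
  {ae nu, forall z, D z -> f_ k z @[k --> \oo] --> f z} ->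
  (forall k, (\int[nu]_(z in D) (f_ k z)%:E <= K%:E)%E) ->
  (\int[nu]_(z in D) (f z)%:E <= K%:E)%E.
Proof.
move=> mD mf_ mf f_0 f0 cvf IK.
have mEf k : measurable_fun D (EFin \o f_ k) by exact/measurable_EFinP.
have Ef0 k z : D z -> (0 <= (EFin \o f_ k) z)%E by move=> _; rewrite lee_fin.
have := fatou nu mD mEf Ef0.
have -> : (\int[nu]_(z in D) (f z)%:E =
    \int[nu]_(z in D) limn_einf (fun k => (EFin \o f_ k) z))%E.
  apply: ae_eq_integral => //; first exact/measurable_EFinP.
    rewrite (_ : (fun x => _) = (fun x => - limn_esup (fun k => - (EFin \o f_ k) x))%E).
      apply: measurableT_comp => //; apply: measurable_fun_limn_esup => k.
      exact: measurableT_comp.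
    by apply/funext => x; rewrite -[RHS]oppeK limn_esupN !oppeK.
  apply: filterS cvf => z h Dz; apply/esym.
  have h' : (fun k => (EFin \o f_ k) z) @ \oo --> (f z)%:E.
    by apply: cvg_EFin; [exact: nearW|exact: (h Dz)].
  by rewrite is_cvg_limn_einfE; [exact/cvg_lim|exact: cvgP h'].
move=> /le_trans; apply.
rewrite limn_einf_lim; apply: lime_le.
  exact: is_cvg_einfs.
apply: nearW => k; apply: ereal_inf_le.
by exists (\int[nu]_(z in D) (EFin \o f_ k) z)%E; [exists k => //=|exact: IK].
Qed.

End AlmostEverywhere.

Section Sections.
Context {R : realType}.
Local Notation mu := (@lebesgue_measure R).

Lemma ae_sections (P : R * R -> Prop) : {ae leb2, forall z, P z} ->
  {ae mu, forall t, {ae mu, forall x, P (x, t)}}.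
Proof.
move=> [N [mN N0 NP]].
have mI : measurable_fun setT (fun z : R * R => (\1_N z : R)%:E).
  by apply/measurable_EFinP; exact: measurable_indic.
have I0 z : (0 <= (\1_N z : R)%:E)%E by rewrite lee_fin.
pose F t : \bar R := (\int[mu]_x (\1_N (x, t) : R)%:E)%E.
have F0 t : (0 <= F t)%E by apply: integral_ge0 => x _.
have mF : measurable_fun setT F.
  have /= := @measurable_fun_fubini_tonelli_G _ _ _ _ _ lebesgue_measure _ mI; exact.
have IF : (\int[mu]_t `|F t| = 0)%E.
  under eq_integral do rewrite gee0_abs//.
  have := @tonelli_rect21 R setT measurableT _ mI I0.
  rewrite setXTT integral_indic// setIT => h.
  by rewrite /F -h; exact: N0.
have := (ae_eq_integral_abs mu measurableT mF).1 IF.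
apply: filterS => t /(_ I) Ft0.
exists (ysection N t); split.
- exact: measurable_ysection.
- move: Ft0; rewrite /F/= => <-.
  rewrite (_ : (\int[mu]_x _)%E = (\int[mu]_x (\1_(ysection N t) x : R)%:E)%E).
    by rewrite integral_indic ?setIT//; exact: measurable_ysection.
  apply: eq_integral => x _; congr EFin; rewrite !indicE; congr ((nat_of_bool _)%:R).
  by rewrite /ysection/= [RHS]asboolb.
- by move=> x /= nP; rewrite /ysection/= inE; apply: NP.
Qed.

End Sections.

Section LimnSup.
Context {R : realType}.

(** The limits are defined as upper limits at every point, also where the sequence diverges. Bounds
    and monotonicity in [t] then hold everywhere and not just almost everywhere. *)
Lemma le_limn_sup (lo hi : R) (v v' : nat -> R) :
  (forall k, lo <= v k) -> (forall k, v k <= v' k) -> (forall k, v' k <= hi) ->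
  limn_sup v <= limn_sup v'.
Proof.
move=> lv vv vh.
have cv (w : nat -> R) : (forall k, lo <= w k) -> (forall k, w k <= hi) ->
    has_ubound (range w) /\ cvgn (sups w : nat -> R^o).
  move=> lw wh.
  have ub : has_ubound (range w) by exists hi => _ [k _ <-].
  have lb : has_lbound (range w) by exists lo => _ [k _ <-].
  by split => //; apply/cvg_ex; eexists; exact: (cvg_sups_inf ub lb).
have [ub c] := cv v lv (fun k => le_trans (vv k) (vh k)).
have [ub' c'] := cv v' (fun k => le_trans (lv k) (vv k)) vh.
apply: ler_lim => //; apply: nearW => n.
apply: ge_sup; first by exists (v n), n => /=.
move=> _ [k /= nk <-]; apply: (le_trans (vv k)).
by apply: ub_le_sup; [exact: has_ubound_sdrop|exists k].
Qed.

Lemma limn_sup_cst (c : R) : limn_sup (fun=> c) = c.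
Proof.
rewrite cvg_limn_supE; last exact: is_cvg_cst.
by apply/cvg_lim => //; exact: cvg_cst.
Qed.

Lemma limn_sup_itv (lo hi : R) (v : nat -> R) :
  (forall k, lo <= v k <= hi) -> lo <= limn_sup v <= hi.
Proof.
move=> vb; have lv k : lo <= v k by have /andP[] := vb k.
have vh k : v k <= hi by have /andP[] := vb k.
apply/andP; split.
  by rewrite -[leLHS]limn_sup_cst; apply: (@le_limn_sup lo hi).
by rewrite -[leRHS]limn_sup_cst; apply: (@le_limn_sup lo hi).
Qed.

End LimnSup.

(** * Convexity of the conditions on approximate solutions *)

Section QuasiTheory.
Context {R : realType}.
Local Notation mu := (@lebesgue_measure R).
Variables (a T m M E0 B : R) (u0 w0 : R -> R).
Hypotheses (a0 : 0 < a) (T0 : 0 < T).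
Hypotheses (mw0 : measurable_fun setT w0) (w0m : forall x, `|w0 x| <= m).
Local Notation quasi := (quasi_solution a T m M E0 B u0 w0).
Local Notation out := (output w0).
Implicit Types u p q : R * R -> R.

Let mI : measurable (`[0, T[ : set R). Proof. exact: measurable_itv. Qed.
Let fI : (mu (`[0%R, T[%classic : set R) < +oo)%E.
Proof. by rewrite /= lebesgue_measure_itv/=; case: ifP; rewrite ?ltry. Qed.
Let mS : measurable (strip T : set (plane R)). Proof. exact: measurable_rect. Qed.

Lemma measurable_output p q : measurable_fun setT p -> measurable_fun setT q ->
  measurable_fun setT (out p q).
Proof.
move=> mp mq; apply: measurable_funB => //; apply: measurable_funD => //.
exact: (measurableT_comp mw0 measurable_fst).
Qed.

Lemma output_bounded p q z : 0 <= p z <= M -> 0 <= q z <= M -> `|out p q z| <= m + M.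
Proof.
move=> /andP[p0 pM] /andP[q0 qM]; have := w0m z.1; rewrite /output !ler_norml; lra.
Qed.

Definition weak_integrand u p q (phi : R * R -> R) (z : R * R) : R :=
  (u z + out p q z) * dt phi z + u z * dx phi z.

(** A majorant of the weak integrand common to all approximate solutions: [|u| <= m] and
    [|w| <= m + M]. *)
Definition weak_bound (phi : R * R -> R) (z : R * R) : R :=
  (m + m + M) * `|dt phi z| + m * `|dx phi z|.

Lemma weak_integrand_le u p q phi z : `|u z| <= m -> 0 <= p z <= M -> 0 <= q z <= M ->
  `|weak_integrand u p q phi z| <= weak_bound phi z.
Proof.
move=> um pM qM; apply: (le_trans (ler_normD _ _)); rewrite !normrM lerD//.
  rewrite ler_wpM2r// (le_trans (ler_normD _ _))//.
  by have := output_bounded pM qM; lra.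
by rewrite ler_wpM2r.
Qed.

Lemma measurable_weak_integrand u p q phi : C1_compact_support_in_strip T phi ->
  measurable_fun setT u -> measurable_fun setT p -> measurable_fun setT q ->
  measurable_fun setT (weak_integrand u p q phi).
Proof.
move=> [[_ _ cdx cdt] _] mu_ mp mq.
have mdt := continuous_measurable_plane cdt.
have mdx := continuous_measurable_plane cdx.
apply: measurable_funD; apply: measurable_funM => //.
by apply: measurable_funD => //; exact: measurable_output.
Qed.

Lemma integrable_weak_bound phi : C1_compact_support_in_strip T phi ->
  leb2.-integrable (strip T) (EFin \o weak_bound phi).
Proof.
move=> C1; have [X [Bd [X0 [_ Bd0 _ d0 dB]] _]] := C1_box_supported T0 C1.
have [[_ _ cdx cdt] _] := C1.
have mdt := continuous_measurable_plane cdt.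
have mdx := continuous_measurable_plane cdx.
have m0 : 0 <= m by apply: le_trans (w0m 0).
apply: (@bounded_support_integrable _ _ _ X (`|m + m + M| * Bd + m * Bd)) => //.
- by apply: measurable_funD; apply: measurable_funM => //; exact: measurableT_comp.
- move=> x t /=; rewrite in_itv/= => tT; have [h1 h2] := dB x t tT.
  rewrite /weak_bound (le_trans (ler_normD _ _))// !normrM !normr_id lerD//.
    by rewrite ler_wpM2l.
  by rewrite (ger0_norm m0) ler_wpM2l.
- move=> x t /=; rewrite in_itv/= => tT Xx; have [h1 h2] := d0 x t tT Xx.
  by rewrite /weak_bound h1 h2 normr0 !mulr0 addr0.
Qed.

Lemma integrable_weak_integrand eps u p q phi : quasi eps u p q ->
  C1_compact_support_in_strip T phi ->
  leb2.-integrable (strip T) (EFin \o weak_integrand u p q phi).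
Proof.
move=> Q C1; have := integrable_weak_bound C1; apply: le_integrable => //.
  apply/measurable_EFinP; apply: measurable_funTS.
  by apply: measurable_weak_integrand; [exact: C1|exact: quasi_mu Q|exact: quasi_mp Q|exact: quasi_mq Q].
move=> z _; rewrite /= lee_fin (le_trans _ (ler_norm _))//.
by apply: weak_integrand_le; [exact: quasi_u Q _|exact: quasi_p Q _|exact: quasi_q Q _].
Qed.

Lemma quasi_le eps eps' u p q : eps <= eps' -> quasi eps u p q -> quasi eps' u p q.
Proof. by move=> ee [*]; split => //; rewrite (@le_trans _ _ eps%:E) ?lee_fin. Qed.

Definition mid (f g : R * R -> R) (z : R * R) : R := 2^-1 * (f z + g z).

Lemma mid_output p q p' q' z :
  out (mid p p') (mid q q') z = 2^-1 * (out p q z + out p' q' z).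
Proof. by rewrite /output /mid; field. Qed.

Lemma measurable_mid f g : measurable_fun setT f -> measurable_fun setT g ->
  measurable_fun setT (mid f g).
Proof. by move=> mf mg; apply: measurable_funM => //; exact: measurable_funD. Qed.

Lemma norm_mid (x y : R) : `|2^-1 * (x + y)| <= 2^-1 * (`|x| + `|y|).
Proof. by rewrite normrM ger0_norm ?invr_ge0// ler_wpM2l ?invr_ge0// ler_normD. Qed.

Lemma sqr_mid (x y : R) : (2^-1 * (x + y)) ^+ 2 <= 2^-1 * (x ^+ 2 + y ^+ 2).
Proof.
rewrite -subr_ge0.
have -> : 2^-1 * (x ^+ 2 + y ^+ 2) - (2^-1 * (x + y)) ^+ 2 = (2^-1 * (x - y)) ^+ 2 by field.
exact: sqr_ge0.
Qed.

Lemma energy_ge0 (u w p q : R) : 0 <= p -> 0 <= q ->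
  0 <= u ^+ 2 / 2 + (w ^+ 2 / 2 + a * (p + q)).
Proof.
move=> p0 q0; rewrite addr_ge0 ?divr_ge0 ?sqr_ge0// addr_ge0 ?divr_ge0 ?sqr_ge0//.
by rewrite mulr_ge0 ?(ltW a0)// addr_ge0.
Qed.

Lemma measurable_energy u p q : measurable_fun setT u -> measurable_fun setT p ->
  measurable_fun setT q -> measurable_fun setT
    (fun z => u z ^+ 2 / 2 + (out p q z ^+ 2 / 2 + a * (p z + q z))).
Proof.
move=> mu_ mp mq; have mo := measurable_output mp mq.
apply: measurable_funD; first by apply: measurable_funM => //; exact: measurable_funX.
apply: measurable_funD; first by apply: measurable_funM => //; exact: measurable_funX.
by apply: measurable_funM => //; exact: measurable_funD.
Qed.

Lemma measurable_L1 u p q : measurable_fun setT u -> measurable_fun setT p ->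
  measurable_fun setT q -> measurable_fun setT (fun z => `|u z| + `|out p q z|).
Proof.
move=> mu_ mp mq; have mo := measurable_output mp mq.
by apply: measurable_funD; exact: measurableT_comp.
Qed.

Lemma measurable_gap u p q : measurable_fun setT u -> measurable_fun setT p ->
  measurable_fun setT q ->
  measurable_fun setT (fun z => Num.max (`|u z - out p q z| - a) 0).
Proof.
move=> mu_ mp mq; have mo := measurable_output mp mq.
apply: measurable_maxr => //; apply: measurable_funB => //.
by apply: measurableT_comp => //; exact: measurable_funB.
Qed.

Lemma measurable_row (f : R * R -> R) t : measurable_fun setT f ->
  measurable_fun setT (fun x : R => f (x, t)).
Proof. by move=> mf; apply: measurableT_comp mf _; exact: pair2_measurable. Qed.

(** The dissipation [a * (p + q)] is linear in the triple, so convexity is needed only for squares,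
    absolute values and positive parts. The weak equation is affine with a common initial term, and
    finiteness of the integrals allows averaging it. *)
Lemma quasi_mid eps u p q u' p' q' : quasi eps u p q -> quasi eps u' p' q' ->
  quasi eps (mid u u') (mid p p') (mid q q').
Proof.
move=> Q Q'.
have [mu_ mp mq] := And3 (quasi_mu Q) (quasi_mp Q) (quasi_mq Q).
have [mu_' mp' mq'] := And3 (quasi_mu Q') (quasi_mp Q') (quasi_mq Q').
have P0 z : 0 <= p z by have /andP[] := quasi_p Q z.
have Q0 z : 0 <= q z by have /andP[] := quasi_q Q z.
have P0' z : 0 <= p' z by have /andP[] := quasi_p Q' z.
have Q0' z : 0 <= q' z by have /andP[] := quasi_q Q' z.
have M0 f f' : (forall z, 0 <= f z) -> (forall z, 0 <= f' z) -> forall z, 0 <= mid f f' z.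
  by move=> f0 f0' z; rewrite mulr_ge0 ?invr_ge0// addr_ge0.
split; try exact: measurable_mid.
- move=> z; have := quasi_u Q z; have := quasi_u Q' z.
  by have := norm_mid (u z) (u' z); rewrite /mid; lra.
- move=> z; have := quasi_p Q z; have := quasi_p Q' z; rewrite /mid; lra.
- move=> z; have := quasi_q Q z; have := quasi_q Q' z; rewrite /mid; lra.
- move=> x s t st; have := quasi_p_homo Q x st; have := quasi_p_homo Q' x st.
  by rewrite /mid; lra.
- move=> x s t st; have := quasi_q_homo Q x st; have := quasi_q_homo Q' x st.
  by rewrite /mid; lra.
- move=> t tT.
  apply: (integral_midpoint_le _ _ _ _ _ _ _ (quasi_energy Q tT) (quasi_energy Q' tT)) => //.
  + exact: (measurable_row t (measurable_energy mu_ mp mq)).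
  + exact: (measurable_row t (measurable_energy mu_' mp' mq')).
  + exact: (measurable_row t (measurable_energy (measurable_mid mu_ mu_')
      (measurable_mid mp mp') (measurable_mid mq mq'))).
  + by move=> x _; exact: energy_ge0.
  + by move=> x _; exact: energy_ge0.
  + move=> x _; rewrite energy_ge0 ?M0//= mid_output.
    have := sqr_mid (u (x, t)) (u' (x, t)).
    have := sqr_mid (out p q (x, t)) (out p' q' (x, t)).
    by rewrite /mid; lra.
- move=> t tT.
  apply: (integral_midpoint_le _ _ _ _ _ _ _ (quasi_L1 Q tT) (quasi_L1 Q' tT)) => //.
  + exact: (measurable_row t (measurable_L1 mu_ mp mq)).
  + exact: (measurable_row t (measurable_L1 mu_' mp' mq')).
  + exact: (measurable_row t (measurable_L1 (measurable_mid mu_ mu_')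
      (measurable_mid mp mp') (measurable_mid mq mq'))).
  + move=> x _; rewrite addr_ge0//= mid_output.
    have := norm_mid (u (x, t)) (u' (x, t)).
    have := norm_mid (out p q (x, t)) (out p' q' (x, t)).
    by rewrite /mid; lra.
- move=> phi C1.
  have i := integrable_weak_integrand Q C1; have i' := integrable_weak_integrand Q' C1.
  have := quasi_weak Q C1; have := quasi_weak Q' C1.
  rewrite -/(EFin \o weak_integrand u p q phi).
  have -> : (\int[leb2]_(z in strip T) ((mid u u' z + out (mid p p') (mid q q') z) * dt phi z +
      mid u u' z * dx phi z)%:E = (2^-1)%:E *
      (\int[leb2]_(z in strip T) (EFin \o weak_integrand u p q phi) z +
       \int[leb2]_(z in strip T) (EFin \o weak_integrand u' p' q' phi) z))%E.
    rewrite -integralD// -integralZl//; last exact: integrableD.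
    apply: eq_integral => z _; rewrite /= -EFinD -EFinM mid_output; congr EFin.
    by rewrite /weak_integrand /mid; ring.
  move: (integrable_fin_num mS i) (integrable_fin_num mS i').
  rewrite -[X in (X + _ = 0)%E -> _]/(\int[leb2]_(z in strip T) (EFin \o weak_integrand u' p' q' phi) z)%E.
  move=> + + + H; rewrite -[X in (X + _ = 0)%E]/(\int[leb2]_(z in strip T) (EFin \o weak_integrand u p q phi) z)%E in H.
  move: H.
  move: (\int[leb2]_(z in _) (EFin \o weak_integrand u p q phi) z)%E => x.
  move: (\int[leb2]_(z in _) (EFin \o weak_integrand u' p' q' phi) z)%E => y.
  move: (\int[_]_x _)%E => k.
  move: x y k => [x| |] [y| |] [k| |] //= [xk] _ _ [yk].
  by rewrite -!EFinD; congr EFin; lra.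
- apply: (integral_midpoint_le mS _ _ _ _ _ _ (quasi_gap Q) (quasi_gap Q')).
  + exact: (measurable_funTS (measurable_gap mu_ mp mq)).
  + exact: (measurable_funTS (measurable_gap mu_' mp' mq')).
  + exact: (measurable_funTS (measurable_gap (measurable_mid mu_ mu_')
      (measurable_mid mp mp') (measurable_mid mq mq'))).
  + by move=> z _; rewrite le_max lexx orbT.
  + by move=> z _; rewrite le_max lexx orbT.
  + move=> z _; rewrite le_max lexx orbT/= mid_output.
    have := norm_mid (u z - out p q z) (u' z - out p' q' z).
    have -> : 2^-1 * (u z - out p q z + (u' z - out p' q' z)) =
      mid u u' z - 2^-1 * (out p q z + out p' q' z) by rewrite /mid; ring.
    have := le_max (`|u z - out p q z| - a) (`|u z - out p q z| - a) 0.
    have := le_max 0 (`|u z - out p q z| - a) 0.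
    have := le_max (`|u' z - out p' q' z| - a) (`|u' z - out p' q' z| - a) 0.
    have := le_max 0 (`|u' z - out p' q' z| - a) 0.
    rewrite !lexx ?orbT/= => h1 h2 h3 h4 h; rewrite ge_max; apply/andP; split; lra.
Qed.

End QuasiTheory.

Section EnergyArithmetic.
Context {R : realType}.

Lemma parallelogram_fine (x y c d : \bar R) : (0 <= x)%E -> (0 <= y)%E ->
  c \is a fin_num -> d \is a fin_num -> (x + 4%:E * y = 2%:E * c + 2%:E * d)%E ->
  x \is a fin_num /\ fine x = 2 * fine c + 2 * fine d - 4 * fine y.
Proof.
move: x y c d => [x| |] [y| |] [c| |] [d| |] //= _ _ _ _.
- by rewrite -!EFinM -!EFinD => -[h]; split => //; lra.
- by rewrite gt0_muley ?lte_fin// addey.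
- by rewrite gt0_muley ?lte_fin.
Qed.

(** The factor 2 absorbs [u ^+ 2]. Since [p ^+ 2 <= M * p], and likewise for [q], the factor [M / a]
    absorbs the other two squares in the dissipation. *)
Lemma sqr_le_energy (a M u w p q : R) : 0 < a -> 0 <= p <= M -> 0 <= q <= M ->
  u ^+ 2 + p ^+ 2 + q ^+ 2 <=
  (2 + M / a) * (u ^+ 2 / 2 + (w ^+ 2 / 2 + a * (p + q))).
Proof.
move=> a0 /andP[p0 pM] /andP[q0 qM].
have Ma : 0 <= M / a by rewrite divr_ge0 ?(ltW a0)//; lra.
have -> : (2 + M / a) * (u ^+ 2 / 2 + (w ^+ 2 / 2 + a * (p + q))) =
  u ^+ 2 + w ^+ 2 + 2 * (a * (p + q)) + M / a * (u ^+ 2 / 2 + w ^+ 2 / 2) + M * (p + q).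
  by field; exact: lt0r_neq0.
have pp : p ^+ 2 <= M * p by rewrite expr2 ler_wpM2r.
have qq : q ^+ 2 <= M * q by rewrite expr2 ler_wpM2r.
have h1 : 0 <= a * (p + q) by rewrite mulr_ge0 ?(ltW a0)// addr_ge0.
have h2 : 0 <= M / a * (u ^+ 2 / 2 + w ^+ 2 / 2).
  by rewrite mulr_ge0// addr_ge0// divr_ge0 ?sqr_ge0.
by have := sqr_ge0 w; lra.
Qed.

End EnergyArithmetic.

Section Limit.
Context {R : realType}.
Local Notation mu := (@lebesgue_measure R).
Variables (a T m M E0 B : R) (u0 w0 : R -> R).
Hypotheses (a0 : 0 < a) (T0 : 0 < T).
Hypotheses (mw0 : measurable_fun setT w0) (w0m : forall x, `|w0 x| <= m).
Local Notation quasi := (quasi_solution a T m M E0 B u0 w0).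
Local Notation out := (output w0).
Implicit Types u p q : R * R -> R.

Let mI : measurable (`[0, T[ : set R). Proof. exact: measurable_itv. Qed.
Let mS : measurable (strip T : set (plane R)). Proof. exact: measurable_rect. Qed.

Lemma strip_integral_le (f : R * R -> R) (K : R) : measurable_fun setT f ->
  (forall z, 0 <= f z) ->
  (forall t : R, 0 <= t < T -> (\int[mu]_x (f (x, t))%:E <= K%:E)%E) ->
  (\int[leb2]_(z in strip T) (f z)%:E <= (T * K)%:E)%E.
Proof.
move=> mf f0 fK.
have mEf : measurable_fun setT (EFin \o f) by exact/measurable_EFinP.
have Ef0 z : (0 <= (EFin \o f) z)%E by rewrite lee_fin.
have K0 : 0 <= K.
  have := fK 0; rewrite lexx T0 => /(_ isT); rewrite -lee_fin; apply: le_trans.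
  by apply: integral_ge0 => x _; rewrite lee_fin.
rewrite [X in (X <= _)%E](tonelli_rect21 mI mEf Ef0).
have -> : (T * K)%:E = (\int[mu]_(t in `[0%R, T[) (cst K%:E) t)%E.
  rewrite integral_cst//= lebesgue_measure_itv/= lte_fin T0 -EFinB subr0 -EFinM.
  by congr EFin; ring.
apply: ge0_le_integral => //.
- by move=> t _; apply: integral_ge0 => x _.
- apply: measurable_funTS.
  have /= := @measurable_fun_fubini_tonelli_G _ _ _ _ _ lebesgue_measure _ mEf; exact.
Qed.

Definition sqnorm (s : (R * R -> R) * (R * R -> R) * (R * R -> R)) : \bar R :=
  (\int[leb2]_(z in strip T) (s.1.1 z ^+ 2 + s.1.2 z ^+ 2 + s.2 z ^+ 2)%:E)%E.

Lemma measurable_sqnorm u p q : measurable_fun setT u -> measurable_fun setT p ->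
  measurable_fun setT q -> measurable_fun setT (fun z => u z ^+ 2 + p z ^+ 2 + q z ^+ 2).
Proof.
by move=> mu_ mp mq; apply: measurable_funD; [apply: measurable_funD|]; exact: measurable_funX.
Qed.

Lemma sqnorm_ge0 s : (0 <= sqnorm s)%E.
Proof. by apply: integral_ge0 => z _; rewrite lee_fin !addr_ge0 ?sqr_ge0. Qed.

Lemma sqnorm_le eps u p q : quasi eps u p q ->
  (sqnorm (u, p, q) <= (T * ((2 + M / a) * E0))%:E)%E.
Proof.
move=> Q; have [mu_ mp mq] := And3 (quasi_mu Q) (quasi_mp Q) (quasi_mq Q).
have P0 z : 0 <= p z by have /andP[] := quasi_p Q z.
have Q0 z : 0 <= q z by have /andP[] := quasi_q Q z.
have M0 : 0 <= M by have /andP[] := quasi_p Q (0, 0); exact: le_trans.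
apply: strip_integral_le; first exact: measurable_sqnorm.
  by move=> z; rewrite !addr_ge0 ?sqr_ge0.
move=> t tT; have mE := measurable_row t (measurable_energy a mw0 mu_ mp mq).
have c0 : 0 <= 2 + M / a by rewrite addr_ge0// divr_ge0 ?(ltW a0).
apply: (@le_trans _ _ ((2 + M / a)%:E * \int[mu]_x (u (x, t) ^+ 2 / 2 +
   (out p q (x, t) ^+ 2 / 2 + a * (p (x, t) + q (x, t))))%:E)%E).
  rewrite -ge0_integralZl_real//; last by move=> x _; exact: energy_ge0.
  apply: le_integral_EFin => //.
  - exact: (measurable_row t (measurable_sqnorm mu_ mp mq)).
  - exact: measurable_funM.
  - by move=> x _; rewrite /= !addr_ge0 ?sqr_ge0.
  - by move=> x _; apply: sqr_le_energy => //; [exact: quasi_p Q _|exact: quasi_q Q _].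
by rewrite EFinM lee_wpmul2l ?lee_fin//; exact: quasi_energy Q _ tT.
Qed.

Let mid3 (s s' : (R * R -> R) * (R * R -> R) * (R * R -> R)) :=
  (mid s.1.1 s'.1.1, mid s.1.2 s'.1.2, mid s.2 s'.2).
Let sub3 (s s' : (R * R -> R) * (R * R -> R) * (R * R -> R)) :=
  ((fun z => s'.1.1 z - s.1.1 z), (fun z => s'.1.2 z - s.1.2 z), (fun z => s'.2 z - s.2 z)).

(** Without subtraction the identity holds in the extended reals; [parallelogram_fine] then reads
    off the finiteness of the distance. *)
Lemma sqnorm_parallelogram s s' :
  measurable_fun setT s.1.1 -> measurable_fun setT s.1.2 -> measurable_fun setT s.2 ->
  measurable_fun setT s'.1.1 -> measurable_fun setT s'.1.2 -> measurable_fun setT s'.2 ->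
  (sqnorm (sub3 s s') + 4%:E * sqnorm (mid3 s s') = 2%:E * sqnorm s + 2%:E * sqnorm s')%E.
Proof.
move=> m1 m2 m3 m1' m2' m3'; rewrite /sqnorm.
have msub : measurable_fun setT (fun z => (s'.1.1 z - s.1.1 z) ^+ 2 +
   (s'.1.2 z - s.1.2 z) ^+ 2 + (s'.2 z - s.2 z) ^+ 2).
  by apply: (measurable_sqnorm (u := fun z => s'.1.1 z - s.1.1 z)
    (p := fun z => s'.1.2 z - s.1.2 z) (q := fun z => s'.2 z - s.2 z)); exact: measurable_funB.
have mm := measurable_sqnorm (measurable_mid m1 m1') (measurable_mid m2 m2') (measurable_mid m3 m3').
have ms := measurable_sqnorm m1 m2 m3.
have ms' := measurable_sqnorm m1' m2' m3'.
have pos (x y z : R) : 0 <= x ^+ 2 + y ^+ 2 + z ^+ 2 by rewrite !addr_ge0 ?sqr_ge0.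
have c4 : 0 <= 4 :> R by []. have c2 : 0 <= 2 :> R by [].
rewrite -!ge0_integralZl_real//; try by [exact: measurable_funTS|move=> x _; exact: pos].
rewrite -!ge0_integralD_real//;
  try by [exact: measurable_funTS|apply: measurable_funTS; exact: measurable_funM
         |move=> x _; exact: pos|move=> x _; rewrite mulr_ge0].
by apply: eq_integral => z _; congr EFin; rewrite /= /mid; field.
Qed.

Lemma minimizing_sequence : (forall eps, 0 < eps -> exists u p q, quasi eps u p q) ->
  exists u_ p_ q_ : nat -> R * R -> R, forall k,
    [/\ quasi k.+1%:R^-1 (u_ k) (p_ k) (q_ k),
     (\int[leb2]_(z in strip T) ((u_ k.+1 z - u_ k z) ^+ 2)%:E <= (16^-1 ^+ k)%:E)%E,
     (\int[leb2]_(z in strip T) ((p_ k.+1 z - p_ k z) ^+ 2)%:E <= (16^-1 ^+ k)%:E)%E &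
     (\int[leb2]_(z in strip T) ((q_ k.+1 z - q_ k z) ^+ 2)%:E <= (16^-1 ^+ k)%:E)%E ].
Proof.
move=> Qex.
pose C eps (s : (R * R -> R) * (R * R -> R) * (R * R -> R)) := quasi eps s.1.1 s.1.2 s.2.
pose J s := fine (sqnorm s); pose dist s s' := fine (sqnorm (sub3 s s')).
have Cfin eps s : C eps s -> sqnorm s \is a fin_num.
  move=> Cs; rewrite ge0_fin_numE ?sqnorm_ge0//; have := sqnorm_le Cs.
  by rewrite -!surjective_pairing => /le_lt_trans; apply; rewrite ltry.
have par eps s s' : C eps s -> C eps s' ->
    sqnorm (sub3 s s') \is a fin_num /\ dist s s' = 2 * J s + 2 * J s' - 4 * J (mid3 s s').
  move=> Cs Cs'; apply: parallelogram_fine; rewrite ?sqnorm_ge0//.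
  - exact: Cfin Cs.
  - exact: Cfin Cs'.
  - apply: sqnorm_parallelogram; [exact: quasi_mu Cs|exact: quasi_mp Cs|exact: quasi_mq Cs
      |exact: quasi_mu Cs'|exact: quasi_mp Cs'|exact: quasi_mq Cs'].
have C_ex e : 0 < e -> exists s, C e s by move=> /Qex[u [p [q Q]]]; exists (u, p, q).
have C_le e e' s : e <= e' -> C e s -> C e' s by move=> ee; exact: quasi_le.
have C_mid e s s' : C e s -> C e s' -> C e (mid3 s s') by move=> Cs Cs'; exact: quasi_mid.
have J_bnd e s : C e s -> 0 <= J s <= T * ((2 + M / a) * E0).
  move=> Cs; rewrite fine_ge0 ?sqnorm_ge0//=.
  rewrite -lee_fin fineK; last exact: Cfin Cs.
  by have := sqnorm_le Cs; rewrite -!surjective_pairing.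
have J_mid e s s' : C e s -> C e s' -> dist s s' = 2 * J s + 2 * J s' - 4 * J (mid3 s s').
  by move=> Cs Cs'; have [] := par e s s' Cs Cs'.
(* The rate is the one that [fast_L2_cvg] asks for. *)
have d0 k : 0 < (16^-1 : R) ^+ k by rewrite exprn_gt0// invr_gt0.
have dS k : (16^-1 : R) ^+ k.+1 <= 16^-1 ^+ k.
  by rewrite exprS ler_piMl ?exprn_ge0// invf_le1// ler1n.
have [z zP] := almost_minimizers C_ex C_le C_mid J_bnd J_mid d0 dS.
exists (fun k => (z k).1.1), (fun k => (z k).1.2), (fun k => (z k).2) => k.
have [Ck dk] := zP k; have [Ck' _] := zP k.+1.
have kk : (k.+2%:R^-1 : R) <= k.+1%:R^-1 by rewrite lef_pV2 ?posrE// ler_nat.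
have Ck1 : C k.+1%:R^-1 (z k.+1) by exact: quasi_le kk Ck'.
have [fd _] := par _ _ _ Ck Ck1.
have bnd (g : R * R -> R) : measurable_fun setT g ->
    (forall y, g y ^+ 2 <= ((z k.+1).1.1 y - (z k).1.1 y) ^+ 2 +
      ((z k.+1).1.2 y - (z k).1.2 y) ^+ 2 + ((z k.+1).2 y - (z k).2 y) ^+ 2) ->
    (\int[leb2]_(y in strip T) (g y ^+ 2)%:E <= (16^-1 ^+ k)%:E)%E.
  move=> mg hg; apply: (@le_trans _ _ (sqnorm (sub3 (z k) (z k.+1)))).
    apply: le_integral_EFin => //.
    - by apply: measurable_funTS; exact: measurable_funX.
    - apply: measurable_funTS.
      apply: (measurable_sqnorm (u := fun y => (z k.+1).1.1 y - (z k).1.1 y)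
        (p := fun y => (z k.+1).1.2 y - (z k).1.2 y) (q := fun y => (z k.+1).2 y - (z k).2 y));
      apply: measurable_funB; [exact: quasi_mu Ck1|exact: quasi_mu Ck|exact: quasi_mp Ck1
        |exact: quasi_mp Ck|exact: quasi_mq Ck1|exact: quasi_mq Ck].
    - by move=> y _; exact: sqr_ge0.
  by rewrite -(fineK fd) lee_fin.
split => //.
- apply: bnd => [|y]; first by apply: measurable_funB; [exact: quasi_mu Ck1|exact: quasi_mu Ck].
  by rewrite -addrA lerDl addr_ge0 ?sqr_ge0.
- apply: bnd => [|y]; first by apply: measurable_funB; [exact: quasi_mp Ck1|exact: quasi_mp Ck].
  by rewrite addrAC lerDr addr_ge0 ?sqr_ge0.
- apply: bnd => [|y]; first by apply: measurable_funB; [exact: quasi_mq Ck1|exact: quasi_mq Ck].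
  by rewrite lerDr addr_ge0 ?sqr_ge0.
Qed.

End Limit.

Section AeImply.
Context {d : measure_display} {X : measurableType d} {R : realType}.
Variables (nu : {measure set X -> \bar R}) (A A' : X -> Prop).

Lemma ae_imply : (forall z, A z -> A' z) ->
  {ae nu, forall z, A z} -> {ae nu, forall z, A' z}.
Proof. by move=> AA; apply: filterS. Qed.

Lemma ae_and : {ae nu, forall z, A z} -> {ae nu, forall z, A' z} ->
  {ae nu, forall z, A z /\ A' z}.
Proof. exact: filterI. Qed.

End AeImply.

(** * The limit triple *)

Section Limit.
Context {R : realType}.
Local Notation mu := (@lebesgue_measure R).
Variables (a T m M E0 B : R) (u0 w0 : R -> R).
Hypotheses (a0 : 0 < a) (T0 : 0 < T).
Hypotheses (mw0 : measurable_fun setT w0) (w0m : forall x, `|w0 x| <= m).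
Local Notation quasi := (quasi_solution a T m M E0 B u0 w0).
Local Notation out := (output w0).

Let mI : measurable (`[0, T[ : set R). Proof. exact: measurable_itv. Qed.
Let mS : measurable (strip T : set (plane R)). Proof. exact: measurable_rect. Qed.

Lemma cvg_sqr (f : nat -> R) (l : R) : f @ \oo --> l ->
  (fun k => f k ^+ 2) @ \oo --> l ^+ 2.
Proof.
move=> fl; rewrite expr2 (_ : (fun k => _) = (fun k => f k * f k)); first exact: cvgM.
by apply/funext => k; rewrite expr2.
Qed.

Lemma cvg_pos (f : nat -> R) (l : R) : f @ \oo --> l ->
  (fun k => Num.max (f k) 0) @ \oo --> Num.max l 0.
Proof.
move=> fl; rewrite maxr_absE (_ : (fun k => _) = (fun k => (f k + 0 + `|f k - 0|) / 2)).
  apply: cvgM; last exact: cvg_cst.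
  apply: cvgD; first by apply: cvgD => //; exact: cvg_cst.
  by apply: cvg_norm; apply: cvgB => //; exact: cvg_cst.
by apply/funext => k; rewrite maxr_absE.
Qed.

(** Convergence almost everywhere in the strip gives convergence on almost every horizontal line, so
    the energy bound is kept for almost every [t] only. Energy, L1 norm and gap pass to the limit by
    Fatou, the weak equation by dominated convergence. *)
Lemma quasi_solution_limit : (forall eps : R, 0 < eps -> exists u p q, quasi eps u p q) ->
  exists u p q : R * R -> R,
  [/\ [/\ measurable_fun setT u, measurable_fun setT p & measurable_fun setT q],
      [/\ forall z, `|u z| <= m, forall z, 0 <= p z <= M & forall z, 0 <= q z <= M],
      [/\ forall x s t, s <= t -> p (x, s) <= p (x, t),
          forall x s t, s <= t -> q (x, s) <= q (x, t),
          {ae mu, forall t : R, 0 <= t < T ->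
            (\int[mu]_x (u (x, t) ^+ 2 / 2 + (out p q (x, t) ^+ 2 / 2
               + a * (p (x, t) + q (x, t))))%:E <= E0%:E)%E} &
          (\int[leb2]_(z in strip T) (`|u z| + `|out p q z|)%:E <= (T * B)%:E)%E],
      (forall phi, C1_compact_support_in_strip T phi ->
        (\int[leb2]_(z in strip T) (weak_integrand w0 u p q phi z)%:E
         + \int[mu]_x ((u0 x + w0 x) * phi (x, 0))%:E = 0)%E) &
      {ae leb2, forall z, strip T z -> `|u z - out p q z| <= a} ].
Proof.
move=> Qex; have [u_ [p_ [q_ H]]] := minimizing_sequence a0 T0 mw0 w0m Qex.
have Q k : quasi k.+1%:R^-1 (u_ k) (p_ k) (q_ k) by have [] := H k.
have mu_ k := quasi_mu (Q k); have mp_ k := quasi_mp (Q k); have mq_ k := quasi_mq (Q k).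
have ub k z := quasi_u (Q k) z; have pb k z := quasi_p (Q k) z; have qb k z := quasi_q (Q k) z.
have ub' k z : - m <= u_ k z <= m by rewrite -ler_norml.
pose u z := limn_sup (u_ ^~ z); pose p z := limn_sup (p_ ^~ z); pose q z := limn_sup (q_ ^~ z).
have mlim (f : nat -> R * R -> R) lo hi : (forall k, measurable_fun setT (f k)) ->
    (forall k z, lo <= f k z <= hi) -> measurable_fun setT (fun z => limn_sup (f ^~ z)).
  move=> mf fb; apply: measurable_fun_limn_sup => // z _.
    by exists hi => _ [k _ <-]; have /andP[] := fb k z.
  by exists lo => _ [k _ <-]; have /andP[] := fb k z.
have mu' : measurable_fun setT u := mlim _ _ _ mu_ ub'.
have mp : measurable_fun setT p := mlim _ _ _ mp_ pb.
have mq : measurable_fun setT q := mlim _ _ _ mq_ qb.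
have um z : `|u z| <= m by rewrite ler_norml; apply: limn_sup_itv => k; exact: ub'.
have pM z : 0 <= p z <= M by apply: limn_sup_itv => k.
have qM z : 0 <= q z <= M by apply: limn_sup_itv => k.
have cvu : {ae leb2, forall z, strip T z -> cvgn (u_ ^~ z)}.
  by apply: fast_L2_cvg => // k; have [] := H k.
have cvp : {ae leb2, forall z, strip T z -> cvgn (p_ ^~ z)}.
  by apply: fast_L2_cvg => // k; have [] := H k.
have cvq : {ae leb2, forall z, strip T z -> cvgn (q_ ^~ z)}.
  by apply: fast_L2_cvg => // k; have [] := H k.
have cv : {ae leb2, forall z, strip T z -> [/\ u_ ^~ z @ \oo --> u z,
    p_ ^~ z @ \oo --> p z & q_ ^~ z @ \oo --> q z]}.
  apply: ae_imply (ae_and cvu (ae_and cvp cvq)) => z [hu [hp hq]] Sz.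
  have cE (f : nat -> R * R -> R) : cvgn (f ^~ z) -> f ^~ z @ \oo --> limn_sup (f ^~ z).
    by move=> cf; rewrite cvg_limn_supE.
  by split; apply: cE; [exact: hu|exact: hp|exact: hq].
have cvo z : [/\ u_ ^~ z @ \oo --> u z, p_ ^~ z @ \oo --> p z & q_ ^~ z @ \oo --> q z] ->
    (fun k => out (p_ k) (q_ k) z) @ \oo --> out p q z.
  move=> [hu hp hq]; apply: cvgB => //; apply: cvgD => //; exact: cvg_cst.
exists u, p, q; split => //.
- split.
  + move=> x s t st; apply: (@le_limn_sup _ 0 M) => k.
    * by have /andP[] := pb k (x, s).
    * exact: quasi_p_homo (Q k) _ _ _ st.
    * by have /andP[] := pb k (x, t).
  + move=> x s t st; apply: (@le_limn_sup _ 0 M) => k.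
    * by have /andP[] := qb k (x, s).
    * exact: quasi_q_homo (Q k) _ _ _ st.
    * by have /andP[] := qb k (x, t).
  + apply: ae_imply (ae_sections cv) => t ht tT.
    have P0 k z : 0 <= p_ k z by have /andP[] := pb k z.
    have Q0 k z : 0 <= q_ k z by have /andP[] := qb k z.
    apply: (@fatou_ae _ _ _ lebesgue_measure setT (fun k x => u_ k (x, t) ^+ 2 / 2 +
      (out (p_ k) (q_ k) (x, t) ^+ 2 / 2 + a * (p_ k (x, t) + q_ k (x, t))))) => //.
    * by move=> k; exact: (measurable_row t (measurable_energy a mw0 (mu_ k) (mp_ k) (mq_ k))).
    * exact: (measurable_row t (measurable_energy a mw0 mu' mp mq)).
    * by move=> k x; exact: energy_ge0.
    * move=> x; apply: energy_ge0 => //.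
        by have /andP[] := pM (x, t).
      by have /andP[] := qM (x, t).
    * apply: ae_imply ht => x h _.
      have St : strip T (x, t) by split => //=; rewrite in_itv.
      have [hu hp hq] := h St; have ho := cvo _ (h St).
      apply: cvgD; first by apply: cvgM; [exact: cvg_sqr|exact: cvg_cst].
      apply: cvgD; first by apply: cvgM; [exact: cvg_sqr|exact: cvg_cst].
      by apply: cvgM; [exact: cvg_cst|exact: cvgD].
    * by move=> k; exact: quasi_energy (Q k) _ tT.
  + apply: (@fatou_ae _ _ _ leb2 (strip T) (fun k z => `|u_ k z| + `|out (p_ k) (q_ k) z|)) => //.
    * by move=> k; exact: measurable_funTS (measurable_L1 mw0 (mu_ k) (mp_ k) (mq_ k)).
    * exact: measurable_funTS (measurable_L1 mw0 mu' mp mq).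
    * apply: ae_imply cv => z h Sz; have [hu hp hq] := h Sz; have ho := cvo _ (h Sz).
      by apply: cvgD; exact: cvg_norm.
    * move=> k; apply: strip_integral_le => //.
        exact: (measurable_L1 mw0 (mu_ k) (mp_ k) (mq_ k)).
      by move=> t tT; exact: quasi_L1 (Q k) _ tT.
- move=> phi C1.
  pose G k z := weak_integrand w0 (u_ k) (p_ k) (q_ k) phi z.
  have mG k : measurable_fun (strip T) (EFin \o G k).
    by apply/measurable_EFinP; apply: measurable_funTS; exact: (measurable_weak_integrand mw0 C1).
  have mG' : measurable_fun (strip T) (EFin \o weak_integrand w0 u p q phi).
    by apply/measurable_EFinP; apply: measurable_funTS; exact: (measurable_weak_integrand mw0 C1).
  have cG : {ae leb2, forall z, strip T z ->
      (EFin \o G k) z @[k --> \oo] --> (EFin \o weak_integrand w0 u p q phi) z}.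
    apply: ae_imply cv => z h Sz; have [hu hp hq] := h Sz; have ho := cvo _ (h Sz).
    apply: cvg_EFin; first exact: nearW.
    apply: cvgD; (apply: cvgM; last exact: cvg_cst) => //.
    exact: cvgD.
  have bG : {ae leb2, forall z k, strip T z ->
      (`|(EFin \o G k) z| <= (EFin \o weak_bound m M phi) z)%E}.
    exists set0; split => // z /=; apply: contra_notP => _ k Sz.
    by rewrite lee_fin; exact: (weak_integrand_le w0m _ (ub k z) (pb k z) (qb k z)).
  have iB := integrable_weak_bound M T0 w0m C1.
  have [_ _ dc] := dominated_convergence mS mG mG' cG iB bG.
  pose K0 := (\int[lebesgue_measure]_x ((u0 x + w0 x) * phi (x, 0))%:E)%E.
  have GK k : (\int[leb2]_(z in strip T) (EFin \o G k) z + K0 = 0)%E by exact: (quasi_weak (Q k)).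
  have GE k : (\int[leb2]_(z in strip T) (EFin \o G k) z = - K0)%E /\ K0 \is a fin_num.
    have aux (x y : \bar R) : (x + y = 0)%E -> x \is a fin_num -> (x = - y)%E /\ y \is a fin_num.
      by move: x y => [x| |] [y| |]//= [xy] _; split => //; congr EFin; lra.
    apply: aux (GK k) _.
    exact: (integrable_fin_num mS (integrable_weak_integrand T0 mw0 w0m (Q k) C1)).
  have [_ K0fin] := GE 0%N.
  have -> : (\int[leb2]_(z in strip T) (weak_integrand w0 u p q phi z)%:E = - K0)%E.
    move/cvg_lim : dc => <- //.
    rewrite (_ : (fun n => _) = fun=> - K0)%E; first exact: lim_cst.
    by apply/funext => k; have [] := GE k.
  by rewrite addeC subee.
- pose g (f : R * R -> R) (w : R * R -> R) z := Num.max (`|f z - w z| - a) 0.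
  have mg' := measurable_gap a mw0 mu' mp mq.
  have IG : (\int[leb2]_(z in strip T) (Num.max (`|u z - out p q z| - a) 0)%:E = 0)%E.
    (* Fatou is applied to the tail from index [n], along which the gap is at most [n.+1%:R^-1]. *)
    have n0 n : (\int[leb2]_(z in strip T) (Num.max (`|u z - out p q z| - a) 0)%:E <= (n.+1%:R^-1)%:E)%E.
      apply: (@fatou_ae _ _ _ leb2 (strip T) (fun k z =>
        Num.max (`|u_ (k + n)%N z - out (p_ (k + n)%N) (q_ (k + n)%N) z| - a) 0)) => //.
      + by move=> k; exact: measurable_funTS (measurable_gap a mw0 (mu_ _) (mp_ _) (mq_ _)).
      + exact: measurable_funTS mg'.
      + by move=> k z; rewrite le_max lexx orbT.
      + by move=> z; rewrite le_max lexx orbT.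
      + apply: ae_imply cv => z h Sz; have [hu hp hq] := h Sz; have ho := cvo _ (h Sz).
        have hg : (fun k => Num.max (`|u_ k z - out (p_ k) (q_ k) z| - a) 0) @ \oo -->
            Num.max (`|u z - out p q z| - a) 0.
          by apply: cvg_pos; apply: cvgB; [apply: cvg_norm; exact: cvgB|exact: cvg_cst].
        by rewrite (cvg_shiftn n (fun k => Num.max (`|u_ k z - out (p_ k) (q_ k) z| - a) 0)).
      + move=> k; apply: le_trans (quasi_gap (Q (k + n)%N)) _.
        by rewrite lee_fin lef_pV2 ?posrE// ler_nat ltnS leq_addl.
    apply/eqP; rewrite eq_le integral_ge0 ?andbT; last first.
      by move=> z _; rewrite lee_fin le_max lexx orbT.
    apply/lee_addgt0Pr => e e0; rewrite add0e; apply: le_trans (n0 (Num.truncn e^-1)) _.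
    by rewrite lee_fin invf_ple ?posrE// ltW// truncnS_gt.
  have mEg : measurable_fun (strip T) (fun z => (Num.max (`|u z - out p q z| - a) 0)%:E).
    by apply/measurable_EFinP; exact: measurable_funTS.
  have := (ae_eq_integral_abs leb2 mS mEg).1.
  have -> : (\int[leb2]_(z in strip T) `|(Num.max (`|u z - out p q z| - a) 0)%:E| = 0)%E.
    rewrite -[RHS]IG; apply: eq_integral => z _.
    by rewrite gee0_abs// lee_fin le_max lexx orbT.
  move=> /(_ erefl); apply: ae_imply => z h /h [] /= hz.
  by rewrite -subr_le0 -hz le_max lexx.
Qed.

End Limit.

(** * The distributional derivative of a monotone output *)

Section Restriction.
Context d (X : measurableType d) (R : realType).
Variables (nu : {measure set X -> \bar R}) (D : set X) (mD : measurable D).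

Lemma ge0_integral_mrestr (f : X -> \bar R) : measurable_fun setT f ->
  (forall x, 0 <= f x)%E ->
  (\int[mrestr nu mD]_x f x = \int[nu]_(x in D) f x)%E.
Proof.
move=> mf f0.
have mDC : measurable (~` D) by exact: measurableC.
have nuD0 : mrestr nu mD (~` D) = 0%E by rewrite /mrestr setICl measure0.
rewrite (ge0_negligible_integral mDC measurableT mf (fun x _ => f0 x) nuD0).
rewrite setTD setCK; apply: eq_measure_integral => S mS SD.
by rewrite /= /mrestr setIidl.
Qed.

Lemma integral_mrestr (f : X -> \bar R) : measurable_fun setT f ->
  (\int[mrestr nu mD]_x f x = \int[nu]_(x in D) f x)%E.
Proof.
move=> mf; rewrite [LHS]integralE [RHS]integralE.
by rewrite !ge0_integral_mrestr//; [exact: measurable_funeneg|exact: measurable_funepos].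
Qed.

Lemma integrable_mrestr (f : X -> \bar R) : measurable_fun setT f ->
  nu.-integrable D f -> (mrestr nu mD).-integrable setT f.
Proof.
move=> mf /integrableP[_ h]; apply/integrableP; split => //.
by rewrite ge0_integral_mrestr//; exact: measurableT_comp.
Qed.

End Restriction.

Section Layer.
Context {R : realType}.
Local Notation mu := (@lebesgue_measure R).
Variables (T M K : R) (p : R * R -> R).
Hypotheses (T0 : 0 < T) (mp : measurable_fun setT p).
Hypothesis pM : forall z, 0 <= p z <= M.
Hypothesis p_homo : forall x s t, s <= t -> p (x, s) <= p (x, t).
Hypothesis pK : forall t : R, 0 <= t < T -> (\int[mu]_x (p (x, t))%:E <= K%:E)%E.

(** By monotonicity the section of [A] at a point [(x, y)] is an initial piece of [[0, T[]. Taking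
    its length for the passage time, rather than an infimum over times, gives measurability at
    once. *)
Let A : set ((R * R) * R) := [set w | 0 <= w.2 < T /\ p (w.1.1, w.2) <= w.1.2].

Let mA : measurable A.
Proof.
have mf : measurable_fun setT (fun w : (R * R) * R => p (w.1.1, w.2)).
  apply: (measurableT_comp mp); apply: measurable_fun_pair => //.
  exact: measurableT_comp.
have mg : measurable_fun setT (fun w : (R * R) * R => w.1.2) by exact: measurableT_comp.
have -> : A = (setT `*` `[0, T[) `&` [set w | p (w.1.1, w.2) <= w.1.2].
  by apply/seteqP; split=> [[z t] [h1 h2]|[z t] [[_ h1] h2]]; split => //=; move: h1; rewrite /= in_itv.
apply: measurableI; last exact: measurable_le_set.
by apply: measurableX.
Qed.

(* The first time at which [p (x, .)] exceeds the level [y], or [T]. *)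
Definition passage (z : R * R) : R := fine (mu (xsection A z)).

Let sectionE z : xsection A z = [set t : R | 0 <= t < T /\ p (z.1, t) <= z.2].
Proof. by apply/seteqP; split => t; rewrite /xsection/= ?inE. Qed.

Let section_T z : (mu (xsection A z) <= T%:E)%E.
Proof.
have -> : (T%:E = mu `[0%R, T[)%E.
  by rewrite lebesgue_measure_itv/= lte_fin T0 sube0.
apply: le_measure; rewrite ?inE//; first exact: measurable_xsection.
by rewrite sectionE => t [h _]; rewrite /= in_itv.
Qed.

Let sectionK z : (passage z)%:E = mu (xsection A z).
Proof.
rewrite /passage fineK// ge0_fin_numE//.
by apply: le_lt_trans (section_T z) _; rewrite ltry.
Qed.

Lemma passage_itv z : 0 <= passage z <= T.
Proof. by rewrite -!lee_fin sectionK section_T andbT. Qed.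

Lemma passage_ge x y t : 0 <= t < T -> p (x, t) <= y -> t <= passage (x, y).
Proof.
move=> /andP[t0 tT] pt; rewrite -lee_fin sectionK.
have -> : (t%:E = mu `[0%R, t])%E.
  rewrite lebesgue_measure_itv/= lte_fin; case: ifPn => [_|]; first by rewrite sube0.
  by rewrite -leNgt => t0'; congr EFin; lra.
apply: le_measure; rewrite ?inE//; first exact: measurable_xsection.
rewrite sectionE => s /=; rewrite in_itv/= => /andP[s0 st]; split.
  by rewrite s0 (le_lt_trans st).
exact: le_trans (p_homo _ st) pt.
Qed.

Lemma passage_le x y t : 0 <= t -> y < p (x, t) -> passage (x, y) <= t.
Proof.
move=> t0 pt; rewrite -lee_fin sectionK.
have -> : (t%:E = mu `[0%R, t])%E.
  rewrite lebesgue_measure_itv/= lte_fin; case: ifPn => [_|]; first by rewrite sube0.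
  by rewrite -leNgt => t0'; congr EFin; lra.
apply: le_measure; rewrite ?inE//; first exact: measurable_xsection.
rewrite sectionE => s /= -[/andP[s0 _] ps]; rewrite in_itv/= s0/= leNgt.
apply/negP => ts; move: pt; rewrite ltNge => /negP; apply.
exact: le_trans (p_homo _ (ltW ts)) ps.
Qed.

Lemma measurable_passage : measurable_fun setT passage.
Proof.
apply: measurableT_comp => //.
exact: (measurable_fun_xsection lebesgue_measure mA).
Qed.

Let Theta (z : R * R) : R * R := (z.1, passage z).

Let mTheta : measurable_fun setT (Theta : plane R -> plane R).
Proof.
by apply: measurable_fun_pair => //; exact: measurable_passage.
Qed.

(** Levels not passed before [T], among them all those above [M], form a set of infinite measure.
    They would be sent to time [T], where test functions vanish, so they can be discarded. *)
Let D : set (R * R) := [set z | 0 < z.2 /\ passage z < T].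

Let under_graph t : leb2 [set z : R * R | 0 < z.2 < p (z.1, t)] = (\int[mu]_x (p (x, t))%:E)%E.
Proof.
apply: eq_integral => x _.
transitivity (mu `]0%R, p (x, t)[).
  congr (mu _).
  by apply/seteqP; split => y; rewrite /xsection/= ?inE ?in_itv.
rewrite lebesgue_measure_itv/= lte_fin; case: ifPn => [_|]; first by rewrite sube0.
by rewrite -leNgt => p0; congr EFin; apply/eqP; rewrite eq_le p0 andbT; have /andP[] := pM (x, t).
Qed.

Let measurable_early t : measurable [set z : R * R | 0 < z.2 /\ passage z < t].
Proof.
have -> : [set z : R * R | 0 < z.2 /\ passage z < t] =
    [set z : R * R | 0 < z.2] `&` [set z | passage z < t] by [].
apply: measurableI; apply: measurable_lt_set => //.
exact: measurable_passage.
Qed.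

(** A level passed before [t] lies below [p (x, t)], and the area under the graph of [p] at time [t]
    is its integral. *)
Lemma early_passage_le t : 0 <= t < T ->
  (leb2 [set z : R * R | (0 < z.2)%R /\ (passage z < t)%R] <= \int[mu]_x (p (x, t))%:E)%E.
Proof.
move=> /andP[t0 tT]; rewrite -under_graph; apply: le_measure; rewrite ?inE.
- exact: measurable_early.
- have -> : [set z : R * R | 0 < z.2 < p (z.1, t)] =
      [set z : R * R | 0 < z.2] `&` [set z : R * R | z.2 < p (z.1, t)].
    by apply/seteqP; split => z /= => [/andP[]|[-> ->]].
  apply: measurableI; apply: measurable_lt_set => //.
  apply: (measurableT_comp mp); apply: measurable_fun_pair => //.
- move=> [x y]/= [y0 h]; rewrite y0/= ltNge; apply/negP => py.
  by have := @passage_ge x y t; rewrite t0 tT => /(_ isT py); rewrite leNgt h.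
Qed.

Let mD : measurable D. Proof. exact: measurable_early. Qed.

Let D_fin : (leb2 D <= K%:E)%E.
Proof.
(* The bound [K] is available only before [T], so [D] is exhausted by the levels passed before times
   increasing to [T]. *)
pose s (n : nat) := T * (1 - n.+1%:R^-1).
have sT n : 0 <= s n < T.
  have h1 : 0 < n.+1%:R^-1 :> R by rewrite invr_gt0.
  have h2 : n.+1%:R^-1 <= 1 :> R by rewrite invf_le1// ler1n.
  by rewrite mulr_ge0 ?subr_ge0 ?(ltW T0)//= -[ltRHS]mulr1 ltr_pM2l//; lra.
pose F n := [set z : R * R | 0 < z.2 /\ passage z < s n].
have DF : D = \bigcup_n F n.
  apply/seteqP; split => [z [z0 zT]|z [n _] [z0 zs]]; last first.
    by split => //; apply: lt_trans zs _; have /andP[] := sT n.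
  have h : 0 < 1 - passage z / T by rewrite subr_gt0 ltr_pdivrMr// mul1r.
  have [n hn] := ltr_add_invr h.
  exists n => //; split => //; rewrite /s.
  by rewrite mulrC -ltr_pdivrMr// ltrBrDr addrC -ltrBrDr -[ltLHS]add0r.
have ndF : nondecreasing_seq F.
  move=> i j ij; apply/subsetPset => z [z0 zs]; split => //.
  apply: lt_le_trans zs _; rewrite /s ler_pM2l// lerB// lef_pV2 ?posrE//.
  by rewrite ler_nat.
have := @nondecreasing_cvg_mu _ _ _ leb2 F (fun n => measurable_early (s n)).
rewrite -DF => /(_ mD ndF) cv; rewrite -(cvg_lim _ cv)//.
apply: lime_le; first exact: cvgP cv.
by apply: nearW => n; apply: le_trans (early_passage_le (sT n)) _; exact: pK.
Qed.

Section TestFunction.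
Variables (X B : R) (phi : R * R -> R).
Hypothesis phi_box : box_supported T X B phi.
Hypothesis phiT : forall x, phi (x, T) = 0.

Let C1 : Ck 1 phi. Proof. by case: phi_box. Qed.
Let mphi : measurable_fun setT phi.
Proof. by apply: continuous_measurable_plane; case: C1. Qed.
Let mdt : measurable_fun setT (dt phi).
Proof. by apply: continuous_measurable_plane; case: C1. Qed.

(** The times at which [p (x, .)] exceeds [y] fill the interval from the passage time to [T], up to
    the passage time itself: [p] has no prescribed one-sided continuity, but a single point is
    negligible. *)
Lemma layer_column x y : 0 < y ->
  (\int[mu]_(t in `[0%R, T[) (\1_[set t : R | y < p (x, t)] t * dt phi (x, t))%:E
   = - (phi (x, passage (x, y)))%:E)%E.
Proof.
move=> y0; have /andP[th0 thT] := passage_itv (x, y); set th := passage (x, y) in th0 thT *.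
have mpx : measurable_fun setT (fun t : R => p (x, t)).
  exact: (measurableT_comp mp (pair1_measurable x)).
have mdx : measurable_fun setT (fun t : R => dt phi (x, t)).
  exact: (measurableT_comp mdt (pair1_measurable x)).
transitivity (\int[mu]_(t in `[0%R, T[) (\1_(`[th, T[%classic) t * dt phi (x, t))%:E)%E.
  apply: ae_eq_integral => //.
  - apply/measurable_EFinP; apply: measurable_funM; last exact: measurable_funTS.
    by apply: measurable_indic; apply: measurable_lt_set.
  - apply/measurable_EFinP; apply: measurable_funM; last exact: measurable_funTS.
    exact: measurable_indic.
  exists [set th]; split => //; first exact: lebesgue_measure_set1.
  move=> t /=; apply: contra_notP => tth.
  rewrite in_itv/= => /andP[t0 tT]; congr (_ * _)%:E; rewrite !indicE; congr (_ _)%:R.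
  apply/idP/idP; rewrite !inE/= in_itv/= => h.
    by rewrite tT passage_le.
  have {}h : th < t by case/andP: h => h _; rewrite lt_neqAle h andbT; apply/eqP => e; exact: tth.
  rewrite ltNge; apply/negP => py.
  by have := @passage_ge x y t; rewrite t0 tT => /(_ isT py); rewrite leNgt h.
transitivity (\int[mu]_(t in `[th, T[) (dt phi (x, t))%:E)%E.
  rewrite integral_mkcond [RHS]integral_mkcond; apply: eq_integral => t _.
  rewrite !patchE !mem_setE indicE mem_setE !in_itv/=.
  case: ifPn => [/andP[t0 tT]|nt]; first by case: ifPn; rewrite ?mul1r ?mul0r.
  by case: ifPn => // /andP[h1 h2]; move: nt; rewrite h2 (le_trans th0 h1).
move: thT; rewrite le_eqVlt => /predU1P[thT|thT].
  by rewrite -thT set_itvco0 ?integral_set0// thT phiT oppe0.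
have := @FTC_characteristic R phi 0 x th T C1 thT.
rewrite !mul0r !addr0 phiT sub0r EFinN => <-.
by apply: eq_integral => t _; rewrite !mul0r !addr0.
Qed.

Let phi_bounded : exists c, 0 <= c /\ forall z, `|phi (Theta z)| <= c.
Proof.
have [c [c0 hc]] : exists B, 0 <= B /\ forall x t, `|x| <= X -> 0 <= t <= T -> `|phi (x, t)| <= B.
  by apply: compact_box_bounded; case: C1.
exists c; split => // z; have [xX|Xx] := leP `|z.1| X.
  by apply: hc => //; exact: passage_itv.
by case: phi_box => _ _ -> //; [rewrite normr0|exact: passage_itv].
Qed.

Lemma layer_integrable : leb2.-integrable D (EFin \o (phi \o Theta)).
Proof.
have [c [c0 hc]] := phi_bounded.
apply: measurable_bounded_integrable => //.
- by apply: le_lt_trans D_fin _; rewrite ltry.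
- by apply: measurable_funTS; exact: (measurableT_comp mphi mTheta).
- exists c; split; first by rewrite num_real.
  move=> c' cc' [x y] _ /=; apply: le_trans (ltW cc').
  exact: hc.
Qed.

(** Writing [p] as the integral over levels [y] of the indicator of [y < p], Fubini reduces the
    identity to [layer_column]. Levels below [p (x, 0)] have passage time 0, so the initial value is
    charged to the bottom edge. *)
Lemma layer_identity :
  (\int[leb2]_(z in strip T) (p z * dt phi z)%:E = - \int[leb2]_(z in D) (phi (Theta z))%:E)%E.
Proof.
have [_ B0 phiX dphiX dphiB] := phi_box.
have mpdt : measurable_fun setT (fun z => p z * dt phi z) by exact: measurable_funM.
have M0 : 0 <= M by have /andP[h1 h2] := pM 0; exact: le_trans h2.
have ipdt : leb2.-integrable (strip T) (fun z => (p z * dt phi z)%:E).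
  apply: (integrable_mul_dt (C := M) T0 phi_box mp) => z.
  by have /andP[p0 pM'] := pM z; rewrite ger0_norm.
rewrite fubini_rect12//; last exact/measurable_EFinP.
pose F (z : R * R) : \bar R := (phi (Theta z))%:E.
have mF : measurable_fun setT F by apply/measurable_EFinP; exact: (measurableT_comp mphi mTheta).
pose I : set R := `]0, M]%classic.
have mI : measurable I by exact: measurable_itv.
have fI : (mu I < +oo)%E.
  by rewrite lebesgue_measure_itv/= lte_fin; case: ifPn => // _; rewrite -EFinB ltry.
have F0 z : ~ D z -> 0 < z.2 -> F z = 0%E.
  move=> nD z0; rewrite /F; congr EFin; rewrite -(phiT z.1); congr (phi (_, _)).
  have /andP[_ h] := passage_itv z; apply/eqP; rewrite eq_le h/= leNgt; apply/negP => h'.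
  exact: nD.
have FM z : M < z.2 -> F z = 0%E.
  case: z => x y/= My; apply: F0 => /=; last exact: le_lt_trans My.
  rewrite /D/= => -[_]; rewrite ltNge => /negP; apply.
  rewrite leNgt; apply/negP => h.
  have /andP[th0 _] := passage_itv (x, y).
  (* Halfway between a passage time smaller than [T] and [T], the level [y > M] is still not
     exceeded, so the passage time would be at least [t]. *)
  pose t := (passage (x, y) + T) / 2.
  have tT : 0 <= t < T by rewrite /t; lra.
  have py : p (x, t) <= y by have /andP[_ h1] := pM (x, t); exact: le_trans h1 (ltW My).
  by have := passage_ge tT py; rewrite /t; lra.
have -> : (\int[leb2]_(z in D) F z = \int[leb2]_(z in [set: R] `*` I) F z)%E.
  rewrite integral_mkcond [RHS]integral_mkcond; apply: eq_integral => z _.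
  rewrite !patchE; case: ifPn => zD; case: ifPn => zI //.
  - move: zD zI; rewrite inE notin_setE => -[z0 _] nI; apply: FM.
    by rewrite ltNge; apply/negP => h; apply: nI; split => //=; rewrite /I/= in_itv/= z0.
  - move: zD zI; rewrite inE notin_setE => nD -[_]; rewrite /I/= in_itv/= => /andP[z0 _].
    by rewrite F0.
have iF : leb2.-integrable ([set: R] `*` I) F.
  have [c [c0 hc]] := phi_bounded.
  apply: (@bounded_support_integrable R I _ X c) => //.
  - exact: (measurableT_comp mphi mTheta).
  - by move=> x t _ /= Xx; rewrite phiX//; exact: passage_itv.
rewrite fubini_rect12// -integralN; last first.
  have h := integrable_rect12 mI mF iF.
  exact: (integrable_add_def measurableT h).
apply: eq_integral => x _.
(* With [x] fixed, the level takes the place of the space variable, so the Fubini lemmas for the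
   strip apply to pairs [(y, t)]. *)
pose g (z : R * R) := \1_[set z : R * R | 0 < z.1 < p (x, z.2)] z * dt phi (x, z.2).
have mpx : measurable_fun setT (fun t : R => p (x, t)).
  exact: (measurableT_comp mp (pair1_measurable x)).
have mdx : measurable_fun setT (fun t : R => dt phi (x, t)).
  exact: (measurableT_comp mdt (pair1_measurable x)).
have mS : measurable [set z : R * R | 0 < z.1 < p (x, z.2)].
  have -> : [set z : R * R | 0 < z.1 < p (x, z.2)] =
      [set z : R * R | 0 < z.1] `&` [set z : R * R | z.1 < p (x, z.2)].
    by apply/seteqP; split => z /= => [/andP[]|[-> ->]].
  apply: measurableI; apply: measurable_lt_set => //.
  exact: (measurableT_comp mpx measurable_snd).
have mg : measurable_fun setT g.
  apply: measurable_funM; first exact: measurable_indic.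
  exact: (measurableT_comp mdx measurable_snd).
have mEg : measurable_fun setT (EFin \o g) by exact/measurable_EFinP.
have ig : leb2.-integrable (strip T) (EFin \o g).
  apply: (@bounded_support_integrable R _ g M B) => //.
  - by rewrite lebesgue_measure_itv/= lte_fin T0 -EFinB ltry.
  - move=> y t; rewrite /= in_itv/= => tT; have [h _] := dphiB x t tT.
    by rewrite /g/= indicE normrM; case: (_ \in _); rewrite /= ?normr1 ?normr0 ?mul1r ?mul0r.
  - move=> y t _ My; rewrite /g indicE memNset ?mul0r//= => /andP[y0 yp].
    have /andP[_ h] := pM (x, t).
    by move: My; rewrite gtr0_norm// ltNge (ltW (lt_le_trans yp h)).
transitivity (\int[mu]_(t in `[0%R, T[) \int[mu]_y (g (y, t))%:E)%E.
  apply: eq_integral => t _.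
  transitivity (\int[mu]_y ((dt phi (x, t))%:E * (\1_(`]0%R, (p (x, t))[%classic) y)%:E))%E.
    rewrite integralZl//; last exact: (integrable_indic_itv 0 (p (x, t)) false true).
    have -> : (\int[mu]_y (\1_(`]0%R, (p (x, t))[%classic) y)%:E = (p (x, t))%:E)%E.
      rewrite (@integral_indic _ _ _ mu _ measurableT _ (measurable_itv _)) setIT/= lebesgue_measure_itv/= lte_fin.
      case: ifPn => [_|]; first by rewrite sube0.
      rewrite -leNgt => p0; congr EFin; apply/eqP; rewrite eq_le p0 andbT.
      by have /andP[] := pM (x, t).
    by rewrite -EFinM mulrC.
  apply: eq_integral => y _; rewrite /g -EFinM mulrC; congr (_ * _)%:E.
rewrite -(fubini_rect21 _ mEg ig)// fubini_rect12//.
have mFx : measurable_fun setT (fun y => phi (Theta (x, y))).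
  exact: (measurableT_comp (measurableT_comp mphi mTheta) (pair1_measurable x)).
have iFx : mu.-integrable I (EFin \o (fun y => phi (Theta (x, y)))).
  apply: measurable_bounded_integrable => //; first exact: measurable_funTS.
  have [c [c0 hc]] := phi_bounded; exists c; split; first by rewrite num_real.
  by move=> c' cc' y _ /=; apply: le_trans (ltW cc'); exact: hc.
have aFx := integrable_add_def (mI : measurable (I : set (measurableTypeR R))) iFx.
rewrite -[in RHS](integralN aFx).
rewrite [RHS]integral_mkcond; apply: eq_integral => y _.
rewrite patchE; case: ifPn => yI.
  move: yI; rewrite inE /I/= in_itv/= => /andP[y0 _].
  transitivity (- (phi (x, passage (x, y)))%:E)%E => //.
  rewrite -layer_column//; apply: eq_integral => t _.
  rewrite /g; congr (_ * _)%:E; rewrite !indicE; congr (_ _)%:R.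
  by apply/idP/idP; rewrite !inE/= y0.
have [y0|y0] := leP y 0.
  apply: integral0_eq => t _; rewrite /= /g indicE memNset ?mul0r//=.
  by rewrite ltNge y0.
have My : M < y.
  by rewrite ltNge; apply/negP => h; move: yI; rewrite notin_setE; apply; rewrite /I/= in_itv/= y0.
apply: integral0_eq => t _; rewrite /= /g indicE memNset ?mul0r//= => /andP[_].
have /andP[_ h] := pM (x, t).
by rewrite ltNge (le_trans h (ltW My)).
Qed.

End TestFunction.

(* [mrestr leb2 D] pushed forward by [Theta] charges each point of the graph of
   [p (x, .)] by the increment of [p (x, .)] there. *)
Lemma layer_measure : exists nu : {finite_measure set (plane R) -> \bar R},
  (forall phi, C1_compact_support_in_strip T phi ->
    (\int[leb2]_(z in strip T) (p z * dt phi z)%:E = - \int[nu]_z (phi z)%:E)%E) /\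
  (forall t : R, 0 < t < T -> (nu (open_strip t) <= \int[mu]_x (p (x, t))%:E)%E).
Proof.
pose nu0 : {measure set (plane R) -> \bar R} :=
  measure_function_pushforward__canonical__measure_function_Measure
    (mrestr leb2 mD) mTheta.
have nu0E (S : set (plane R)) : nu0 S = leb2 (Theta @^-1` S `&` D) by [].
have nu0fin : fin_num_fun nu0.
  move=> S mS; rewrite ge0_fin_numE// nu0E.
  apply: le_lt_trans (ltry K); apply: le_trans D_fin; apply: le_measure; rewrite ?inE//.
  by apply: measurableI => //; rewrite -[X in measurable X]setTI; exact: mTheta.
pose nu := HB.pack_for (FiniteMeasure.type (plane R) R) (Measure.sort nu0)
  (Measure_isFinite.Build _ _ _ (Measure.sort nu0) nu0fin).
have nuE (S : set (plane R)) : nu S = leb2 (Theta @^-1` S `&` D) by [].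
exists nu; split => [phi C1|t /andP[t0 tT]]; last first.
  have tT' : 0 <= t < T by rewrite (ltW t0).
  rewrite nuE; apply: le_trans (early_passage_le tT'); apply: le_measure; rewrite ?inE.
  - apply: measurableI => //; rewrite -[X in measurable X]setTI; apply: mTheta => //.
    by apply: measurable_rect.
  - exact: measurable_early.
  - by move=> z [[_ /=]]; rewrite in_itv/= => /andP[_ ?] [].
have [X [B [X0 box phiT]]] := C1_box_supported T0 C1.
have mphi : measurable_fun setT phi by apply: continuous_measurable_plane; case: C1 => -[].
have mE : measurable_fun setT (EFin \o phi) by exact/measurable_EFinP.
refine (eq_trans (layer_identity box phiT) (f_equal oppe _)).
have mET : measurable_fun setT ((EFin \o phi) \o Theta) by exact: (measurableT_comp mE mTheta).
rewrite -(integral_mrestr leb2 mD mET); symmetry.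
apply: (integral_pushforward mTheta mE _ measurableT).
exact: (@integrable_mrestr _ _ _ leb2 D mD _ mET (layer_integrable box)).
Qed.

End Layer.

(** * The signed measure and its Jordan decomposition *)

Section Charge.
Context {R : realType}.
Local Notation mu := (@lebesgue_measure R).

Lemma test_function_C1 (T : R) phi : test_function T phi -> C1_compact_support_in_strip T phi.
Proof.
move=> [Cphi [K [cK KT phiK]]]; split; first exact: (Cphi 1%N).
exists K; split => // [z Kz|z _ nK]; last exact: phiK.
have [_ /=] := KT z Kz; rewrite in_itv/= => /andP[/ltW t0 tT].
by split => //=; rewrite in_itv/= t0.
Qed.

Lemma test_function_bottom (T : R) phi x : test_function T phi -> phi (x, 0) = 0.
Proof.
move=> [_ [K [_ KT phiK]]]; apply: phiK => /KT[_ /=].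
by rewrite in_itv/= ltxx.
Qed.

Lemma test_function_integrable (T : R) phi (nu : {finite_measure set (plane R) -> \bar R}) :
  test_function T phi -> nu.-integrable setT (EFin \o phi).
Proof.
move=> [Cphi [K [cK KT phiK]]].
have cphi : continuous phi := Cphi 0%N.
have /compact_bounded [M [_ hM]] : compact (phi @` K).
  by apply: continuous_compact => //; exact: continuous_subspaceT.
apply: measurable_bounded_integrable => //.
- by rewrite -ge0_fin_numE// fin_num_measure.
- exact: continuous_measurable_plane.
- exists (Num.max M 0); split; first by rewrite num_real.
  move=> c; rewrite gt_max => /andP[Mc c0] z _ /=.
  have [Kz|nK] := pselect (K z); first by apply: (hM c Mc); exists z.
  by rewrite phiK// normr0 ltW.
Qed.

Variables (nup nuq : {finite_measure set (plane R) -> \bar R}).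

Let nu : {charge set (plane R) -> \bar R} :=
  cadd (charge_of_finite_measure nup) (copp (charge_of_finite_measure nuq)).
Variables (P N : set (plane R)) (nuPN : hahn_decomposition nu P N).

(** The two decompositions of the charge are compared as an equality between sums of positive
    measures, which can be integrated directly. *)
Lemma jordan_balance A : measurable A ->
  (jordan_pos nuPN A + nuq A = jordan_neg nuPN A + nup A)%E.
Proof.
move=> mA.
have : (nup A - nuq A = jordan_pos nuPN A - jordan_neg nuPN A)%E.
  by have := jordan_decomp nuPN mA; rewrite /cadd/= cscaleN1.
have f1 : nup A \is a fin_num by exact: fin_num_measure.
have f2 : nuq A \is a fin_num by exact: fin_num_measure.
have f3 : jordan_pos nuPN A \is a fin_num by exact: fin_num_measure.
have f4 : jordan_neg nuPN A \is a fin_num by exact: fin_num_measure.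
rewrite -(fineK f1) -(fineK f2) -(fineK f3) -(fineK f4) -!EFinN -!EFinD => -[h].
by congr EFin; lra.
Qed.

Lemma jordan_integral_difference phi T : test_function T phi ->
  ((jordan_integral nuPN phi)%:E = \int[nup]_z (phi z)%:E - \int[nuq]_z (phi z)%:E)%E.
Proof.
move=> tphi.
have i1 := test_function_integrable nup tphi.
have i2 := test_function_integrable nuq tphi.
have i3 := test_function_integrable (jordan_pos nuPN) tphi.
have i4 := test_function_integrable (jordan_neg nuPN) tphi.
have h1 := integral_measure_add measurableT i3 i2.
have h2 := integral_measure_add measurableT i4 i1.
have h : (\int[measure_add (jordan_pos nuPN) nuq]_z (EFin \o phi) z =
    \int[measure_add (jordan_neg nuPN) nup]_z (EFin \o phi) z)%E.
  apply: eq_measure_integral => A mA _.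
  have := jordan_balance mA; rewrite -(measure_addE (jordan_pos nuPN)) -(measure_addE (jordan_neg nuPN)); exact.
rewrite {}h2 {}h1 in h; move: h.
have f1 := integrable_fin_num measurableT i1.
have f2 := integrable_fin_num measurableT i2.
have f3 := integrable_fin_num measurableT i3.
have f4 := integrable_fin_num measurableT i4.
rewrite /jordan_integral /Rintegral.
rewrite -(fineK f1) -(fineK f2) -(fineK f3) -(fineK f4) -!EFinD => -[h].
by congr EFin; move: h => /=; lra.
Qed.

(** On [P] the charge is at most [nup] and on [N] its opposite is at most [nuq]. Only an inequality
    is available, as [nup] and [nuq] may share mass. *)
Lemma charge_variation_difference A : measurable A ->
  (charge_variation nuPN A <= nup A + nuq A)%E.
Proof.
move=> mA; have [[mP _] [mN _] PN PN0] := nuPN.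
rewrite /charge_variation/=.
have f B : measurable B -> nu B = (nup B - nuq B)%E by [].
apply: leeD.
- rewrite jordan_posE cjordan_posE /crestr0 mem_set// /crestr.
  rewrite f; last exact: measurableI.
  apply: (@le_trans _ _ (nup (A `&` P))); first by rewrite leeBlDr ?leeDl// fin_num_measure//; exact: measurableI.
  by apply: le_measure; rewrite ?inE//; exact: measurableI.
- rewrite jordan_negE cjordan_negE /crestr0 mem_set// /crestr.
  have mAN : measurable (A `&` N) by exact: measurableI.
  rewrite f// fin_num_oppeB ?fin_num_measure//.
  apply: (@le_trans _ _ (nuq (A `&` N))).
    by rewrite addeC leeBlDr ?leeDl// fin_num_measure.
  by apply: le_measure; rewrite ?inE.
Qed.

End Charge.

Section Output.
Context {R : realType}.
Local Notation mu := (@lebesgue_measure R).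
Variables (T m M : R) (w0 : R -> R) (p q : R * R -> R).
Hypotheses (T0 : 0 < T) (mw0 : measurable_fun setT w0) (w0m : forall x, `|w0 x| <= m).
Hypotheses (mp : measurable_fun setT p) (mq : measurable_fun setT q).
Hypotheses (pM : forall z, 0 <= p z <= M) (qM : forall z, 0 <= q z <= M).
Variables (nup nuq : {finite_measure set (plane R) -> \bar R}).
Hypothesis nup_dt : forall phi, C1_compact_support_in_strip T phi ->
  (\int[leb2]_(z in strip T) (p z * dt phi z)%:E = - \int[nup]_z (phi z)%:E)%E.
Hypothesis nuq_dt : forall phi, C1_compact_support_in_strip T phi ->
  (\int[leb2]_(z in strip T) (q z * dt phi z)%:E = - \int[nuq]_z (phi z)%:E)%E.

(** Transport at speed 0 over the whole strip; [phi] vanishes at both ends. *)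
Lemma initial_dt phi : test_function T phi ->
  (\int[leb2]_(z in strip T) (w0 z.1 * dt phi z)%:E = 0)%E.
Proof.
move=> tphi; have [X [B [X0 box phiT]]] := C1_box_supported T0 (test_function_C1 tphi).
have [_ _ _] := slab_transport (lexx 0) (lexx 0) T0 (lexx T) box mw0 w0m.
under eq_integral do rewrite !mul0r !subr0 addr0; move=> ->.
rewrite [X in (X - _)%E]integral0_eq; last first.
  by move=> x _; rewrite !mul0r addr0 phiT mulr0.
rewrite [X in (_ - X)%E]integral0_eq ?subee// => x _.
by rewrite !mul0r addr0 (test_function_bottom x tphi) mulr0.
Qed.

Variables (P N : set (plane R)).
Hypothesis nuPN : hahn_decomposition
  (cadd (charge_of_finite_measure nup) (copp (charge_of_finite_measure nuq))) P N.

Lemma output_distributional_dt : is_distributional_dt T (output w0 p q) nuPN.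
Proof.
move=> phi tphi; have C1 := test_function_C1 tphi.
have [X [B [X0 box _]]] := C1_box_supported T0 C1.
apply: EFin_inj; rewrite EFinN (jordan_integral_difference nuPN tphi).
have pn z : `|p z| <= M by have /andP[h1 h2] := pM z; rewrite ger0_norm.
have qn z : `|q z| <= M by have /andP[h1 h2] := qM z; rewrite ger0_norm.
have ip := integrable_mul_dt T0 box mp pn.
have iq := integrable_mul_dt T0 box mq qn.
have mw0' : measurable_fun setT (fun z : R * R => w0 z.1) by exact: (measurableT_comp mw0 measurable_fst).
have iw := integrable_mul_dt T0 box mw0' (fun z => w0m z.1).
have mS : measurable (strip T : set (plane R)) by apply: measurable_rect.
have fp := integrable_fin_num measurableT (test_function_integrable nup tphi).
have fq := integrable_fin_num measurableT (test_function_integrable nuq tphi).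
have E : (\int[leb2]_(z in strip T) (output w0 p q z * dt phi z)%:E =
    - (\int[nup]_z (phi z)%:E - \int[nuq]_z (phi z)%:E))%E.
  transitivity (\int[leb2]_(z in strip T) ((w0 z.1 * dt phi z)%:E +
      ((p z * dt phi z)%:E - (q z * dt phi z)%:E)))%E.
    by apply: eq_integral => z _; rewrite /output -EFinB -EFinD; congr EFin; ring.
  rewrite (integralD mS iw (integrableB mS ip iq)) initial_dt// add0e.
  by rewrite (integralB mS ip iq) nup_dt// nuq_dt// oppeK (fin_num_oppeB _ fq).
by rewrite /Rintegral E fineK// fin_numN fin_numB fp fq.
Qed.

End Output.

(** * The energy inequality *)

Section Energy.
Context {R : realType}.
Local Notation mu := (@lebesgue_measure R).

(** A bound known at almost every time extends to every time for a quantity nondecreasing in time,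
    by comparison with a later good time. *)
Lemma ae_later (T t : R) (A : R -> Prop) : {ae mu, forall s, 0 <= s < T -> A s} ->
  0 <= t < T -> exists2 s, t <= s < T & A s.
Proof.
move=> [N [mN N0 NA]] /andP[t0 tT]; apply: contrapT => h.
have tN : `[t, T[ `<=` N.
  move=> s /=; rewrite in_itv/= => /andP[ts sT]; apply: NA => /= sA; apply: h.
  by exists s; [rewrite ts|apply: sA; rewrite (le_trans t0 ts)].
have : (mu `[t, T[ <= mu N)%E.
  apply: le_measure; [rewrite inE; exact: measurable_itv|rewrite inE; exact: mN|exact: tN].
by rewrite [mu N]N0 lebesgue_measure_itv/= lte_fin tT -EFinB lee_fin leNgt subr_gt0 tT.
Qed.

(** All terms of the energy being nonnegative, the bound [E0] makes each integral finite. Only then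
    can the initial energy be subtracted inside the integrals. *)
Lemma energy_balance (a E0 : R) (f g P Q f0 g0 : R -> R) (V : \bar R) : 0 < a ->
  measurable_fun setT f -> measurable_fun setT g ->
  measurable_fun setT P -> measurable_fun setT Q ->
  (forall x, 0 <= P x) -> (forall x, 0 <= Q x) ->
  mu.-integrable setT (fun x => (f0 x ^+ 2)%:E) ->
  mu.-integrable setT (fun x => (g0 x ^+ 2)%:E) ->
  (\int[mu]_x (f0 x ^+ 2)%:E + \int[mu]_x (g0 x ^+ 2)%:E = (2 * E0)%:E)%E ->
  (\int[mu]_x (f x ^+ 2 / 2 + (g x ^+ 2 / 2 + a * (P x + Q x)))%:E <= E0%:E)%E ->
  (0 <= V)%E -> (V <= \int[mu]_x (P x)%:E + \int[mu]_x (Q x)%:E)%E ->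
  (2^-1%:E * (\int[mu]_x (f x ^+ 2 - f0 x ^+ 2)%:E)
    + 2^-1%:E * (\int[mu]_x (g x ^+ 2 - g0 x ^+ 2)%:E) <= - (a%:E * V))%E.
Proof.
move=> a0 mf mg mP mQ P0 Q0 if0 ig0 E0E.
have mf2 : measurable_fun setT (fun x => f x ^+ 2) by exact: measurable_funX.
have mg2 : measurable_fun setT (fun x => g x ^+ 2) by exact: measurable_funX.
have f20 x : 0 <= f x ^+ 2 by exact: sqr_ge0.
have g20 x : 0 <= g x ^+ 2 by exact: sqr_ge0.
have mPQ : measurable_fun setT (fun x => P x + Q x) by exact: measurable_funD.
have PQ0 x : 0 <= P x + Q x by exact: addr_ge0.
have -> : (\int[mu]_x (f x ^+ 2 / 2 + (g x ^+ 2 / 2 + a * (P x + Q x)))%:E =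
  (2^-1)%:E * \int[mu]_x (f x ^+ 2)%:E + ((2^-1)%:E * \int[mu]_x (g x ^+ 2)%:E +
   a%:E * (\int[mu]_x (P x)%:E + \int[mu]_x (Q x)%:E)))%E.
  have h0 : 0 <= 2^-1 :> R by rewrite invr_ge0.
  have mf' : measurable_fun setT (fun x => 2^-1 * f x ^+ 2) by exact: measurable_funM.
  have mg' : measurable_fun setT (fun x => 2^-1 * g x ^+ 2) by exact: measurable_funM.
  have mPQ' : measurable_fun setT (fun x => a * (P x + Q x)) by exact: measurable_funM.
  transitivity (\int[mu]_x (2^-1 * f x ^+ 2 + (2^-1 * g x ^+ 2 + a * (P x + Q x)))%:E)%E.
    by apply: eq_integral => x _; congr EFin; ring.
  rewrite ge0_integralD_real//; last 3 first.
  - exact (measurable_funD mg' mPQ').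
  - by move=> x _; rewrite mulr_ge0.
  - by move=> x _; rewrite addr_ge0// mulr_ge0// ltW.
  rewrite ge0_integralD_real//; last 2 first.
  - by move=> x _; rewrite mulr_ge0.
  - by move=> x _; rewrite mulr_ge0// ltW.
  by rewrite !ge0_integralZl_real ?(ltW a0)// ge0_integralD_real.
set IF := (\int[mu]_x (f x ^+ 2)%:E)%E; set IG := (\int[mu]_x (g x ^+ 2)%:E)%E.
set IP := (\int[mu]_x (P x)%:E)%E; set IQ := (\int[mu]_x (Q x)%:E)%E.
have F0 : (0 <= IF)%E by apply: integral_ge0 => x _; rewrite lee_fin.
have G0 : (0 <= IG)%E by apply: integral_ge0 => x _; rewrite lee_fin.
have IP0 : (0 <= IP)%E by apply: integral_ge0 => x _; rewrite lee_fin.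
have IQ0 : (0 <= IQ)%E by apply: integral_ge0 => x _; rewrite lee_fin.
move=> hE V0 VPQ.
have fin (x : \bar R) c : (0 <= x)%E -> 0 < c -> (c%:E * x <= E0%:E)%E -> x \is a fin_num.
  move=> x0 c0 h; rewrite ge0_fin_numE// ltNge leye_eq; apply/negP => /eqP xE.
  by move: h; rewrite xE gt0_muley ?lte_fin// leye_eq.
have S0 : (0 <= IP + IQ)%E by exact: adde_ge0.
have h2 : 0 < 2^-1 :> R by rewrite invr_gt0.
have mul0 (c : R) x : 0 < c -> (0 <= x)%E -> (0 <= c%:E * x)%E by move=> c0 x0; rewrite mule_ge0// lee_fin ltW.
have Ff : IF \is a fin_num.
  apply: (fin _ _ F0 h2); apply: (le_trans _ hE); rewrite leeDl// adde_ge0//; exact: mul0.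
have Gf : IG \is a fin_num.
  apply: (fin _ _ G0 h2); apply: (le_trans _ hE).
  apply: (@le_trans _ _ ((2^-1)%:E * IG + a%:E * (IP + IQ))%E); first by rewrite leeDl// mul0.
  by rewrite leeDr// mul0.
have Sf : (IP + IQ)%E \is a fin_num.
  apply: (fin _ _ S0 a0); apply: (le_trans _ hE).
  apply: (@le_trans _ _ ((2^-1)%:E * IG + a%:E * (IP + IQ))%E); first by rewrite leeDr// mul0.
  by rewrite leeDr// mul0.
have Vf : V \is a fin_num.
  by rewrite ge0_fin_numE//; apply: le_lt_trans VPQ _; rewrite -ge0_fin_numE.
have if2 : mu.-integrable setT (fun x => (f x ^+ 2)%:E).
  apply/integrableP; split; first exact/measurable_EFinP.
  under eq_integral do rewrite gee0_abs ?lee_fin//.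
  by rewrite -ge0_fin_numE.
have ig2 : mu.-integrable setT (fun x => (g x ^+ 2)%:E).
  apply/integrableP; split; first exact/measurable_EFinP.
  under eq_integral do rewrite gee0_abs ?lee_fin//.
  by rewrite -ge0_fin_numE.
under [X in (_ * X + _)%E]eq_integral do rewrite EFinB.
under [X in (_ + _ * X)%E]eq_integral do rewrite EFinB.
rewrite (integralB measurableT if2 if0) (integralB measurableT ig2 ig0).
rewrite -/IF -/IG.
have f0f := integrable_fin_num measurableT if0.
have g0f := integrable_fin_num measurableT ig0.
move: hE VPQ E0E V0.
rewrite -(fineK Ff) -(fineK Gf) -(fineK Sf) -(fineK Vf) -(fineK f0f) -(fineK g0f).
rewrite -!EFinN; do ! rewrite -?EFinM -?EFinD -?EFinN; rewrite !lee_fin => hE VPQ [E0E] V0.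
have := ler_wpM2l (ltW a0) VPQ; lra.
Qed.

End Energy.

(** * Representatives of the initial data *)

Section InitialData.
Context {R : realType}.
Local Notation mu := (@lebesgue_measure R).

(** The Jordan decomposition: both [V] and [V - f] are nondecreasing. *)
Lemma modulus_measurable (f V : R -> R) : {homo V : x y / x <= y} ->
  (forall x y, y <= x -> `|f x - f y| <= V x - V y) -> measurable_fun setT f.
Proof.
move=> hV fV; have -> : f = V \- (fun x => V x - f x).
  by apply/funext => x /=; rewrite opprB addrC subrK.
apply: measurable_funB; first exact: nondecreasing_measurable.
apply: nondecreasing_measurable => // x y xy.
by have := fV y x xy; rewrite ler_norml; lra.
Qed.

Definition clamp (lo hi x : R) : R := Num.max lo (Num.min hi x).

Lemma clamp_itv (lo hi x : R) : lo <= hi -> lo <= clamp lo hi x <= hi.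
Proof. by move=> lh; rewrite /clamp le_max lexx/= ge_max lh ge_min lexx. Qed.

Lemma clamp_id (lo hi x : R) : lo <= x <= hi -> clamp lo hi x = x.
Proof. by move=> /andP[h1 h2]; rewrite /clamp min_r// max_r. Qed.

Lemma dist_clamp (a f g f' g' e : R) : `|f - f'| <= e -> `|g - g'| <= e ->
  `|clamp (f - a) (f + a) g - clamp (f' - a) (f' + a) g'| <= e.
Proof.
rewrite /clamp !ler_norml !maxEle !minEle.
by do ! case: ifPn => //; rewrite ?ltNge; lra.
Qed.

Lemma integrable_ae_eq (f g : R -> R) : measurable_fun setT g ->
  {ae mu, forall x, f x = g x} -> mu.-integrable setT (EFin \o f) ->
  mu.-integrable setT (EFin \o g).
Proof.
move=> mg fg /integrableP[mf fi]; apply/integrableP; split; first exact/measurable_EFinP.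
rewrite (_ : (\int[mu]_x `|(EFin \o g) x| = \int[mu]_x `|(EFin \o f) x|)%E)//.
apply: ge0_ae_eq_integral => //.
- by apply: measurableT_comp => //; exact/measurable_EFinP.
- exact: measurableT_comp.
- by apply: ae_imply fg => x /= -> _.
Qed.

Lemma integrable_sqr (f : R -> R) (m : R) : measurable_fun setT f ->
  (forall x, `|f x| <= m) -> mu.-integrable setT (EFin \o f) ->
  mu.-integrable setT (fun x => (f x ^+ 2)%:E).
Proof.
move=> mf fm fi; apply: (@le_integrable _ _ _ mu setT measurableT _ (fun x => m%:E * (EFin \o f) x)%E).
- by apply/measurable_EFinP; exact: measurable_funX.
- move=> x _; rewrite /= !lee_fin normrX expr2 normrM ler_wpM2r//.
  exact: le_trans (fm x) (ler_norm m).
- exact: integrableZl.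
Qed.

Record initial_data (a m M C : R) (f g V : R -> R) : Prop := InitialData {
  initial_mf : measurable_fun setT f;
  initial_mg : measurable_fun setT g;
  initial_fm : forall x, `|f x| <= m;
  initial_gm : forall x, `|g x| <= m;
  initial_gap : forall x, `|f x - g x| <= a;
  initial_V : forall x, 0 <= V x <= M;
  initial_fV : forall x y, y <= x -> `|f x - f y| <= V x - V y;
  initial_f1 : mu.-integrable setT (EFin \o f);
  initial_g1 : mu.-integrable setT (EFin \o g);
  initial_translate : forall s : R, 0 <= s ->
    (\int[mu]_x (`|f (x - s) - f x| + `|g (x - s) - g x|)%:E <= (s * C)%:E)%E }.

Lemma initial_data_representatives (a : R) (u0 w0 : R -> R) : 0 < a ->
  BV_line u0 -> BV_line w0 ->
  mu.-integrable setT (EFin \o u0) -> mu.-integrable setT (EFin \o w0) ->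
  {ae mu, forall x : R, `|u0 x - w0 x| <= a} ->
  exists f g V m M C, [/\ {ae mu, forall x, u0 x = f x}, {ae mu, forall x, w0 x = g x} &
    initial_data a m M C f g V].
Proof.
move=> a0 [f [uf /BV_modulus[V [M [VM hV fV]]]]] [g1 [wg /BV_modulus[V' [M' [VM' hV' gV]]]]] u1 w1 uw.
have a0' := ltW a0.
(* The constraint holds only almost everywhere for [f] and [g1]. Clamping enforces it everywhere,
   changes [g1] only on a null set, and keeps a variation bound since the ends of the clamp move
   with [f]. *)
pose g x := clamp (f x - a) (f x + a) (g1 x).
have wg' : {ae mu, forall x, w0 x = g x}.
  apply: ae_imply (ae_and uf (ae_and wg uw)) => x [-> [wx]]; rewrite wx ler_norml => h.
  by rewrite /g clamp_id//; lra.
have mf : measurable_fun setT f := modulus_measurable hV fV.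
pose V2 x := V x + V' x.
have gV2 x y : y <= x -> `|g x - g y| <= V2 x - V2 y.
  move=> xy; have h1 := fV x y xy; have h2 := gV x y xy.
  have h3 := hV y x xy; have h4 := hV' y x xy.
  by apply: dist_clamp; [apply: le_trans h1 _|apply: le_trans h2 _]; rewrite /V2; lra.
have hV2 : {homo V2 : x y / x <= y} by move=> x y xy; rewrite /V2 lerD ?hV ?hV'.
have mg : measurable_fun setT g := modulus_measurable hV2 gV2.
have fg x : `|f x - g x| <= a.
  have h : f x - a <= f x + a by lra.
  by have := clamp_itv (g1 x) h; rewrite -/(g x) ler_norml; lra.
have fm x : `|f x| <= `|f 0| + M.
  have h : `|f x - f 0| <= M.
    have := VM x; have := VM 0.
    have [x0|/ltW x0] := leP x 0; have := fV _ _ x0; rewrite // 1?distrC; lra.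
  by have := ler_normD (f x - f 0) (f 0); rewrite subrK; lra.
have M0 : 0 <= M by have /andP[h1 h2] := VM 0; exact: le_trans h2.
pose V3 x := V x + V2 x.
have V3M x : 0 <= V3 x <= M + (M + M') by have := VM x; have := VM' x; rewrite /V3 /V2; lra.
have hV3 : {homo V3 : x y / x <= y} by move=> x y xy; rewrite /V3 lerD ?hV ?hV2.
(* [f] oscillates by at most [M] and [g] stays within [a] of it; the last constant bounds [V3],
   which controls [f] and [g] together. *)
exists f, g, V, (`|f 0| + M + a), M, (M + (M + M')); split => //.
split => //.
- by move=> x; apply: le_trans (fm x) _; rewrite lerDl.
- move=> x; have := fg x; have := fm x; have := ler_normB (f x) (f x - g x).
  by rewrite opprB addrC subrK; lra.
- exact: integrable_ae_eq uf u1.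
- exact: integrable_ae_eq wg' w1.
- move=> s s0; apply: le_trans (BV_translate V3M hV3 s0).
  have ms := measurable_shift s.
  apply: le_integral_EFin => //.
  + apply: measurable_funD; (apply: measurableT_comp => //; apply: measurable_funB => //).
    * exact: (measurableT_comp mf ms).
    * exact: (measurableT_comp mg ms).
  + have mV3 : measurable_fun setT V3 by exact: nondecreasing_measurable.
    by apply: measurable_funB => //; exact: (measurableT_comp mV3 ms).
  + move=> x _; have xs : x - s <= x by rewrite gerBl.
    by rewrite distrC [X in _ + X]distrC; have := fV _ _ xs; have := gV2 _ _ xs; rewrite /V3; lra.
Qed.

End InitialData.

(** * Existence from the limit triple and its two measures *)

Unset Implicit Arguments.

Theorem theorem5p4 (R : realType) (a T : R) (ha : 0 < a) (hT : 0 < T)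
    (u0 w0 : R -> R)
    (u0_BV : BV_line u0) (w0_BV : BV_line w0)
    (u0_L1 : leb1.-integrable setT (EFin \o u0))
    (w0_L1 : leb1.-integrable setT (EFin \o w0))
    (u0w0 : {ae leb1, forall x : R, `|u0 x - w0 x| <= a}) :
  exists u w : R * R -> R,
    [/\ leb2.-integrable (strip T) (EFin \o u),
        leb2.-integrable (strip T) (EFin \o w) &
        weak_solution a T u0 w0 u w].
Proof.
pose mu := @lebesgue_measure R.
have [f [g [V [m [M [C [uf wg D]]]]]]] :=
  initial_data_representatives ha u0_BV w0_BV u0_L1 w0_L1 u0w0.
have [mf mg fm gm fg VM fV f1 g1 fgC] := D.
have f2 := integrable_sqr mf fm f1.
have g2 := integrable_sqr mg gm g1.
have f2f := integrable_fin_num measurableT f2.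
have g2f := integrable_fin_num measurableT g2.
have mu0 : measurable_fun setT u0 by apply/measurable_EFinP; exact: measurable_int u0_L1.
have mw0 : measurable_fun setT w0 by apply/measurable_EFinP; exact: measurable_int w0_L1.
have sqr_ae (h k : R -> R) : measurable_fun setT h -> measurable_fun setT k ->
    {ae mu, forall x, k x = h x} -> mu.-integrable setT (fun x => (h x ^+ 2)%:E) ->
    mu.-integrable setT (fun x => (k x ^+ 2)%:E) /\
    (\int[mu]_x (k x ^+ 2)%:E = \int[mu]_x (h x ^+ 2)%:E)%E.
  move=> mh mk kh h2; have mk2 : measurable_fun setT (fun x => k x ^+ 2) by exact: measurable_funX.
  have mh2 : measurable_fun setT (fun x => h x ^+ 2) by exact: measurable_funX.
  split; first by apply: (integrable_ae_eq mk2 _ h2); apply: ae_imply kh => x ->.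
  apply: ae_eq_integral => //; try exact/measurable_EFinP.
  by apply: ae_imply kh => x ->.
have [u2 u2E] := sqr_ae f u0 mf mu0 uf f2.
have [w2 w2E] := sqr_ae g w0 mg mw0 wg g2.
pose E0 := 2^-1 * (fine (\int[mu]_x (f x ^+ 2)%:E) + fine (\int[mu]_x (g x ^+ 2)%:E)).
have E0E : (\int[mu]_x (f x ^+ 2)%:E + \int[mu]_x (g x ^+ 2)%:E = (2 * E0)%:E)%E.
  by rewrite -(fineK f2f) -(fineK g2f) -EFinD; congr EFin; rewrite /E0 mulrA divff// mul1r.
have E0le : (\int[mu]_x (f x ^+ 2 / 2 + g x ^+ 2 / 2)%:E <= E0%:E)%E.
  have sq0 (h : R -> R) x : 0 <= h x ^+ 2 by exact: sqr_ge0.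
  have mf2 : measurable_fun setT (fun x => f x ^+ 2) by exact: measurable_funX.
  have mg2 : measurable_fun setT (fun x => g x ^+ 2) by exact: measurable_funX.
  have mfg2 : measurable_fun setT (fun x => f x ^+ 2 + g x ^+ 2) by exact: measurable_funD.
  rewrite (_ : (\int[mu]_x _)%E = (\int[mu]_x (2^-1 * (f x ^+ 2 + g x ^+ 2))%:E)%E); last first.
    by apply: eq_integral => x _; congr EFin; ring.
  rewrite ge0_integralZl_real//; last by move=> x _; rewrite addr_ge0.
  by rewrite ge0_integralD_real// E0E -EFinM lee_fin mulrA mulVf// mul1r.
have f1n := integrable_abse f1; have g1n := integrable_abse g1.
pose B := fine (\int[mu]_x (`|f x| + `|g x|)%:E).
have BE : (\int[mu]_x (`|f x| + `|g x|)%:E <= B%:E)%E.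
  rewrite /B fineK//; apply: integrable_fin_num => //.
  exact: (integrableD measurableT f1n g1n).
have approx (eps : R) : 0 < eps -> exists u p q, quasi_solution a T m M E0 B f g eps u p q.
  move=> eps0; have [N hN] : exists N, T * (T / N.+1%:R * C) <= eps.
    (* The gap of the interpolated scheme is [T * T * C / N.+1%:R]. *)
    exists (Num.truncn (T * T * C / eps)).
    rewrite (_ : T * _ = T * T * C / (Num.truncn (T * T * C / eps)).+1%:R); last by ring.
    rewrite ler_pdivrMr ?ltr0n// [leRHS]mulrC -ler_pdivrMr//; exact/ltW/truncnS_gt.
  do 3 eexists; apply: (quasi_le hN).
  exact: (quasi_solution_step ha hT mf mg fm gm fg VM fV E0le BE fgC N).
have [u [p [q [[mU mp mq] [um pM qM] [ph qh hE hB] hweak hgap]]]] :=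
  quasi_solution_limit ha hT mg gm approx.
have M0 : 0 <= M by have /andP[h1 h2] := VM 0; exact: le_trans h2.
have E00 : 0 <= E0 by rewrite /E0 mulr_ge0 ?invr_ge0// addr_ge0// fine_ge0// integral_ge0// => x _; rewrite lee_fin sqr_ge0.
(* The dissipation bounds the integral of [p + q] by [a^-1 * E0] at almost every time; monotonicity
   gives it at every time, as [layer_measure] requires. *)
have layer_bound (r : R * R -> R) : measurable_fun setT r -> (forall z, 0 <= r z) ->
    (forall x s t, s <= t -> r (x, s) <= r (x, t)) ->
    (forall z, r z <= p z + q z) -> forall t : R, 0 <= t < T ->
    (\int[mu]_x (r (x, t))%:E <= (a^-1 * E0)%:E)%E.
  move=> mr r0 rh rpq t tT; have [s /andP[ts sT] hs] := ae_later hE tT.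
  have me := measurable_row s (measurable_energy a mg mU mp mq).
  pose e x := u (x, s) ^+ 2 / 2 + (output g p q (x, s) ^+ 2 / 2 + a * (p (x, s) + q (x, s))).
  have e0 x : r (x, t) <= a^-1 * e x.
    rewrite ler_pdivlMl// /e; apply: (@le_trans _ _ (a * (p (x, s) + q (x, s)))).
      by rewrite ler_pM2l//; apply: le_trans (rh x t s ts) (rpq _).
    have := sqr_ge0 (u (x, s)); have := sqr_ge0 (output g p q (x, s)); lra.
  have ae0 x : 0 <= a^-1 * e x by apply: le_trans (e0 x).
  have eg0 x : 0 <= e x by have := ae0 x; rewrite pmulr_rge0// invr_gt0.
  apply: (@le_trans _ _ (\int[mu]_x (a^-1 * e x)%:E)%E).
    apply: le_integral_EFin => //; first exact: measurable_row.
    exact: (measurable_funM (measurable_cst _) me).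
  rewrite ge0_integralZl_real ?invr_ge0 ?(ltW ha)//.
  by rewrite EFinM lee_wpmul2l ?lee_fin ?invr_ge0 ?(ltW ha).
have [nup [nup_dt nup_le]] := layer_measure hT mp pM ph
  (layer_bound p mp (fun z => (andP (pM z)).1) ph (fun z => ler_wpDr (andP (qM z)).1 (lexx _))).
have [nuq [nuq_dt nuq_le]] := layer_measure hT mq qM qh
  (layer_bound q mq (fun z => (andP (qM z)).1) qh (fun z => ler_wpDl (andP (pM z)).1 (lexx _))).
have [P [N nuPN]] := Hahn_decomposition
  (cadd (charge_of_finite_measure nup) (copp (charge_of_finite_measure nuq))).
pose w := output g p q.
have mw : measurable_fun setT w := measurable_output mg mp mq.
have mS : measurable (strip T : set (plane R)) by apply: measurable_rect.
have strip_integrable (h : R * R -> R) : measurable_fun setT h ->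
    (forall z, `|h z| <= `|u z| + `|w z|) -> leb2.-integrable (strip T) (EFin \o h).
  move=> mh hle; have mEh : measurable_fun setT (EFin \o h) by exact/measurable_EFinP.
  apply/integrableP; split; first exact: measurable_funTS.
  apply: (@le_lt_trans _ _ (T * B)%:E); last by rewrite ltry.
  apply: le_trans hB; apply: le_integral_EFin => //.
  - by apply: measurable_funTS; exact: measurableT_comp.
  - by apply: measurable_funTS; apply: measurable_funD; exact: measurableT_comp.
have L1loc (h : R * R -> R) : measurable_fun setT h ->
    leb2.-integrable (strip T) (EFin \o h) -> L1loc_strip T h.
  move=> mh ih; split; first exact: measurable_funTS.
  move=> K cK KT; apply: (@integrableS _ _ _ leb2 (strip T)) => //.
  have /closed_openC/open_measurable_plane/measurableC : closed K.
    by apply: compact_closed cK; exact: norm_hausdorff.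
  by rewrite setCK.
have iu : leb2.-integrable (strip T) (EFin \o u).
  by apply: strip_integrable => // z; rewrite lerDl.
have iw : leb2.-integrable (strip T) (EFin \o w).
  by apply: strip_integrable => // z; rewrite lerDr.
exists u, w; split => //; split.
- exact: L1loc.
- exact: L1loc.
- move=> phi C1; have := hweak phi C1.
  have -> : (\int[mu]_x ((f x + g x) * phi (x, 0))%:E =
      \int[leb1]_x ((u0 x + w0 x) * phi (x, 0))%:E)%E.
    have mphi0 : measurable_fun setT (fun x : R => phi (x, 0)).
      apply: (@measurable_row R phi 0); apply: continuous_measurable_plane.
      by case: C1 => -[].
    apply: ae_eq_integral => //.
    - by apply/measurable_EFinP; apply: measurable_funM => //; exact: measurable_funD.
    - by apply/measurable_EFinP; apply: measurable_funM => //; exact: measurable_funD.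
    - by apply: ae_imply (ae_and uf wg) => x [-> ->].
  (* A vanishing sum of extended reals has finite terms, so the identity passes to the real-valued
     integrals of the definition. *)
  have fine0 (x y : \bar R) : (x + y = 0)%E -> fine x + fine y = 0.
    by case: x y => [x| |] [y| |] //= [].
  exact: fine0.
- exact: hgap.
- exists (cadd (charge_of_finite_measure nup) (copp (charge_of_finite_measure nuq))), P, N, nuPN.
  split.
    exact: (output_distributional_dt hT mg gm mp mq pM qM nup_dt nuq_dt).
  apply: ae_imply hE => t ht; rewrite in_itv/= => /andP[t0 tT].
  have tT' : 0 <= t < T by rewrite (ltW t0).
  have tT'' : 0 < t < T by rewrite t0.
  have mt : measurable (open_strip t : set (plane R)) by apply: measurable_rect.
  apply: (energy_balance ha (measurable_row t mU) (measurable_row t mw)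
    (measurable_row t mp) (measurable_row t mq) _ _ _ _ _ (ht tT')).
  + by move=> x; have /andP[] := pM (x, t).
  + by move=> x; have /andP[] := qM (x, t).
  + exact: u2.
  + exact: w2.
  + by rewrite u2E w2E.
  + by rewrite /charge_variation/= adde_ge0.
  + apply: le_trans (charge_variation_difference nuPN mt) _.
    by apply: leeD; [exact: nup_le|exact: nuq_le].
Qed.
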